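(* Let $d\ge3$ and $1\le k\le d-1$. There is a constant $C>0$, independent of $\Sigma$ and $\lambda$, such that for every totally geodesic submanifold $\Sigma\subset\mathbb{T}^d$ of dimension $k$, every $\lambda>1$ and every eigenfunction $e_\lambda$ on $\mathbb{T}^d$ with $-\Delta e_\lambda=\lambda^2e_\lambda$, $$\|e_\lambda\|_{L^2(\Sigma)}\le C\sqrt{A_{k,d,\lambda}}\,(\log\lambda)^{k/2}\,\|e_\lambda\|_{L^2(\mathbb{T}^d)}.$$ Moreover, there are constants $0<c'\le C'$, independent of $\lambda$, such that for every $\lambda>1$ for which $\lambda^2$ is an eigenvalue of $-\Delta$ on $\mathbb{T}^d$ there exist a totally geodesic submanifold $\Sigma\subset\mathbb{T}^d$ of dimension $k$ and a nonzero eigenfunction $e_\lambda$ (with $-\Delta e_\lambda=\lambda^2e_\lambda$) such that $$c'\sqrt{A_{k,d,\lambda}}\,\|e_\lambda\|_{L^2(\mathbb{T}^d)}\le\|e_\lambda\|_{L^2(\Sigma)}\le C'\sqrt{A_{k,d,\lambda}}\,\|e_\lambda\|_{L^2(\mathbb{T}^d)}.$$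
   Context: $\mathbb{T}^d=\mathbb{R}^d/(2\pi\mathbb{Z})^d$ is the standard flat torus and $\Delta$ its Laplace-Beltrami operator. Eigenfunctions are complex valued; those with $-\Delta e_\lambda=\lambda^2e_\lambda$ are exactly the finite sums $e_\lambda(x)=\sum_{n\in\mathbb{Z}^d,\,|n|=\lambda}c_ne^{in\cdot x}$. Totally geodesic submanifolds are bounded and have unit Hausdorff measure: a totally geodesic submanifold $\Sigma\subset\mathbb{T}^d$ of dimension $k$ is the image in $\mathbb{T}^d$ of a relatively open subset $\tilde\Sigma$ of a $k$-dimensional affine plane in $\mathbb{R}^d$, with $k$-dimensional Hausdorff measure $1$, and contained in a ball of fixed radius $C_0$ (a fixed constant $C_0\ge d$). $L^2(\Sigma)$ is taken with respect to $k$-dimensional Hausdorff measure on $\tilde\Sigma$. Let $\lambda S^{d-1}=\{x\in\mathbb{R}^d:|x|=\lambda\}$. Fix a constant $c_0>0$. For $0\ne u\in\mathbb{R}^d$ and $x_0\in\mathbb{R}^d$, the unit band is $$B(u,x_0)=\Big\{x\in\lambda S^{d-1}:\Big|\frac{u}{|u|}\cdot(x-x_0)\Big|\le c_0\Big\}.$$ $A_{1,d,\lambda}$ is the maximum of $\#(\mathbb{Z}^d\cap B(u,x_0))$ over all $0\neq u\in\mathbb{R}^d$, $x_0\in\mathbb{R}^d$. For $2\le k\le d-1$, bands $B(u_1,x_{01}),\dots,B(u_k,x_{0k})$ are called $\nu_{k,d}$-transverse if $$\frac{|u_1\wedge\cdots\wedge u_k|}{|u_1|\cdots|u_k|}\ge\nu_{k,d},\qquad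 |u_1\wedge\cdots\wedge u_k|=\sqrt{\det[u_i\cdot u_j]_{k\times k}},$$ where $\nu_{k,d}=(d-k+1)^{-k/2}$; and $A_{k,d,\lambda}$ is the maximal number of points of $\mathbb{Z}^d$ in the intersection of $k$ unit bands of $\lambda S^{d-1}$ that are $\nu_{k,d}$-transverse. Constants in the claim may depend on $d$, $k$, $c_0$, $C_0$. *)

(* Defs.v *)
From HB Require Import structures.
From mathcomp Require Import all_boot all_order all_algebra.
From mathcomp Require Import finmap.
From mathcomp Require Import all_classical all_reals all_analysis.
From mathcomp.real_closed Require Import complex.

Set Implicit Arguments.
Unset Strict Implicit.
Unset Printing Implicit Defensive.

Import Order.TTheory GRing.Theory Num.Theory.
Import numFieldNormedType.Exports.

Local Open Scope classical_set_scope.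
Local Open Scope ring_scope.

Section Euclidean.
Context {R : realType} {d : nat}.
Implicit Types x y : 'rV[R]_d.

Definition dot x y : R := \sum_(i < d) x 0 i * y 0 i.

(* The norm `|x| that MathComp-Analysis puts on 'rV[R]_d is the sup norm; it
   induces the usual topology but is not the length of x. *)
Definition enorm x : R := Num.sqrt (dot x x).

Definition wedge_norm {k : nat} (u : 'I_k -> 'rV[R]_d) : R :=
  Num.sqrt (\det (\matrix_(i < k, j < k) dot (u i) (u j))).

Definition of_int (n : 'rV[int]_d) : 'rV[R]_d := map_mx intr n.

Definition integer_points : set 'rV[R]_d := range of_int.

Definition affine_plane (k : nat) (P : set 'rV[R]_d) : Prop :=
  exists (p : 'rV[R]_d) (V : 'M[R]_(k, d)),
    row_free V /\ P = [set p + t *m V | t in [set: 'rV[R]_k]].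

End Euclidean.

Section Hausdorff.
Local Open Scope ereal_scope.

(* Volume of the unit ball of R^k, by |B^(k+2)| = (2 pi / (k+2)) |B^k|. *)
Fixpoint unit_ball_volume (R : realType) (k : nat) : R :=
  match k with
  | 0 => 1
  | 1 => 2
  | k'.+2 => (2 * pi / k'.+2%:R * unit_ball_volume R k')%R
  end.

Lemma unit_ball_volume_ge0 (R : realType) (k : nat) :
  (0 <= unit_ball_volume R k)%R.
Proof.
have [m] := ubnP k; elim: m k => // m IH [|[|k]] //= km.
by rewrite mulr_ge0 ?divr_ge0 ?mulr_ge0 ?pi_ge0 ?IH// ltnW.
Qed.

Context {R : realType} {d : nat}.
Implicit Types (A E : set 'rV[R]_d) (delta : R).

(* 0 is thrown in so that the empty set has diameter 0, not -oo. *)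
Definition diameter A : \bar R :=
  ereal_sup (0 |` [set (enorm (x - y))%:E | x in A & y in A]).

(* The case split only matters for k = 0, where diam(set0)^0 has to be 0. *)
Definition hausdorff_gauge (k : nat) A : \bar R :=
  if A == set0 then 0
  else (unit_ball_volume R k / 2 ^+ k)%:E * diameter A ^+ k.

Definition hausdorff_pre (k : nat) delta E : \bar R :=
  ereal_inf [set \sum_(i <oo) hausdorff_gauge k (U i) |
    U in [set U : (set 'rV[R]_d)^nat |
      E `<=` \bigcup_i U i /\ forall i, diameter (U i) <= delta%:E]].

(* Euclidean k-dimensional Hausdorff outer measure, normalised so as to agree
   with Lebesgue measure on k-planes. *)
Definition hausdorff (k : nat) E : \bar R :=
  ereal_sup [set hausdorff_pre k delta E | delta in [set delta | (0 < delta)%R]].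

Lemma diameter_ge0 A : 0 <= diameter A.
Proof. by apply: ereal_sup_ubound; left. Qed.

Lemma diameter0 : diameter set0 = 0.
Proof.
apply/eqP; rewrite eq_le diameter_ge0 andbT.
by apply: ge_ereal_sup => _ [->//|[x []]].
Qed.

Lemma hausdorff_gauge_ge0 k A : 0 <= hausdorff_gauge k A.
Proof.
rewrite /hausdorff_gauge; case: ifP => // _.
by rewrite mule_ge0 ?expe_ge0 ?diameter_ge0// lee_fin divr_ge0
  ?unit_ball_volume_ge0// exprn_ge0.
Qed.

Lemma hausdorff_gauge0 k : hausdorff_gauge k set0 = 0.
Proof. by rewrite /hausdorff_gauge eqxx. Qed.

Lemma hausdorff_pre_ge0 k delta E : 0 <= hausdorff_pre k delta E.
Proof.
apply: le_ereal_inf_tmp => _ [U _ <-].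
by apply: nneseries_ge0 => n _ _; exact: hausdorff_gauge_ge0.
Qed.

Lemma hausdorff_pre_sigma_subadditive k delta :
  sigma_subadditive (hausdorff_pre k delta).
Proof.
set mu := hausdorff_pre k delta; move=> A.
have [[i ioo]|] := pselect (exists i, mu (A i) = +oo).
  rewrite (eseries_pinfty _ _ ioo) ?leey// => n _.
  by rewrite -ltNye (lt_le_trans _ (hausdorff_pre_ge0 _ _ _)).
rewrite -forallNE => Aoo.
suff add2e (e : {posnum R}) :
    mu (\bigcup_n A n) <= \sum_(i <oo) mu (A i) + e%:num%:E.
  by apply/lee_addgt0Pr => _/posnumP[].
rewrite (le_trans _ (epsilon_trick _ _ _))//; last first.
  by move=> n; exact: hausdorff_pre_ge0.
pose g := @hausdorff_gauge k.
pose P n (B : (set 'rV[R]_d)^nat) :=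
  (A n `<=` \bigcup_i B i /\ forall i, diameter (B i) <= delta%:E) /\
  \sum_(j <oo) g (B j) <= mu (A n) + (e%:num / (2 ^ n.+1)%:R)%:E.
have [G PG] : {G : ((set 'rV[R]_d)^nat)^nat & forall n, P n (G n)}.
  apply: (@choice _ _ P) => n; rewrite /P /mu /hausdorff_pre.
  set S := (X in ereal_inf X); move infS : (ereal_inf S) => iS.
  case: iS infS => [r Sr|Soo|Soo].
  - have en1 : (0 < e%:num / (2 ^ n.+1)%:R)%R by [].
    have /(lb_ereal_inf_adherent en1) : ereal_inf S \is a fin_num by rewrite Sr.
    move=> [x [B [mB AnB] muBx] xS].
    by exists B; split => //; rewrite muBx -Sr; exact/ltW.
  - by have := Aoo n; rewrite /mu /hausdorff_pre Soo.
  - suff : lbound S 0 by move/le_ereal_inf_tmp; rewrite Soo.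
    move=> /= _ [B _ <-]; apply: nneseries_ge0 => m _ _.
    exact: hausdorff_gauge_ge0.
have gG_ge0 x : 0 <= (g \o uncurry G) x by exact: hausdorff_gauge_ge0.
apply: (@le_trans _ _ (\esum_(i in setT) (g \o uncurry G) i)).
  rewrite /mu /hausdorff_pre; apply: ereal_inf_lbound => /=.
  have /card_esym/ppcard_eqP[f] := card_nat2.
  exists (uncurry G \o f).
    split => [|i]; last by rewrite /= /uncurry; case: (f i) => a b; apply: (PG a).1.2.
    apply: (@subset_trans _  (\bigcup_n \bigcup_k G n k)) => [t [i _]|].
      by move=> /((PG i).1.1) -[j _ ?]; exists i => //; exists j.
    move=> t [i _ [j _ Bijt]]; exists (f^-1%FUN (i, j)) => //=.
    by rewrite invK ?inE.
  rewrite -(esum_pred_image (g \o uncurry G) _ xpredT) ?[fun=> _]set_true//.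
  by rewrite image_eq.
rewrite (_ : esum _ _ = \sum_(i <oo) \sum_(j <oo) g (G i j)); last first.
  pose J : nat -> set (nat * nat) := fun i => [set (i, j) | j in setT].
  rewrite (_ : setT = \bigcup_k J k); last first.
    by rewrite predeqE => -[a b]; split => // _; exists a => //; exists b.
  rewrite esum_bigcupT /=; last 2 first.
    - apply/trivIsetP => i j _ _ ij.
      rewrite predeqE => -[n m] /=; split => //= -[] [_] _ [<-{n} _].
      by move=> [m' _] [] /esym/eqP; rewrite (negbTE ij).
    - by move=> /= [n m]; exact: hausdorff_gauge_ge0.
  rewrite -(image_id [set: nat]) -fun_true esum_pred_image//; last first.
    by move=> n _; apply: esum_ge0 => ? _; exact: gG_ge0.
  apply: eq_eseriesr => /= j _.
  rewrite -(esum_pred_image (g \o uncurry G) (pair j) predT)//=.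
  - congr (esum _ _); rewrite predeqE => -[a b].
    by split; move=> [i _ <-]; exists i.
  - by move=> n _; exact: hausdorff_gauge_ge0.
  - by move=> ? ? _ _; exact: (@can_inj _ _ _ snd).
apply: lee_lim.
- apply: is_cvg_nneseries => n *.
  by apply: nneseries_ge0 => m *; exact: (gG_ge0 (n, m)).
- by apply: is_cvg_nneseries => n *; apply: adde_ge0 => //; exact: hausdorff_pre_ge0.
- by near=> n; apply: lee_sum => i _; exact: (PG i).2.
Unshelve. all: by end_near. Qed.

Lemma hausdorff0 k : hausdorff k set0 = 0.
Proof.
apply/eqP; rewrite eq_le; apply/andP; split; last first.
  apply: le_trans (hausdorff_pre_ge0 k 1 set0) _.
  by apply: ereal_sup_ubound; exists 1%R => //=.
apply: ge_ereal_sup => _ [delta /= delta0 <-].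
apply: ereal_inf_lbound; exists (fun=> set0).
  by split=> // i; rewrite diameter0 lee_fin ltW.
by rewrite eseries0// => i _ _; exact: hausdorff_gauge0.
Qed.

Lemma hausdorff_ge0 k E : 0 <= hausdorff k E.
Proof.
apply: le_trans (hausdorff_pre_ge0 k 1 E) _.
by apply: ereal_sup_ubound; exists 1%R => //=.
Qed.

Lemma le_hausdorff k : {homo hausdorff k : A B / A `<=` B >-> A <= B}.
Proof.
move=> A B AB; apply: ge_ereal_sup => _ [delta /= delta0 <-].
apply: (@le_trans _ _ (hausdorff_pre k delta B)); last first.
  by apply: ereal_sup_ubound; exists delta.
apply: ereal_inf_le_tmp => _ [U [BU Udelta] <-].
by exists U => //; split=> //; exact: subset_trans BU.
Qed.

Lemma hausdorff_sigma_subadditive k : sigma_subadditive (hausdorff k).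
Proof.
move=> F; apply: ge_ereal_sup => _ [delta /= delta0 <-].
apply: le_trans (hausdorff_pre_sigma_subadditive _ _ _) _.
apply: lee_nneseries => [i _ _|i _]; first exact: hausdorff_pre_ge0.
by apply: ereal_sup_ubound; exists delta.
Qed.

HB.instance Definition _ (k : nat) := isOuterMeasure.Build R 'rV[R]_d
  (hausdorff k) (hausdorff0 k) (hausdorff_ge0 k) (@le_hausdorff k)
  (@hausdorff_sigma_subadditive k).

Definition hausdorff_outer (k : nat) : {outer_measure set 'rV[R]_d -> \bar R} :=
  hausdorff k.

(* The measure that H^k induces on its Caratheodory-measurable sets. *)
Definition hausdorff_measure (k : nat) :
    {measure set (caratheodory_type (hausdorff_outer k)) -> \bar R} :=
  (hausdorff_outer k : set (caratheodory_type (hausdorff_outer k)) -> \bar R).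

Definition L2_norm (k : nat) (A : set 'rV[R]_d) (f : 'rV[R]_d -> R[i]) : \bar R :=
  'N[hausdorff_measure k]_2%:E
    [(fun x => (ComplexField.Normc.normc (f x))%:E) \_ A].

End Hausdorff.

Section Torus.
Context {R : realType} {d : nat}.
Implicit Types (f : 'rV[R]_d -> R) (e : 'rV[R]_d -> R[i]).

(* Functions on T^d are (2 pi Z)^d-periodic functions on R^d. *)
Definition torus_periodic e : Prop :=
  forall (n : 'rV[int]_d) x, e (x + (2 * pi) *: of_int n) = e x.

Definition fundamental_domain : set 'rV[R]_d :=
  [set x | forall i, 0 <= x 0 i < 2 * pi].

(* The Riemannian volume of T^d is its d-dimensional Hausdorff measure. *)
Definition L2_norm_torus e : \bar R := L2_norm d fundamental_domain e.

Definition partial (j : 'I_d) f : 'rV[R]_d -> R :=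
  fun x => 'D_(delta_mx 0 j : 'rV[R]_d) f x.

Definition C1 f : Prop :=
  continuous f /\
  forall j, (forall x, derivable f x (delta_mx 0 j : 'rV[R]_d)) /\
            continuous (partial j f).

Definition C2 f : Prop := C1 f /\ forall j, C1 (partial j f).

Definition laplacian f : 'rV[R]_d -> R :=
  fun x => \sum_(j < d) partial j (partial j f) x.

Definition complex_laplacian e : 'rV[R]_d -> R[i] := fun x =>
  Complex (laplacian (fun y => complex.Re (e y)) x)
          (laplacian (fun y => complex.Im (e y)) x).

(* - Delta e = mu e on T^d; the zero function is allowed. *)
Definition eigenfunction (mu : R) e : Prop :=
  [/\ torus_periodic e,
      C2 (fun x => complex.Re (e x)),
      C2 (fun x => complex.Im (e x)) &
      forall x, - complex_laplacian e x = Complex mu 0 * e x].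

Definition nonzero e : Prop := exists x, e x != 0.

Definition eigenvalue_of_torus (mu : R) : Prop :=
  exists e, eigenfunction mu e /\ nonzero e.

(* S is the relatively open piece of a k-plane in R^d whose image in T^d is the
   submanifold. *)
Definition totally_geodesic (k : nat) (C0 : R) (S : set 'rV[R]_d) : Prop :=
  [/\ exists P O, [/\ affine_plane k P, open O & S = P `&` O],
      hausdorff k S = 1%E &
      exists p, forall x, S x -> enorm (x - p) <= C0].

End Torus.

Section Bands.
Context {R : realType} {d : nat}.

Definition band (c0 lambda : R) (u x0 : 'rV[R]_d) : set 'rV[R]_d :=
  [set x | enorm x = lambda /\ `|dot ((enorm u)^-1 *: u) (x - x0)| <= c0].

Definition transverse (k : nat) (u : 'I_k -> 'rV[R]_d) : Prop :=
  wedge_norm u / \prod_(i < k) enorm (u i) >=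
  (d - k + 1)%:R `^ (- (k%:R / 2)).

Definition band_configuration (k : nat) (u : 'I_k -> 'rV[R]_d) : Prop :=
  (forall i, u i != 0) /\ ((2 <= k)%N -> transverse u).

Definition band_count (k : nat) (c0 lambda : R) (u x0 : 'I_k -> 'rV[R]_d) : nat :=
  #|` fset_set (integer_points `&` \bigcap_i band c0 lambda (u i) (x0 i))|.

(* The counts are bounded by the number of integer points on the sphere of
   radius lambda, so for 1 <= k <= d this supremum is a maximum. *)
Definition band_max (k : nat) (c0 lambda : R) : R :=
  sup [set m | exists u x0 : 'I_k -> 'rV[R]_d,
    band_configuration u /\ m = (band_count c0 lambda u x0)%:R].

End Bands.
Arguments band_max {R} d k c0 lambda.

(* Main.v *)
(* Upper bound: every real eigenfunction is a finite sum of the waves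
   a_n cos (n.x) + b_n sin (n.x) over the lattice points of the sphere, because
   it is orthogonal to all other waves and the waves are complete.  Put on the
   plane of Sigma a product of smooth bumps in orthonormal coordinates; the
   integral of cos (xi.x) against it decays like prod_j 1 / (1 + (xi.v_j)^2)
   along the axes v_j.  By Schur's test the squared norm is at most the largest
   row sum of prod_j 1 / (1 + ((m - n).v_j)^2), and sorting n by the integer
   parts of (m - n).v_j / (2 c0) puts each class into k orthogonal bands, so
   that the row sum is O(A_k).  No power of log is lost; the one in the claim is
   harmless since lambda^2 >= 2.

   Sharpness: take e = sum exp (i n.x) over the N lattice points of an almost
   maximal intersection of transverse bands, and for Sigma a disc centred at 0
   in the span of their normals u_i.  The Gram determinant is bounded below, so
   |(m - n).x| = O(|x|) on that span, hence |e|^2 >= N^2 / 2 near 0, while the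
   squared norm of e on the torus is N times the volume. *)

Require Import Defs.
From HB Require Import structures.
From mathcomp Require Import all_boot all_order all_algebra.
From mathcomp Require Import fingroup perm finmap.
From mathcomp Require Import all_classical all_reals all_analysis.
From mathcomp.real_closed Require Import complex.
From mathcomp Require Import measurable_realfun zify lra ring.

Import Order.TTheory GRing.Theory Num.Theory.
Import numFieldNormedType.Exports.

Local Open Scope classical_set_scope.
Local Open Scope ring_scope.

Set Implicit Arguments.
Unset Strict Implicit.
Unset Printing Implicit Defensive.

(** * Hausdorff measure and Lipschitz maps *)

(** A sharp cutoff to Sigma would decay only like 1 / |xi_j| along each axis, and the harmonic sums
    over the band classes would cost one logarithm per axis in the squared norm, hence (log
    lambda)^(k/2). The bumps decay like 1 / xi_j^2, whose sums converge.

    The obstacle is that Hausdorff measure is given by coverings, and neither Fubini's theorem nor a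
    change of variables is established for it on k-planes. Everything is drawn from its behaviour
    under Lipschitz maps and scalings, its finiteness and positivity on cubes, the measurability of
    open sets, and translation invariance. Integration by parts is therefore replaced by
    translations: a shift by half a wavelength reverses the sign of a wave. On the torus this gives
    the vanishing of the mean of a wave; on the plane, shifting both ways turns a bump into its
    second difference and so produces the decay. Green's identity on the torus likewise comes from
    difference quotients. *)

Lemma continuous_sum {R : realType} {T : topologicalType} (I : Type) (r : seq I) (P : pred I)
    (F : I -> T -> R) :
  (forall i, P i -> continuous (F i)) -> continuous (fun x => \sum_(i <- r | P i) F i x).
Proof.
move=> cF; elim: r => [|i r IH].
  have -> : (fun x => \sum_(i <- [::] | P i) F i x) = cst 0 :> (T -> R).
    by apply/funext => x; rewrite big_nil.
  exact: cst_continuous.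
have -> : (fun x => \sum_(j <- i :: r | P j) F j x) =
    (fun x => (if P i then F i x else 0) + \sum_(j <- r | P j) F j x).
  by apply/funext => x; rewrite big_cons; case: ifP => _; rewrite ?add0r.
move=> x; apply: continuousD; last exact: IH.
case Pi: (P i); [exact: cF|exact: cst_continuous].
Qed.

Lemma continuous_prod {R : realType} {T : topologicalType} (I : Type) (r : seq I) (P : pred I)
    (F : I -> T -> R) :
  (forall i, P i -> continuous (F i)) -> continuous (fun x => \prod_(i <- r | P i) F i x).
Proof.
move=> cF; elim: r => [|i r IH].
  have -> : (fun x => \prod_(i <- [::] | P i) F i x) = cst 1 :> (T -> R).
    by apply/funext => x; rewrite big_nil.
  exact: cst_continuous.
have -> : (fun x => \prod_(j <- i :: r | P j) F j x) =
    (fun x => (if P i then F i x else 1) * \prod_(j <- r | P j) F j x).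
  by apply/funext => x; rewrite big_cons; case: ifP => _; rewrite ?mul1r.
move=> x; apply: continuousM; last exact: IH.
case Pi: (P i); [exact: cF|exact: cst_continuous].
Qed.

Section EuclideanFacts.
Context {R : realType} {d : nat}.
Implicit Types x y z : 'rV[R]_d.

Lemma dotC x y : dot x y = dot y x.
Proof. by apply: eq_bigr => i _; rewrite mulrC. Qed.

Lemma dotDl x y z : dot (x + y) z = dot x z + dot y z.
Proof. by rewrite -big_split; apply: eq_bigr => i _; rewrite mxE mulrDl. Qed.

Lemma dotZl (a : R) x z : dot (a *: x) z = a * dot x z.
Proof. by rewrite /dot mulr_sumr; apply: eq_bigr => i _; rewrite mxE mulrA. Qed.

Lemma dotNl x z : dot (- x) z = - dot x z.
Proof. by rewrite -scaleN1r dotZl mulN1r. Qed.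

Lemma dotBl x y z : dot (x - y) z = dot x z - dot y z.
Proof. by rewrite dotDl dotNl. Qed.

Lemma dotDr x y z : dot z (x + y) = dot z x + dot z y.
Proof. by rewrite dotC dotDl !(dotC z). Qed.

Lemma dotZr (a : R) x z : dot z (a *: x) = a * dot z x.
Proof. by rewrite dotC dotZl (dotC z). Qed.

Lemma dotNr x z : dot z (- x) = - dot z x.
Proof. by rewrite dotC dotNl (dotC z). Qed.

Lemma dotBr x y z : dot z (x - y) = dot z x - dot z y.
Proof. by rewrite dotDr dotNr. Qed.

Lemma dot0l x : dot 0 x = 0.
Proof. by rewrite -[0 in LHS](scale0r 0) dotZl mul0r. Qed.

Lemma dot0r x : dot x 0 = 0.
Proof. by rewrite dotC dot0l. Qed.

Lemma dot_ge0 x : 0 <= dot x x.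
Proof. by apply: sumr_ge0 => i _; rewrite -expr2 sqr_ge0. Qed.

Lemma dot_delta (j : 'I_d) x : dot x (delta_mx 0 j) = x 0 j.
Proof.
rewrite /dot (bigD1 j)//= big1 ?addr0 => [|i ij]; rewrite !mxE !eqxx ?mulr1//.
by rewrite (negbTE ij) mulr0.
Qed.

Lemma sqr_enorm x : enorm x ^+ 2 = dot x x.
Proof. by rewrite sqr_sqrtr ?dot_ge0. Qed.

Lemma enorm_ge0 x : 0 <= enorm x.
Proof. exact: sqrtr_ge0. Qed.

Lemma enorm0 : enorm (0 : 'rV[R]_d) = 0.
Proof. by rewrite /enorm dot0l sqrtr0. Qed.

Lemma enorm_eq0 x : (enorm x == 0) = (x == 0).
Proof.
apply/eqP/eqP => [x0|->]; last exact: enorm0.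
have : dot x x = 0 by rewrite -sqr_enorm x0 expr0n.
move/eqP; rewrite psumr_eq0; last by move=> i _; rewrite -expr2 sqr_ge0.
move/allP => h; apply/rowP => i; rewrite mxE.
by have := h i (mem_index_enum _); rewrite /= -expr2 sqrf_eq0 => /eqP.
Qed.

Lemma enorm_gt0 x : (0 < enorm x) = (x != 0).
Proof. by rewrite lt_neqAle eq_sym enorm_eq0 enorm_ge0 andbT. Qed.

Lemma enormZ (a : R) x : enorm (a *: x) = `|a| * enorm x.
Proof.
by rewrite /enorm dotZl dotZr mulrA -expr2 sqrtrM ?sqr_ge0// sqrtr_sqr.
Qed.

Lemma sqr_dot_le x y : dot x y ^+ 2 <= dot x x * dot y y.
Proof.
have [/eqP|y0] := eqVneq (enorm y) 0.
  by rewrite enorm_eq0 => /eqP ->; rewrite !dot0r expr0n mulr0.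
have yy : 0 < dot y y by rewrite -sqr_enorm exprn_gt0// lt_neqAle eq_sym y0 enorm_ge0.
have := dot_ge0 (dot y y *: x - dot x y *: y).
rewrite dotBl !dotBr !dotZl !dotZr (dotC y x).
set a := dot x x; set b := dot x y; set c := dot y y in yy *.
have -> : c * (c * a) - c * (b * b) - (b * (c * b) - b * (b * c)) = c * (a * c - b ^+ 2) by ring.
by rewrite pmulr_rge0// subr_ge0.
Qed.

Lemma dot_le x y : `|dot x y| <= enorm x * enorm y.
Proof.
rewrite -sqrtr_sqr -sqrtrM ?dot_ge0//; exact/ler_wsqrtr/sqr_dot_le.
Qed.

Lemma ler_enormD x y : enorm (x + y) <= enorm x + enorm y.
Proof.
rewrite -(@ler_pXn2r _ 2)// ?nnegrE ?enorm_ge0 ?addr_ge0 ?enorm_ge0//.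
rewrite sqr_enorm dotDl !dotDr (dotC y x) sqrrD !sqr_enorm.
have := le_trans (ler_norm _) (dot_le x y); lra.
Qed.

Lemma enorm_triangle z x y : enorm (x - y) <= enorm (x - z) + enorm (z - y).
Proof. by rewrite -[X in enorm X](@subrKA _ z) ler_enormD. Qed.

Lemma ler_coord_enorm x i : `|x 0 i| <= enorm x.
Proof.
rewrite -dot_delta (le_trans (dot_le _ _))// ler_piMr ?enorm_ge0//.
by rewrite /enorm dot_delta mxE !eqxx sqrtr1.
Qed.

Lemma enorm_le_coord x (L : R) : (forall i, `|x 0 i| <= L) ->
  0 <= L -> enorm x <= Num.sqrt d%:R * L.
Proof.
move=> h L0; rewrite -[in leRHS](ger0_norm L0) -sqrtr_sqr -sqrtrM ?ler0n//.
apply: ler_wsqrtr; apply: (@le_trans _ _ (\sum_(i < d) L ^+ 2)).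
  rewrite /dot; apply: ler_sum => i _; rewrite -expr2 -[leLHS]real_normK ?num_real//.
  by rewrite ler_pXn2r ?nnegrE.
by rewrite sumr_const card_ord mulr_natl.
Qed.

(** The topology comes from the sup norm, which the Euclidean norm dominates, so a sup-ball contains
    the Euclidean ball of the same radius. *)
Lemma nbhs_enorm x (A : set 'rV[R]_d) : nbhs x A ->
  exists2 r : R, 0 < r & forall y, enorm (x - y) < r -> A y.
Proof.
move=> /nbhs_ballP[r r0 rA]; exists r => // y xy; apply: rA; split=> // i j.
rewrite (ord1 i) /ball /=; apply: le_lt_trans xy.
by have := ler_coord_enorm (x - y) j; rewrite !mxE.
Qed.

Lemma continuous_dotr x : continuous (fun y : 'rV[R]_d => dot x y).
Proof.
apply: continuous_sum => i _ y.
apply: (@continuousM R _ (cst (x 0 i)) (fun y : 'rV[R]_d => y 0 i)).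
  exact: cst_continuous.
exact: coord_continuous.
Qed.

Lemma continuous_dot_self : continuous (fun y : 'rV[R]_d => dot y y).
Proof.
apply: continuous_sum => i _ y.
by apply: (@continuousM R _ (fun y : 'rV[R]_d => y 0 i)); exact: coord_continuous.
Qed.

Lemma continuous_enorm : continuous (@enorm R d).
Proof.
move=> x; apply: (@continuous_comp _ _ _ (fun y => dot y y) Num.sqrt).
  exact: continuous_dot_self.
exact: sqrt_continuous.
Qed.

End EuclideanFacts.

Section HausdorffFacts.
Context {R : realType}.
Local Open Scope ereal_scope.

Lemma diameter_le {d} (A : set 'rV[R]_d) (r : R) : (0 <= r)%R ->
  (forall x y, A x -> A y -> (enorm (x - y) <= r)%R) -> diameter A <= r%:E.
Proof.
move=> r0 Ar; apply: ge_ereal_sup => _ [->|[x Ax [y Ay <-]]]; rewrite lee_fin//.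
exact: Ar.
Qed.

Lemma enorm_le_diameter {d} (A : set 'rV[R]_d) x y : A x -> A y ->
  (enorm (x - y))%:E <= diameter A.
Proof. by move=> Ax Ay; apply: ereal_sup_ubound; right; exists x => //; exists y. Qed.

Lemma diameter_image_le {a b} (f : 'rV[R]_a -> 'rV[R]_b) (L : R) (A : set 'rV[R]_a) :
  (0 < L)%R -> (forall x y, enorm (f x - f y) <= L * enorm (x - y))%R ->
  diameter (f @` A) <= L%:E * diameter A.
Proof.
move=> L0 fL; apply: ge_ereal_sup => _ [->|[_ [x Ax <-] [_ [y Ay <-] <-]]].
  by rewrite mule_ge0 ?diameter_ge0// lee_fin ltW.
apply: (@le_trans _ _ (L * enorm (x - y))%:E); first by rewrite lee_fin.
by rewrite EFinM lee_pmul2l// enorm_le_diameter.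
Qed.

Lemma le_expe (x y : \bar R) n : 0 <= x -> x <= y -> x ^+ n <= y ^+ n.
Proof.
move=> x0 xy; elim: n => [|n IH]; first by rewrite !expe0.
by rewrite !expeS lee_pmul// expe_ge0.
Qed.

Lemma mule_expe (L : R) (x : \bar R) n : (0 < L)%R -> 0 <= x ->
  (L%:E * x) ^+ n = (L ^+ n)%:E * x ^+ n.
Proof.
move=> L0 x0; elim: n => [|n IH]; first by rewrite !expe0 expr0 mule1.
rewrite !expeS IH exprS EFinM !muleA; congr (_ * _).
by rewrite -!muleA; congr (_ * _); rewrite muleC.
Qed.

Lemma hausdorff_gauge_image_le {a b} k (f : 'rV[R]_a -> 'rV[R]_b) (L : R) (A : set 'rV[R]_a) :
  (0 < L)%R -> (forall x y, enorm (f x - f y) <= L * enorm (x - y))%R ->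
  hausdorff_gauge k (f @` A) <= (L ^+ k)%:E * hausdorff_gauge k A.
Proof.
move=> L0 fL; rewrite /hausdorff_gauge; case: (eqVneq A set0) => [->|A0].
  by rewrite image_set0 eqxx mule0.
rewrite ifF; last by apply: contra_neqF A0 => /eqP /image_set0_set0.
rewrite muleCA lee_wpmul2l//; first by rewrite lee_fin divr_ge0 ?unit_ball_volume_ge0 ?exprn_ge0.
rewrite -mule_expe// ?diameter_ge0//; apply: le_expe; last exact: diameter_image_le.
exact: diameter_ge0.
Qed.

Lemma hausdorff_image_le {a b} k (f : 'rV[R]_a -> 'rV[R]_b) (L : R) (E : set 'rV[R]_a) :
  (0 < L)%R -> (forall x y, enorm (f x - f y) <= L * enorm (x - y))%R ->
  hausdorff k (f @` E) <= (L ^+ k)%:E * hausdorff k E.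
Proof.
move=> L0 fL; apply: ge_ereal_sup => _ [delta /= d0 <-].
have Lk : (0 < L ^+ k)%R by rewrite exprn_gt0.
(* A cover of E of mesh delta / L is carried by f to a cover of mesh delta. *)
apply: (@le_trans _ _ ((L ^+ k)%:E * hausdorff_pre k (delta / L) E)); last first.
  rewrite lee_pmul2l//; apply: ereal_sup_ubound; exists (delta / L)%R => //=.
  by rewrite divr_gt0.
rewrite -lee_pdivrMl//; apply: le_ereal_inf_tmp => _ [U [EU Ud] <-].
rewrite lee_pdivrMl// -nneseriesZl//; last by move=> i _; exact: hausdorff_gauge_ge0.
apply: (@le_trans _ _ (\sum_(i <oo) hausdorff_gauge k (f @` U i))).
  apply: ereal_inf_lbound; exists (fun i => f @` U i) => //; split.
    by move=> _ [x /EU[i _ Ux] <-]; exists i => //; exists x.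
  move=> i; apply: le_trans (diameter_image_le _ L0 fL) _.
  apply: (@le_trans _ _ (L%:E * (delta / L)%:E)); first by rewrite lee_pmul2l.
  by rewrite -EFinM mulrC divfK// gt_eqF.
apply: lee_nneseries => [i _ _|i _]; first exact: hausdorff_gauge_ge0.
exact: hausdorff_gauge_image_le.
Qed.

(** A 1-Lipschitz left inverse suffices; for the embedding of a plane it is the orthogonal
    projection, which is no isometry on the whole space. *)
Lemma hausdorff_isometry {a b} k (f : 'rV[R]_a -> 'rV[R]_b) (g : 'rV[R]_b -> 'rV[R]_a)
    (E : set 'rV[R]_a) :
  (forall x y, enorm (f x - f y) <= enorm (x - y))%R ->
  (forall x y, enorm (g x - g y) <= enorm (x - y))%R -> cancel f g ->
  hausdorff k (f @` E) = hausdorff k E.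
Proof.
move=> f1 g1 fg; apply/eqP; rewrite eq_le; apply/andP; split.
  have := @hausdorff_image_le _ _ k f 1 E ltr01.
  by rewrite expr1n mul1e; apply=> x y; rewrite mul1r.
have := @hausdorff_image_le _ _ k g 1 (f @` E) ltr01.
rewrite expr1n mul1e image_comp (_ : g \o f = id) ?image_id; last exact/funext.
by apply=> x y; rewrite mul1r.
Qed.

Lemma hausdorff_translate {d} k (v : 'rV[R]_d) (E : set 'rV[R]_d) :
  hausdorff k [set (x + v)%R | x in E] = hausdorff k E.
Proof.
apply: (@hausdorff_isometry _ _ _ _ (fun x => x - v)%R) => [x y|x y|x].
- by rewrite opprD addrACA subrr addr0.
- by rewrite opprB addrA subrK.
- by rewrite /= addrK.
Qed.

Lemma hausdorff_scale {d} k (L : R) (E : set 'rV[R]_d) : (0 < L)%R ->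
  hausdorff k [set (L *: x)%R | x in E] = (L ^+ k)%:E * hausdorff k E.
Proof.
move=> L0; have key (M : R) (F : set 'rV[R]_d) : (0 < M)%R ->
    hausdorff k [set (M *: x)%R | x in F] <= (M ^+ k)%:E * hausdorff k F.
  move=> M0; apply: hausdorff_image_le => // x y.
  by rewrite -scalerBr enormZ gtr0_norm.
apply/eqP; rewrite eq_le key//= -lee_pdivlMl ?exprn_gt0//.
have := @key L^-1%R [set (L *: x)%R | x in E]; rewrite invr_gt0 => /(_ L0).
rewrite image_comp (_ : _ \o _ = id) ?image_id ?exprVn//.
by apply/funext => x /=; rewrite scalerA mulVf ?scale1r// gt_eqF.
Qed.

Lemma hausdorff_pre_le_hausdorff {d} k (delta : R) (E : set 'rV[R]_d) : (0 < delta)%R ->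
  hausdorff_pre k delta E <= hausdorff k E.
Proof. by move=> ?; apply: ereal_sup_ubound; exists delta. Qed.

Lemma le_hausdorff_pre {d} k (delta delta' : R) (E : set 'rV[R]_d) : (delta <= delta')%R ->
  hausdorff_pre k delta' E <= hausdorff_pre k delta E.
Proof.
move=> dd; apply: ereal_inf_le_tmp => _ [U [EU Ud] <-]; exists U => //.
by split=> // i; rewrite (le_trans (Ud i))// lee_fin.
Qed.

Lemma hausdorff_pre_separated {d} k (rho delta : R) (A B : set 'rV[R]_d) :
  (delta < rho)%R -> (forall x y, A x -> B y -> (rho <= enorm (x - y))%R) ->
  hausdorff_pre k delta A + hausdorff_pre k delta B <= hausdorff_pre k delta (A `|` B).
Proof.
move=> dr AB; apply: le_ereal_inf_tmp => _ [U [ABU Ud] <-].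
(* A set of diameter at most delta < rho cannot meet both A and B, so the sets meeting A and those
   meeting B use up different terms of the cover. *)
pose V (X : set 'rV[R]_d) i := if U i `&` X == set0 then set0 else U i.
have VX X : X `<=` A `|` B -> hausdorff_pre k delta X <= \sum_(i <oo) hausdorff_gauge k (V X i).
  move=> XAB; apply: ereal_inf_lbound; exists (V X) => //; split.
    move=> x Xx; have [i _ Ux] := ABU _ (XAB _ Xx); exists i => //.
    rewrite /V ifF//; apply/negbTE/set0P; by exists x.
  by move=> i; rewrite /V; case: ifP => _ //; rewrite diameter0 (le_trans _ (Ud i)) ?diameter_ge0.
apply: le_trans (leeD (VX A _) (VX B _)) _; [by left|by right|].
rewrite -nneseriesD; do ?[by move=> i _ _; exact: hausdorff_gauge_ge0].
apply: lee_nneseries => [i _ _|i _].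
  by rewrite adde_ge0// hausdorff_gauge_ge0.
rewrite /V; case: ifPn => [_|/set0P[x [Ux Ax]]]; case: ifPn => [_|/set0P[y [Uy By]]];
  rewrite ?hausdorff_gauge0 ?add0e ?adde0 ?hausdorff_gauge_ge0//.
have := le_trans (enorm_le_diameter _ _) (Ud i); move=> /(_ _ _ Ux Uy).
by rewrite lee_fin leNgt (lt_le_trans dr)// AB.
Qed.

Lemma hausdorff_separated {d} k (rho : R) (A B : set 'rV[R]_d) : (0 < rho)%R ->
  (forall x y, A x -> B y -> (rho <= enorm (x - y))%R) ->
  hausdorff k A + hausdorff k B <= hausdorff k (A `|` B).
Proof.
move=> r0 AB; set h := hausdorff k (A `|` B).
have hA : hausdorff k A <= h by apply: le_hausdorff => x; left.
have hB : hausdorff k B <= h by apply: le_hausdorff => x; right.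
have [hoo|hoo] := eqVneq h +oo; first by rewrite hoo leey.
have fin (x : \bar R) : 0 <= x -> x <= h -> x \is a fin_num.
  by move=> x0 xh; rewrite ge0_fin_numE// (le_lt_trans xh)// ltey.
(* The suprema for A and for B are independent, so two meshes must be allowed; passing to a common
   smaller mesh m < rho only increases both terms. *)
have key (e e' : R) : (0 < e)%R -> (0 < e')%R ->
    hausdorff_pre k e A + hausdorff_pre k e' B <= h.
  move=> e0 e0'; pose m : R := Num.min (Num.min e e') (rho / 2)%R.
  have m0 : (0 < m)%R by rewrite !lt_min e0 e0' divr_gt0.
  have me : (m <= e)%R by rewrite !ge_min lexx.
  have me' : (m <= e')%R by rewrite !ge_min lexx orbT.
  have mr : (m < rho)%R by rewrite gt_min ltr_pdivrMr// ltr_pMr// ltr1n orbT.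
  apply: le_trans (leeD (le_hausdorff_pre _ _ me) (le_hausdorff_pre _ _ me')) _.
  exact: le_trans (hausdorff_pre_separated _ mr AB) (hausdorff_pre_le_hausdorff _ _ m0).
rewrite -leeBrDr; last exact: fin (hausdorff_ge0 _ _) hB.
apply: ge_ereal_sup => _ [e /= e0 <-].
have eA : hausdorff_pre k e A \is a fin_num.
  by apply: fin; [exact: hausdorff_pre_ge0|exact: le_trans (hausdorff_pre_le_hausdorff _ _ e0) hA].
rewrite leeBrDr; last exact: fin (hausdorff_ge0 _ _) hB.
rewrite -leeBrDl//; apply: ge_ereal_sup => _ [e' /= e0' <-].
by rewrite leeBrDl// key.
Qed.

(* Caratheodory's criterion: the layers between consecutive distances to the
   complement are separated two steps apart, so their measures are summable. *)
Lemma hausdorff_open_caratheodory {d} k (G : set 'rV[R]_d) : open G ->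
  (hausdorff_outer k).-caratheodory G.
Proof.
move=> oG; apply: le_caratheodory_measurable => X /=.
pose r (n : nat) : R := (n.+1%:R^-1)%R.
have r0 n : (0 < r n)%R by rewrite invr_gt0.
have rS n : (r n.+1 < r n)%R by rewrite ltf_pV2 ?posrE// ltr_nat.
pose H n := [set x | forall z, ~ G z -> (r n <= enorm (x - z))%R].
have HS n : H n `<=` H n.+1 by move=> x Hx z /Hx; apply: le_trans; exact: ltW.
have Hle m n : (m <= n)%N -> H m `<=` H n.
  by move=> /subnKC <-; elim: (n - m)%N => [|p IH]; rewrite ?addn0// addnS => x /IH/HS.
have HG n : H n `<=` G.
  by move=> x Hx; apply: contrapT => /Hx; rewrite subrr enorm0 leNgt r0.
have GH : G = \bigcup_n H n.
  apply/seteqP; split=> [x Gx|x [n _ /HG]//].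
  have /nbhs_enorm[e e0 eG] := open_nbhs_nbhs (conj oG Gx).
  have [n _ ne] := near_infty_natSinv_lt (PosNum e0).
  exists n => // z nGz; rewrite leNgt; apply/negP => xz; apply: nGz; apply: eG.
  by rewrite (lt_trans xz)//; exact: (ne n (leqnn n)).
have [->|] := eqVneq (hausdorff k X) +oo; first by rewrite leey.
rewrite -ltey => Xoo.
have sub_oo (A : set 'rV[R]_d) : A `<=` X -> hausdorff k A \is a fin_num.
  move=> AX; rewrite ge0_fin_numE ?hausdorff_ge0//.
  by apply: le_lt_trans Xoo; exact: le_hausdorff.
have sep n x y : H n x -> ~ H n.+1 y -> (r n - r n.+1 <= enorm (x - y))%R.
  move=> Hx; rewrite -existsNE => -[z /not_implyP[nGz /negP]]; rewrite -ltNge => yz.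
  have := le_trans (Hx _ nGz) (enorm_triangle y x z); lra.
have dr n : (0 < r n - r n.+1)%R by rewrite subr_gt0.
pose D n := X `&` (H n.+2 `\` H n.+1).
(* Layers two apart are separated, hence additive; b picks the parity. The even and the odd layers
   each sum to at most the measure of X. *)
have Dsum b n : \sum_(i < n) hausdorff k (D (i.*2 + b)%N) <=
    hausdorff k (X `&` H (n.*2 + b)%N).
  elim: n => [|n IH]; first by rewrite big_ord0 hausdorff_ge0.
  rewrite big_ord_recr/=; apply: le_trans (leeD2r _ IH) _.
  apply: le_trans (hausdorff_separated k (dr (n.*2 + b)%N) _) _.
    by move=> x y [_ Hx] [_ [_ Hy]]; exact: sep Hx Hy.
  apply: le_hausdorff => x [[Xx /HS/HS Hx]|[Xx [Hx _]]]; split=> //.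
have DX n : \sum_(i < n) hausdorff k (D i) <= hausdorff k X + hausdorff k X.
  apply: (@le_trans _ _ (\sum_(i < n.*2) hausdorff k (D i))).
    rewrite -!(big_mkord xpredT (fun i => hausdorff k (D i))).
    apply: lee_sum_nneg_natr => // [i _ _|]; first exact: hausdorff_ge0.
    by rewrite -addnn leq_addr.
  have even_odd (a : nat -> \bar R) : \sum_(i < n.*2) a i =
      \sum_(i < n) a (i.*2 + 0)%N + \sum_(i < n) a (i.*2 + 1)%N.
    elim: n => [|n IH]; first by rewrite !big_ord0 add0e.
    by rewrite doubleS !big_ord_recr/= IH addn0 addn1 -!addeA; congr (_ + _); rewrite addeCA.
  rewrite (even_odd (fun i => hausdorff k (D i))).
  by apply: leeD; apply: le_trans (Dsum _ _) _; apply: le_hausdorff => x [].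
have Doo : \sum_(i <oo) hausdorff k (D i) < +oo.
  apply: (@le_lt_trans _ _ (hausdorff k X + hausdorff k X)); last first.
    by rewrite ltey_eq fin_numD sub_oo.
  apply: lime_le.
    by apply: is_cvg_nneseries => n _ _; exact: hausdorff_ge0.
  by apply: nearW => n; rewrite big_mkord.
(* X inside G is covered by X inside [H n.+1] and the layers from n on, and [H n.+1] is separated
   from the complement of G. The tail of the convergent series then tends to 0. *)
have tail n : hausdorff k (X `&` G) + hausdorff k (X `&` ~` G) <=
    hausdorff k X + \sum_(n <= i <oo) hausdorff k (D i).
  have : hausdorff k (X `&` G) <= hausdorff k (X `&` H n.+1) + \sum_(n <= i <oo) hausdorff k (D i).
    apply: (@le_trans _ _ (hausdorff k ((X `&` H n.+1) `|` \bigcup_(i in ~` `I_n) D i))).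
      apply: le_hausdorff => x [Xx]; rewrite GH => -[m _].
      have [mn /(Hle _ _ mn) Hm|] := leqP m n.+1; first by left.
      elim: m => // m IH; rewrite ltnS leq_eqVlt => /predU1P[<-|nm] Hx.
        have [Hn|nHn] := pselect (H n.+1 x); [by left|right].
        by exists n => //=; rewrite ltnn.
      have [Hm|nHm] := pselect (H m x); first exact: IH.
      case: m nm {IH} Hx nHm => // m nm Hx nHm.
      by right; exists m; [move=> /= mn; move: nm; rewrite ltnS ltnNge (ltnW mn)|split].
    apply: le_trans (outer_measureU2 (hausdorff_outer k) _ _) _.
    by rewrite leeD2l// (outer_measure_sigma_subadditive_tail (hausdorff_outer k)).
  move=> /(leeD2r (hausdorff k (X `&` ~` G))) /le_trans; apply.
  rewrite addeAC leeD2r//.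
  apply: le_trans (hausdorff_separated k (r0 n.+1) _) _.
    by move=> x y [_ Hx] [_ nGy]; exact: Hx.
  by apply: le_hausdorff => x [] [].
have := nneseries_tail_cvg Doo (fun i _ => hausdorff_ge0 k (D i)).
move=> /(cvgeD (fin_num_adde_defl _ (erefl : (0 : \bar R) \is a fin_num)) (cvg_cst (hausdorff k X))).
rewrite adde0 => cv; apply: (cvge_to_ge cv); apply: nearW => n; exact: tail.
Qed.

End HausdorffFacts.

(** * The Hausdorff measure of a cube *)

Definition cube {R : realType} (k : nat) (L : R) : set 'rV[R]_k :=
  [set x | forall i, 0 <= x 0 i <= L].
Arguments cube {R} k L _.

Section CubeMeasure.
Context {R : realType}.

(* Slicing by the last coordinate and integrating over it lowers k by one. *)
Lemma cover_cube_volume k (a : nat -> nat -> R) (r : nat -> R) (D : set nat) :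
  (forall i, 0 <= r i) ->
  (forall x : nat -> R, (forall j, 0 <= x j <= 1) ->
    exists2 i, D i & forall j, (j < k)%N -> a i j <= x j <= a i j + r i) ->
  (1 <= \sum_(i <oo) (if `[< D i >] then r i ^+ k else 0)%:E)%E.
Proof.
move=> r0; elim: k D => [|k IH] D cov.
  have [j|i Di _] := cov (fun=> 0); first by rewrite lexx ler01.
  apply: le_trans (@nneseries_lim_ge _ _ _ 0 i.+1 _); last first.
    by move=> n _ _; rewrite lee_fin; case: ifP.
  rewrite big_nat_recr//= asboolT// expr0 leeDr// sume_ge0// => n _.
  by rewrite lee_fin; case: ifP.
(* [f i t] is the k-dimensional volume of the slice at height t of the i-th box; its integral over t
   is at most the volume of the box. *)
pose c i : R := if `[< D i >] then r i ^+ k else 0.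
have c0 i : 0 <= c i by rewrite /c; case: ifP; rewrite ?exprn_ge0.
pose I i : set R := `[a i k, a i k + r i]%classic.
pose f i (t : R) : \bar R := (c i * \1_(I i) t)%:E.
have f0 i t : (0 <= f i t)%E by rewrite lee_fin mulr_ge0.
have slice t : 0 <= t <= 1 -> (1 <= \sum_(i <oo) f i t)%E.
  (* The index set [D] lets the induction hypothesis run over the boxes that meet the slice without
     renumbering them. *)
  move=> t01; apply: le_trans (IH (D `&` [set i | I i t]) _) _.
    move=> x x01; have [|i Di ax] := cov (fun j => if j == k then t else x j).
      by move=> j; case: eqP.
    exists i; first by split=> //=; rewrite /I/= in_itv/=; have := ax k (ltnSn k); rewrite eqxx.
    by move=> j jk; have := ax j (ltnW jk); rewrite ltn_eqF.
  apply: lee_nneseries => [i _ _|i _]; first by rewrite lee_fin; case: ifP; rewrite ?exprn_ge0.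
  rewrite lee_fin /c indicE; case: asboolP => [[Di Iit]|_].
    by rewrite asboolT// mem_set// mulr1.
  by rewrite mulr_ge0//; case: ifP; rewrite ?exprn_ge0.
have mI i : measurable (I i) by exact: measurable_itv.
have mf i : measurable_fun setT (f i).
  by apply/measurable_EFinP; apply: measurable_funM => //; exact: measurable_indic.
have m01 : measurable (`[0, 1]%classic : set R) by exact: measurable_itv.
have one : (\int[lebesgue_measure]_(t in `[0%R, 1%R]) (1%:E : \bar R) = 1)%E.
  by rewrite integral_cst//= mul1e lebesgue_measure_itv/= lte_fin ltr01 sube0.
rewrite -[leLHS]one.
apply: (@le_trans _ _ (\int[lebesgue_measure]_(t in `[0%R, 1%R]) (\sum_(i <oo) f i t))%E).
  apply: ge0_le_integral => //.
  - apply: ge0_emeasurable_sum => [i t _ _|i _]; first exact: f0.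
    by apply: measurable_funTS; exact: mf.
rewrite integral_nneseries//; last first.
  by move=> i; apply: measurable_funTS; exact: mf.
apply: lee_nneseries => [i _ _|i _]; first by apply: integral_ge0 => t _; exact: f0.
rewrite /f; under eq_integral do rewrite EFinM.
rewrite ge0_integralZl//; last 2 first.
- by apply: measurable_funTS; apply/measurable_EFinP; apply: measurable_indic; exact: mI.
- by rewrite lee_fin.
rewrite integral_indic//; last exact: mI.
apply: (@le_trans _ _ ((c i)%:E * (r i)%:E)%E).
  rewrite lee_wpmul2l ?lee_fin//.
  apply: (@le_trans _ _ (lebesgue_measure (I i))).
    have mII : measurable (I i `&` `[0, 1]%classic) by exact: measurableI (mI i) m01.
    apply: le_measure; [exact: mem_set mII|exact: mem_set (mI i)|exact: subIsetl].
  rewrite lebesgue_measure_itv/= lte_fin; case: ifP => _; last by rewrite lee_fin.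
  by rewrite -EFinD addrAC subrr add0r.
by rewrite -EFinM lee_fin /c; case: ifP => _; rewrite ?mul0r// exprSr.
Qed.

(** Each covering set of diameter r sits in a box of side r whose corner is given by the infima of
    its coordinates. Using boxes in place of the isodiametric inequality gives, for k >= 2, a
    constant below the true measure 1. *)
Lemma hausdorff_cube_ge k : ((unit_ball_volume R k / 2 ^+ k)%:E <= hausdorff k (cube k 1))%E.
Proof.
apply: le_trans (hausdorff_pre_le_hausdorff _ _ ltr01).
apply: le_ereal_inf_tmp => _ [U [cU Ud] <-].
pose r i := fine (diameter (U i)).
have rE i : diameter (U i) = (r i)%:E.
  by rewrite fineK// ge0_fin_numE ?diameter_ge0// (le_lt_trans (Ud i)) ?ltry.
have r0 i : 0 <= r i by rewrite fine_ge0 ?diameter_ge0.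
pose S i j := [set x 0 j' | x in U i & j' in [set j' : 'I_k | j' = j :> nat]].
pose a i j := inf (S i j).
have w0 : 0 <= unit_ball_volume R k / 2 ^+ k.
  by rewrite divr_ge0 ?unit_ball_volume_ge0 ?exprn_ge0.
have -> : (\sum_(i <oo) hausdorff_gauge k (U i) = \sum_(i <oo) (unit_ball_volume R k / 2 ^+ k)%:E *
    (if `[< U i !=set0 >] then r i ^+ k else 0)%:E)%E.
  apply: eq_eseriesr => i _; rewrite /hausdorff_gauge; case: asboolP => [/set0P/negbTE ->|].
    by rewrite rE EFin_expe.
  by move=> /set0P/negP/negPn ->; rewrite mule0.
rewrite nneseriesZl; last by move=> i _; rewrite lee_fin; case: ifP; rewrite ?exprn_ge0.
rewrite -[leLHS]mule1 lee_wpmul2l// ?lee_fin//.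
apply: (@cover_cube_volume k a r) => // x x01.
have [|i _ Ux] := cU (\row_j x j); first by move=> j; rewrite mxE.
exists i; first by exists (\row_j x j).
move=> j jk; have close y z (j' : 'I_k) : U i y -> U i z -> z 0 j' - r i <= y 0 j'.
  move=> Uy Uz; have := enorm_le_diameter Uz Uy; rewrite rE lee_fin.
  move=> /(le_trans (ler_coord_enorm _ j')) /(le_trans (ler_norm _)); rewrite !mxE; lra.
have Sx : S i j (x j).
  by exists (\row_j x j) => //; exists (Ordinal jk) => //; rewrite mxE.
have lb : lbound (S i j) (x j - r i).
  move=> _ [y Uy [j' /= j'j <-]]; have := close _ _ j' Uy Ux.
  by rewrite mxE j'j.
apply/andP; split; first by apply: ge_inf => //; exists (x j - r i).
by rewrite -lerBlDr; apply: lb_le_inf => //; exists (x j).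
Qed.

Lemma hausdorff_pre_finite_cover {d} k (delta : R) (T : finType) (U : T -> set 'rV[R]_d)
    (E : set 'rV[R]_d) : 0 <= delta ->
  E `<=` \bigcup_t U t -> (forall t, (diameter (U t) <= delta%:E)%E) ->
  (hausdorff_pre k delta E <= \sum_(t : T) hausdorff_gauge k (U t))%E.
Proof.
move=> d0 EU Ud; pose s := [seq U t | t <- enum T].
apply: (@le_trans _ _ (\sum_(i <oo) hausdorff_gauge k (nth set0 s i))%E).
  apply: ereal_inf_lbound; exists (nth set0 s) => //; split.
    move=> x /EU[t _ Ut]; exists (index t (enum T)) => //.
    by rewrite (nth_map t) ?index_mem ?mem_enum// nth_index ?mem_enum.
  move=> i; have [si|si] := ltnP i (size s); last by rewrite nth_default// diameter0 lee_fin.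
  have /mapP[t _ ->] := mem_nth set0 si; exact: Ud.
rewrite (@nneseries_split _ _ 0 (size s)); last by move=> i _; exact: hausdorff_gauge_ge0.
rewrite add0n eseries0 ?adde0; last first.
  by move=> i si _; rewrite nth_default// hausdorff_gauge0.
by rewrite -(big_nth set0 predT) big_map big_enum.
Qed.

Lemma hausdorff_cube_lt k (L : R) : (hausdorff k (cube k L) < +oo)%E.
Proof.
pose Q : set 'rV[R]_k := [set x | forall i, 0 <= x 0 i < 1].
pose w : R := unit_ball_volume R k / 2 ^+ k.
have w0 : 0 <= w by rewrite divr_ge0 ?unit_ball_volume_ge0 ?exprn_ge0.
have QC : (hausdorff k Q <= (w * Num.sqrt k%:R ^+ k)%:E)%E.
  apply: ge_ereal_sup => _ [delta /= d0 <-].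
  (* The unit cube is cut into N^k cubes of diameter sqrt k / N <= delta. Their total gauge does not
     depend on N, so the bound survives delta -> 0. *)
  pose N := (Num.truncn (Num.sqrt k%:R / delta)).+1.
  have N0 : 0 < N%:R :> R by rewrite ltr0n.
  have Nd : Num.sqrt k%:R / N%:R <= delta.
    by rewrite ler_pdivrMr// mulrC -ler_pdivrMr// ltW// truncnS_gt.
  pose U (g : {ffun 'I_k -> 'I_N}) : set 'rV[R]_k :=
    [set x | forall i, (g i)%:R <= N%:R * x 0 i <= (g i).+1%:R].
  have Udiam g : (diameter (U g) <= (Num.sqrt k%:R / N%:R)%:E)%E.
    apply: diameter_le => [|x y Ux Uy]; first by rewrite divr_ge0 ?sqrtr_ge0 ?ltW.
    apply: enorm_le_coord => [i|]; last by rewrite invr_ge0 ltW.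
    rewrite !mxE -(ler_pM2l N0) divff ?gt_eqF// -[X in X * _]gtr0_norm// -normrM.
    have := Ux i; have := Uy i; rewrite -natr1 mulrBr ler_distl; lra.
  apply: (@le_trans _ _ (\sum_(g : {ffun 'I_k -> 'I_N}) hausdorff_gauge k (U g))%E).
    apply: hausdorff_pre_finite_cover; first exact: ltW.
      move=> x Qx; have lt i : (Num.truncn (N%:R * x 0 i)%R < N)%N.
        have /andP[x0 x1] := Qx i.
        by rewrite truncn_lt_nat ?mulr_ge0 ?(ltW N0)// gtr_pMr.
      exists [ffun i => Ordinal (lt i)] => // i; rewrite ffunE/=.
      have /andP[x0 x1] := Qx i.
      have := truncn_itv (mulr_ge0 (ltW N0) x0); lra.
    by move=> g; apply: le_trans (Udiam g) _; rewrite lee_fin.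
  apply: (@le_trans _ _ (\sum_(g : {ffun 'I_k -> 'I_N}) (w * (Num.sqrt k%:R / N%:R) ^+ k)%:E)%E).
    apply: lee_sum => g _; rewrite /hausdorff_gauge; case: ifP => _.
      by rewrite lee_fin mulr_ge0// exprn_ge0// divr_ge0 ?sqrtr_ge0 ?ltW.
    rewrite [leRHS]EFinM lee_wpmul2l// EFin_expe; apply: le_expe => //; exact: diameter_ge0.
  rewrite sumEFin lee_fin sumr_const card_ffun !card_ord -[leLHS]mulr_natl natrX.
  by rewrite expr_div_n mulrCA [_ ^+ k * (_ / _)]mulrC divfK// gt_eqF// exprn_gt0.
(* Enlarging L makes the scaling factor positive and lets the closed cube fit into a scaled copy of
   the half-open [Q]. *)
have L0 : 0 < `|L| + 1 by rewrite ltr_wpDl.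
apply: (@le_lt_trans _ _ (hausdorff k [set (`|L| + 1) *: x | x in Q])).
  apply: le_hausdorff => x xL; exists ((`|L| + 1)^-1 *: x).
    move=> i; have /andP[x0 x1] := xL i; rewrite mxE mulr_ge0 ?invr_ge0 ?(ltW L0)//=.
    by rewrite ltr_pdivrMl// mulr1 (le_lt_trans x1)// (le_lt_trans (ler_norm L))// ltrDl.
  by rewrite scalerA divff ?scale1r// gt_eqF.
rewrite hausdorff_scale//; apply: (@le_lt_trans _ _ ((`|L| + 1) ^+ k * (w * Num.sqrt k%:R ^+ k))%:E).
  by rewrite EFinM lee_wpmul2l// lee_fin exprn_ge0// ltW.
exact: ltry.
Qed.

End CubeMeasure.

(** * Integration over bounded sets and the torus *)

Lemma integrable_bounded_support {disp} {T : measurableType disp} {R : realType}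
    (mu : {measure set T -> \bar R}) (M : R) (D B : set T) (f : T -> R) : measurable D -> measurable B ->
  (mu (D `&` B) < +oo)%E -> measurable_fun D f ->
  (forall x, D x -> `|f x| <= M) -> (forall x, D x -> ~ B x -> f x = 0) ->
  mu.-integrable D (EFin \o f).
Proof.
move=> mD mB DBoo mf fM f0; apply/integrableP; split; first exact/measurable_EFinP.
apply: (@le_lt_trans _ _ (\int[mu]_(x in D) (`|M| * \1_B x)%:E)%E).
  apply: ge0_le_integral => //.
  - by apply: measurableT_comp => //; exact/measurable_EFinP.
  - by apply/measurable_EFinP; apply: measurable_funM => //; apply: measurable_funTS; apply: measurable_indic.
  - move=> x Dx; rewrite /= lee_fin indicE; have [Bx|nBx] := pselect (B x).
      by rewrite mem_set// mulr1 (le_trans (fM _ Dx))// ler_norm.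
    by rewrite memNset// mulr0 f0// normr0.
under eq_integral do rewrite EFinM.
rewrite ge0_integralZl//; last first.
  by apply/measurable_EFinP; apply: measurable_funTS; apply: measurable_indic.
rewrite integral_indic// setIC lte_mul_pinfty// lee_fin//.
Qed.

Section HausdorffIntegral.
Context {R : realType} {d : nat} (k : nat).
Let T := caratheodory_type (@hausdorff_outer R d k).
Local Notation mu := (@hausdorff_measure R d k).
Implicit Types (D B : set T) (f g : T -> R) (v : 'rV[R]_d).

Lemma open_measurable_hausdorff (G : set 'rV[R]_d) : open G -> measurable (G : set T).
Proof. exact: hausdorff_open_caratheodory. Qed.

Lemma closed_measurable_hausdorff (G : set 'rV[R]_d) : closed G -> measurable (G : set T).
Proof.
move=> cG; rewrite -(setCK G); apply: measurableC.
by apply: open_measurable_hausdorff; exact: closed_openC.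
Qed.

Lemma continuous_measurable_hausdorff (f : 'rV[R]_d -> R) D : continuous f ->
  measurable_fun D (f : T -> R).
Proof.
move=> cf mD; apply: (measurability _ (RGenOInfty.measurableE R)) => //.
move=> _ [_ [a ->] <-]; apply: measurableI => //.
apply: open_measurable_hausdorff; move/continuousP : cf; apply.
exact: interval_open.
Qed.

Lemma translate_caratheodory v (A : set T) : measurable A ->
  measurable ([set x | A ((x : 'rV[R]_d) + v)%R] : set T).
Proof.
move=> mA.
suff : (hausdorff_outer k).-caratheodory [set x | A ((x : 'rV[R]_d) + v)%R] by [].
move=> X; have tr (Y Z : set 'rV[R]_d) : [set x + v | x in Y `&` [set x | Z (x + v)]] =
    [set x + v | x in Y] `&` Z.
  apply/seteqP; split=> [_ [x [Yx Zx] <-]|_ [[x Yx <-] Zx]]; first by split=> //; exists x.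
  by exists x.
have /(_ [set x + v | x in X]) : (hausdorff_outer k).-caratheodory A by [].
rewrite -(tr X A) -(tr X (~` A)).
by rewrite /= !hausdorff_translate.
Qed.

Lemma hausdorff_preimage_translate v (A : set 'rV[R]_d) :
  hausdorff k [set x | A (x + v)] = hausdorff k A.
Proof.
rewrite -(hausdorff_translate k v); congr (hausdorff k _).
apply/seteqP; split=> [_ [x Ax <-]//|x Ax].
by exists (x - v); rewrite ?subrK//= subrK.
Qed.

Lemma measurable_translate v : measurable_fun setT (fun x : T => ((x : 'rV[R]_d) + v)%R : T).
Proof. by move=> _ A mA; rewrite setTI; exact: translate_caratheodory. Qed.

(** By translation invariance [mu] is its own pushforward under x + v. *)
Lemma ge0_integral_translate v D (g : T -> \bar R) : measurable D ->
  measurable_fun D g -> (forall x, D x -> (0 <= g x)%E) ->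
  (\int[mu]_(x in D) g x =
   \int[mu]_(x in [set x | D ((x : 'rV[R]_d) + v)%R]) g ((x : 'rV[R]_d) + v)%R)%E.
Proof.
move=> mD mg g0; pose phi (x : T) : T := ((x : 'rV[R]_d) + v)%R.
have mphi : measurable_fun setT phi by exact: measurable_translate.
pose Phi : {mfun T >-> T} := HB.pack phi (isMeasurableFun.Build _ _ _ _ _ mphi).
transitivity (\int[pushforward mu Phi]_(x in D) g x)%E.
  apply: (@eq_measure_integral _ _ _ _ (pushforward mu Phi) mu) => A mA _.
  exact: (esym (hausdorff_preimage_translate v A)).
apply: (ge0_integral_pushforward mphi) => // x.
by rewrite inE => /g0.
Qed.

Lemma integral_translate v D (g : T -> \bar R) : measurable D -> measurable_fun D g ->
  (\int[mu]_(x in D) g x =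
   \int[mu]_(x in [set x | D ((x : 'rV[R]_d) + v)%R]) g ((x : 'rV[R]_d) + v)%R)%E.
Proof.
move=> mD mg; rewrite integralE [RHS]integralE; congr (_ - _)%E.
  rewrite (ge0_integral_translate v)//; last exact: measurable_funepos.
  by apply: eq_integral => x _; rewrite funeposE funeposE.
rewrite (ge0_integral_translate v)//; last exact: measurable_funeneg.
by apply: eq_integral => x _; rewrite funenegE funenegE.
Qed.

Lemma integrable_translate v D (g : T -> \bar R) : measurable D -> mu.-integrable D g ->
  mu.-integrable [set x | D ((x : 'rV[R]_d) + v)%R] (fun x => g ((x : 'rV[R]_d) + v)%R).
Proof.
move=> mD /integrableP[mg goo]; apply/integrableP; split.
  move=> _ A mA; have -> : [set x | D ((x : 'rV[R]_d) + v)%R] `&` (fun x => g ((x : 'rV[R]_d) + v)%R) @^-1` A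
    = [set x | (D `&` g @^-1` A) ((x : 'rV[R]_d) + v)%R] by [].
  by apply: translate_caratheodory; exact: mg.
have mng : measurable_fun D (fun x => `|g x|%E) by exact: measurableT_comp.
by have E := ge0_integral_translate v mD mng (fun x _ => abse_ge0 (g x)); rewrite E in goo.
Qed.

Lemma Rintegral_translate v D f : measurable D -> measurable_fun D f ->
  \int[mu]_(x in D) f x =
  \int[mu]_(x in [set x | D ((x : 'rV[R]_d) + v)%R]) f ((x : 'rV[R]_d) + v)%R.
Proof.
move=> mD /measurable_EFinP mf; exact: (congr1 fine (integral_translate v mD mf)).
Qed.

End HausdorffIntegral.

Lemma integrable_disjointU {disp} {T : measurableType disp} {R : realType}
    (mu : {measure set T -> \bar R}) (A B : set T) (f : T -> \bar R) :
  measurable A -> measurable B -> mu.-integrable A f -> mu.-integrable B f ->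
  [disjoint A & B] -> mu.-integrable (A `|` B) f.
Proof.
move=> mA mB /integrableP[mfA fA] /integrableP[mfB fB] AB.
have mf : measurable_fun (A `|` B) f by apply/measurable_funU.
apply/integrableP; split=> //; rewrite ge0_integral_setU//.
  exact: lte_add_pinfty.
exact: measurableT_comp.
Qed.

Section CubeFacts.
Context {R : realType} {d : nat}.

Lemma coordC (i : 'I_d) : continuous (fun x : 'rV[R]_d => x 0 i).
Proof. exact: coord_continuous. Qed.

Lemma cube_compact (L : R) : compact (cube d L).
Proof.
rewrite (_ : cube d L = [set v : 'rV[R]_d | forall i, `[0, L]%classic (v ord0 i)]).
  by apply: (@rV_compact R d (fun=> `[0, L]%classic)) => i; exact: segment_compact.
by apply/seteqP; split=> x xL i; have := xL i; rewrite /= in_itv.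
Qed.

Lemma continuous_bounded_cube (f : 'rV[R]_d -> R) (L : R) : continuous f ->
  exists2 B : R, 0 < B & forall x, cube d L x -> `|f x| <= B.
Proof.
move=> cf; have : compact (f @` cube d L).
  by apply: continuous_compact; [exact: continuous_subspaceT|exact: cube_compact].
move=> /compact_bounded[M [_ MB]]; exists (`|M| + 1); first by rewrite ltr_wpDl.
move=> x Lx; apply: (MB (`|M| + 1)); last by exists x.
by rewrite (le_lt_trans (ler_norm _))// ltrDl.
Qed.

Lemma coord_lt_open (i : 'I_d) (a : R) : open [set x : 'rV[R]_d | x 0 i < a].
Proof.
rewrite (_ : [set _ | _] = (fun x : 'rV[R]_d => x 0 i) @^-1` `]-oo, a[%classic).
  by move/continuousP : (@coordC i); apply; exact: interval_open.
by apply/seteqP; split=> x /=; rewrite in_itv.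
Qed.

Lemma coord_measurable_lt k (i : 'I_d) (a : R) :
  measurable ([set x : 'rV[R]_d | x 0 i < a] : set (caratheodory_type (@hausdorff_outer R d k))).
Proof. by apply: open_measurable_hausdorff; exact: coord_lt_open. Qed.

Lemma coord_measurable_ge k (i : 'I_d) (a : R) :
  measurable ([set x : 'rV[R]_d | a <= x 0 i] : set (caratheodory_type (@hausdorff_outer R d k))).
Proof.
have -> : [set x : 'rV[R]_d | a <= x 0 i] = ~` [set x | x 0 i < a].
  by apply/seteqP; split=> x /=; rewrite leNgt => /negP.
by apply: measurableC; exact: coord_measurable_lt.
Qed.

Lemma hausdorff_box_gt0 (y : 'rV[R]_d) (L : R) (E : set 'rV[R]_d) : 0 < L ->
  (forall x : 'rV[R]_d, (forall i, y 0 i <= x 0 i <= y 0 i + L) -> E x) -> (0 < hausdorff d E)%E.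
Proof.
move=> L0 yE; apply: (@lt_le_trans _ _ (hausdorff d [set x + y | x in [set L *: x | x in cube d 1]])).
  rewrite hausdorff_translate hausdorff_scale//; apply: mule_gt0; first by rewrite lte_fin exprn_gt0.
  apply: lt_le_trans (hausdorff_cube_ge d); rewrite lte_fin divr_gt0 ?exprn_gt0//.
  have [m] := ubnP d; elim: m (d) => // m IH [|[|n]] //= nm.
  by rewrite !mulr_gt0 ?pi_gt0 ?invr_gt0// IH// ltnW.
apply: le_hausdorff => _ [_ [x x1 <-] <-]; apply: yE => i.
have /andP[x0 x1i] := x1 i; rewrite !mxE lerDr mulr_ge0 ?(ltW L0)//= addrC lerD2l.
by rewrite ler_piMr// ltW.
Qed.

End CubeFacts.

Definition lattice_periodic {R : realType} {d : nat} (f : 'rV[R]_d -> R) :=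
  forall (n : 'rV[int]_d) x, f (x + (2 * pi) *: of_int n) = f x.

Definition torus_int {R : realType} {d : nat} (f : 'rV[R]_d -> R) : R :=
  \int[@hausdorff_measure R d d]_(x in fundamental_domain) f x.

Section TorusIntegral.
Context {R : realType} {d : nat}.
Local Notation Q := (@fundamental_domain R d).
Local Notation mu := (@hausdorff_measure R d d).
Implicit Types (f g : 'rV[R]_d -> R).

Lemma fundamental_domain_measurable :
  measurable (Q : set (caratheodory_type (@hausdorff_outer R d d))).
Proof.
rewrite (_ : Q = \bigcap_(i in [set: 'I_d])
   ([set x : 'rV[R]_d | 0 <= x 0 i] `&` [set x | x 0 i < 2 * pi])); last first.
  apply/seteqP; split=> x Qx i => [_|]; first by have /andP[] := Qx i; split.
  by have [/= ? ?] := Qx i I; apply/andP; split.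
apply: fin_bigcap_measurable => // i _; apply: measurableI.
  exact: coord_measurable_ge.
exact: coord_measurable_lt.
Qed.
Local Notation mQ := fundamental_domain_measurable.

Lemma fundamental_domain_sub_cube (L : R) : 2 * pi <= L -> Q `<=` cube d L.
Proof. by move=> piL x Qx i; have /andP[-> /ltW x2] := Qx i; rewrite (le_trans x2). Qed.

Lemma fundamental_domain_lt : (mu Q < +oo)%E.
Proof.
apply: le_lt_trans (hausdorff_cube_lt d (2 * pi)).
by apply: le_hausdorff; exact: fundamental_domain_sub_cube.
Qed.

Lemma fundamental_domain_gt0 : (0 < mu Q)%E.
Proof.
apply: (@hausdorff_box_gt0 _ _ 0 pi); first exact: pi_gt0.
move=> x x0 i; have := x0 i; rewrite mxE add0r => /andP[-> xpi] /=.
by rewrite (le_lt_trans xpi)// ltr_pMl ?pi_gt0// ltr1n.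
Qed.

Lemma torus_integrable f : continuous f -> mu.-integrable Q (EFin \o f).
Proof.
move=> cf; have [B _ fB] := continuous_bounded_cube (2 * pi) cf.
apply: (@integrable_bounded_support _ _ _ mu B Q Q) => [||||x Qx|x Qx /(_ Qx)]//; try exact: mQ.
- by rewrite setIid; exact: fundamental_domain_lt.
- exact: continuous_measurable_hausdorff.
- by apply: fB; exact: fundamental_domain_sub_cube Qx.
Qed.

Lemma torus_intD f g : continuous f -> continuous g ->
  torus_int (fun x => f x + g x) = torus_int f + torus_int g.
Proof. by move=> cf cg; apply: RintegralD; [exact: mQ|exact: torus_integrable..]. Qed.

Lemma torus_intZ (a : R) f : continuous f -> torus_int (fun x => a * f x) = a * torus_int f.
Proof. by move=> cf; apply: RintegralZl; [exact: mQ|exact: torus_integrable]. Qed.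

Lemma torus_intB f g : continuous f -> continuous g ->
  torus_int (fun x => f x - g x) = torus_int f - torus_int g.
Proof. by move=> cf cg; apply: RintegralB; [exact: mQ|exact: torus_integrable..]. Qed.

Lemma eq_torus_int f g : f =1 g -> torus_int f = torus_int g.
Proof. by move=> /funext ->. Qed.

Lemma torus_int_cst (a : R) : torus_int (fun _ : 'rV[R]_d => a) = a * fine (mu Q).
Proof. by apply: Rintegral_cst; exact: mQ. Qed.

Lemma torus_int_sum (I : Type) (s : seq I) (F : I -> 'rV[R]_d -> R) :
  (forall i, continuous (F i)) ->
  torus_int (fun x => \sum_(i <- s) F i x) = \sum_(i <- s) torus_int (F i).
Proof.
move=> cF; elim: s => [|i s IH].
  under eq_torus_int do rewrite big_nil.
  by rewrite torus_int_cst mul0r big_nil.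
under eq_torus_int do rewrite big_cons.
rewrite torus_intD//; first by rewrite IH big_cons.
by apply: continuous_sum => j _; exact: cF.
Qed.

Lemma continuous_translate f (v : 'rV[R]_d) : continuous f -> continuous (fun x : 'rV[R]_d => f (x + v)).
Proof.
move=> cf x; apply: (@continuous_comp _ _ _ (fun x : 'rV[R]_d => x + v) f); last exact: cf.
by move=> z; apply: (@continuousD R _ _ id (cst v)); [exact: cvg_id|exact: cst_continuous].
Qed.

Lemma of_int_delta (j : 'I_d) : of_int (delta_mx 0 j) = delta_mx 0 j :> 'rV[R]_d.
Proof. by apply/rowP => i; rewrite !mxE !eqxx/=; case: (i == j). Qed.

Lemma torus_int_translate f (j : 'I_d) (s : R) : continuous f -> lattice_periodic f ->
  0 <= s < 2 * pi -> torus_int (fun x => f (x + s *: delta_mx 0 j)) = torus_int f.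
Proof.
move=> cf pf /andP[s0 s2]; set v := s *: delta_mx 0 j; rewrite /torus_int.
rewrite [RHS](Rintegral_translate v); [|exact: mQ|exact: continuous_measurable_hausdorff].
pose g x := f (x + v); have cg : continuous g by exact: continuous_translate.
have pg x : g (x + (2 * pi) *: delta_mx 0 j) = g x.
  by rewrite /g addrAC -of_int_delta pf.
have vE (x : 'rV[R]_d) i : (x + v) 0 i = x 0 i + (if i == j then s else 0).
  by rewrite !mxE eqxx/=; case: eqP; rewrite ?mulr1 ?mulr0.
(* The translated cell consists of [A1] and of [A2] moved down by one full period along the j-th
   axis; periodicity of the integrand puts [A2] back. *)
pose A1 := Q `&` [set x | x 0 j < 2 * pi - s].
pose A2 := Q `&` [set x | 2 * pi - s <= x 0 j].
pose A2' := [set x | A2 (x + (2 * pi) *: delta_mx 0 j)].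
have mA1 : measurable (A1 : set (caratheodory_type (@hausdorff_outer R d d))).
  by apply: measurableI; [exact: mQ|exact: coord_measurable_lt].
have mA2 : measurable (A2 : set (caratheodory_type (@hausdorff_outer R d d))).
  by apply: measurableI; [exact: mQ|exact: coord_measurable_ge].
have mA2' : measurable (A2' : set (caratheodory_type (@hausdorff_outer R d d))).
  exact: translate_caratheodory.
have piE (x : 'rV[R]_d) i : (x + (2 * pi) *: delta_mx 0 j) 0 i =
    x 0 i + (if i == j then 2 * pi else 0).
  by rewrite !mxE eqxx/=; case: eqP; rewrite ?mulr1 ?mulr0.
have E1 : Q = A1 `|` A2.
  by rewrite -setIUr [X in _ `&` X](_ : _ = setT) ?setIT// -subTset => x _ /=; case: ltP; [left|right].
have E2 : [set x | Q (x + v)] = A1 `|` A2'.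
  apply/seteqP; split=> x.
    move=> Qx; have [xj|xj] := leP 0 (x 0 j).
      left; split; last by have := Qx j; rewrite vE eqxx /=; lra.
      by move=> i; have := Qx i; rewrite vE; case: eqP => [->|]; [lra|rewrite addr0].
    right; split; last by rewrite /= piE eqxx; have := Qx j; rewrite vE eqxx; lra.
    by move=> i; have := Qx i; rewrite vE piE; case: eqP => [->|//]; lra.
  move=> [[Qx /= xj]|[Qx /= xj]] i; have := Qx i; rewrite vE ?piE; case: eqP => [->|_];
    rewrite ?addr0//; [lra|move: xj; rewrite piE eqxx; lra].
have iU (A : set 'rV[R]_d) : measurable (A : set (caratheodory_type (@hausdorff_outer R d d))) ->
    A `<=` Q -> mu.-integrable A (EFin \o g).
  by move=> mA AQ; apply: (integrableS mQ) => //; exact: torus_integrable.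
have iA2' : mu.-integrable A2' (EFin \o g).
  have := integrable_translate ((2 * pi) *: delta_mx 0 j) mA2 (iU _ mA2 (@subIsetl _ _ _)).
  apply: eq_integrable => // x _; by rewrite /= pg.
rewrite E2 [in LHS]E1 !Rintegral_setU//.
- congr (_ + _).
  rewrite (Rintegral_translate ((2 * pi) *: delta_mx 0 j) mA2); last exact: continuous_measurable_hausdorff.
  by apply: eq_Rintegral => x _; exact: pg.
- apply: integrable_disjointU => //; first exact: iU mA1 (@subIsetl _ _ _).
  by apply/eqP/seteqP; split=> // x [[Qx _] [Qx' _]]; have := Qx j; have := Qx' j; rewrite piE eqxx; lra.
- apply/eqP/seteqP; split=> // x [[Qx _] [Qx' _]]; have := Qx j; have := Qx' j; rewrite piE eqxx; lra.
- by rewrite -E1; exact: torus_integrable.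
- by apply/eqP/seteqP; split=> // x [[_ /= x2] [_ /=]]; rewrite leNgt x2.
Qed.

End TorusIntegral.

(** * Trigonometric waves *)

Lemma Rintegral_bounded_cvg {disp} {T : measurableType disp} {R : realType}
    (mu : {measure set T -> \bar R}) (D : set T) (f_ : nat -> T -> R) (f : T -> R) (B : R) :
  measurable D -> (mu D < +oo)%E -> (forall n, measurable_fun D (f_ n)) -> measurable_fun D f ->
  (forall x, D x -> f_ n x @[n --> \oo] --> f x) -> (forall n x, D x -> `|f_ n x| <= B) ->
  (\int[mu]_(x in D) f_ n x) @[n --> \oo] --> \int[mu]_(x in D) f x.
Proof.
move=> mD Doo mf_ mf f_f fB.
have ig : mu.-integrable D (EFin \o cst B).
  apply: (@integrable_bounded_support _ _ _ mu `|B| D D) => //.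
  by rewrite setIid.
have mf_E n : measurable_fun D (EFin \o f_ n) by apply/measurable_EFinP.
have f_fE x : D x -> (EFin \o f_ n) x @[n --> \oo] --> (EFin \o f) x.
  by move=> Dx; apply: cvg_EFin; [exact: nearW|exact: f_f].
have absE n x : D x -> (`|(EFin \o f_ n) x| <= (EFin \o cst B) x)%E.
  by move=> Dx; rewrite /= lee_fin fB.
have mfE : measurable_fun D (EFin \o f) by apply/measurable_EFinP.
have [intf _ cv] := dominated_convergence mD mf_E mfE
  (aeW mu f_fE) ig (aeW mu (fun x n (Dx : D x) => absE n x Dx)).
by apply: fine_cvg; rewrite fineK//; exact: integrable_fin_num.
Qed.

(** A phase replaces a separate sine: [phi = - (pi / 2)] gives sin (n.x), and differentiating only
    shifts the phase by pi / 2. *)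
Definition wave {R : realType} {d : nat} (n : 'rV[R]_d) (phi : R) (x : 'rV[R]_d) : R :=
  cos (dot n x + phi).

Section Waves.
Context {R : realType} {d : nat}.
Implicit Types (n m x : 'rV[R]_d) (phi : R) (f g : 'rV[R]_d -> R).

Lemma continuous_wave n phi : continuous (wave n phi).
Proof.
move=> x; apply: (@continuous_comp _ _ _ (fun x => dot n x + phi) cos); last exact: continuous_cos.
apply: (@continuousD R _ _ (dot n) (cst phi)); first exact: continuous_dotr.
exact: cst_continuous.
Qed.

Lemma cosD2pi_int (a : R) (z : int) : cos (a + 2 * pi * z%:~R) = cos a.
Proof.
have nat (m : nat) b : cos (b + 2 * pi * m%:R) = cos b :> R.
  by rewrite mulr_natr mulr_natl (periodicn (@cosD2pi R)).
case: z => m; first exact: nat.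
by rewrite NegzE mulrNz mulrN -[LHS](nat m.+1) -pmulrn subrK.
Qed.

Lemma dot_of_int (m n : 'rV[int]_d) :
  dot (of_int m) (of_int n) = (\sum_i m 0 i * n 0 i)%:~R :> R.
Proof. by rewrite rmorph_sum; apply: eq_bigr => i _; rewrite !mxE rmorphM. Qed.

Lemma wave_periodic n phi : integer_points n -> lattice_periodic (wave n phi).
Proof.
by move=> [m _ <-] p x; rewrite /wave dotDr dotZr dot_of_int addrAC cosD2pi_int.
Qed.

(** A shift by pi / |n_j| along an axis with n_j <> 0 changes the sign of the wave. As n_j is a
    nonzero integer, the shift is shorter than a period. *)
Lemma torus_int_wave n phi : integer_points n -> n != 0 -> torus_int (wave n phi) = 0.
Proof.
move=> nZ n0; have [j nj] : exists j, n 0 j != 0.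
  apply: contrapT => /forallNP h; move/eqP: n0; apply; apply/rowP => i; rewrite mxE.
  by have /negP/negPn/eqP := h i.
have nj1 : 1 <= `|n 0 j|.
  case: nZ nj => z _ <-; rewrite mxE intr_eq0 -intr_norm -[1]/(1%:~R) ler_int.
  by rewrite -normr_gt0 gtz0_ge1.
have nj0 : 0 < `|n 0 j| by rewrite normr_gt0.
have := @torus_int_translate R d (wave n phi) j (pi / `|n 0 j|) (@continuous_wave n phi) (@wave_periodic n phi nZ).
have -> : 0 <= pi / `|n 0 j| < 2 * pi :> bool.
  rewrite divr_ge0 ?pi_ge0//= ltr_pdivrMr//; have := pi_gt0 R; nra.
move=> /(_ isT) h; suff : torus_int (wave n phi) = -1 * torus_int (wave n phi) by lra.
rewrite -[in LHS]h -torus_intZ; last exact: continuous_wave.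
apply: eq_torus_int => x; rewrite /wave dotDr dotZr dot_delta mulN1r.
have [n_ge0|n_lt0] := leP 0 (n 0 j).
  by rewrite ger0_norm// divfK// addrAC cosDpi.
rewrite ltr0_norm// invrN mulrN mulNr divfK//.
by rewrite addrAC cosB cospi sinpi mulrN1 mulr0 addr0.
Qed.

Lemma is_derive_line f x v (df : R) :
  is_derive (0 : R) (1 : R) (fun h : R => f (h *: v + x)) df -> is_derive x v f df.
Proof.
have E : (fun h : R => h^-1 *: ((f \o shift x) (h *: v) - f x)) =
    (fun h : R => h^-1 *: (((fun h : R => f (h *: v + x)) \o shift 0) (h *: (1 : R)) - f (0 *: v + x))).
  by apply/funext => h /=; rewrite addr0 scale0r add0r [_%:A]mulr1.
by move=> [ex ev]; split; [rewrite /derivable E|rewrite -ev /derive E].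
Qed.

Lemma is_derive_shift f x v (t : R) (df : R) :
  is_derive (t *: v + x) v f df -> is_derive (t : R) (1 : R) (fun h : R => f (h *: v + x)) df.
Proof.
have E : (fun h : R => h^-1 *: ((f \o shift (t *: v + x)) (h *: v) - f (t *: v + x))) =
    (fun h : R => h^-1 *: (((fun h : R => f (h *: v + x)) \o shift t) (h *: (1 : R)) - f (t *: v + x))).
  by apply/funext => h /=; rewrite [_%:A]mulr1 scalerDl addrA.
by move=> [ex ev]; split; [rewrite /derivable -E|rewrite -ev /derive -E].
Qed.

Lemma is_derive_wave n phi x v :
  is_derive x v (wave n phi) (dot n v * wave n (phi + pi / 2) x).
Proof.
apply: is_derive_line.
have -> : (fun h : R => wave n phi (h *: v + x)) = cos \o (fun h => h * dot n v + (dot n x + phi)).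
  by apply/funext => h; rewrite /wave/= dotDr dotZr addrA.
have -> : dot n v * wave n (phi + pi / 2) x =
    - sin (0 * dot n v + (dot n x + phi)) * (dot n v + 0).
  by rewrite /wave addrA cosDpihalf mul0r add0r addr0 mulrC.
apply: is_derive1_comp.
apply: is_deriveD.
have -> : (fun h : R => h * dot n v) = dot n v \*: id.
  by apply/funext => h /=; rewrite mulrC.
by apply: is_derive_eq; rewrite /GRing.scale/= mulr1.
Qed.

(** Translation invariance makes every difference quotient integrate to 0; the mean value theorem
    bounds the quotients uniformly, so bounded convergence passes this to the derivative. *)
Lemma torus_int_partial f (j : 'I_d) : continuous f -> lattice_periodic f ->
  (forall x, derivable f x (delta_mx 0 j : 'rV[R]_d)) -> continuous (partial j f) ->
  torus_int (partial j f) = 0.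
Proof.
move=> cf pf df cdf; pose v : 'rV[R]_d := delta_mx 0 j.
pose h_ (n : nat) : R := n.+1%:R^-1.
pose f_ (n : nat) x := n.+1%:R * (f (x + h_ n *: v) - f x).
have h0 (n : nat) : 0 < h_ n by rewrite invr_gt0.
have h1 (n : nat) : h_ n <= 1 by rewrite invf_le1// ler1n.
have cf_ (n : nat) : continuous (f_ n).
  move=> x; apply: (@continuousM R _ (cst n.+1%:R) (fun x => f (x + h_ n *: v) - f x)).
    exact: cst_continuous.
  by apply: (@continuousB R _ _ (fun x => f (x + h_ n *: v)) f); [exact: continuous_translate|exact: cf].
(* The intermediate point of the mean value theorem may leave the cell by a step of length at most
   1. *)
have [B B0 fB] := continuous_bounded_cube (2 * pi + 1) cdf.
have deriv x (t : R) : is_derive (t : R) (1 : R) (fun h : R => f (h *: v + x)) (partial j f (t *: v + x)).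
  by apply: is_derive_shift; apply: derivableP.
have f_B (n : nat) x : fundamental_domain x -> `|f_ n x| <= B.
  move=> Qx.
  have [t|c] := @MVT_segment R (fun h : R => f (h *: v + x)) (fun t => partial j f (t *: v + x)) 0 (h_ n) (ltW (h0 n)) (fun t _ => deriv x t).
    apply: derivable_within_continuous => t' _; by case: (deriv x t').
  rewrite in_itv/= scale0r add0r subr0 => /andP[c0 c1] E.
  have -> : f_ n x = partial j f (c *: v + x).
    by rewrite /f_ (addrC x) E mulrC -mulrA mulVf ?mulr1// gt_eqF// ltr0n.
  apply: fB => i; have /andP[x0 x1] := Qx i; rewrite !mxE eqxx/=.
  have pi0 := pi_gt0 R; have := h1 n; case: (i == j) => /= h; rewrite ?mulr1 ?mulr0; lra.
have lim0 x : f_ n x @[n --> \oo] --> partial j f x.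
  have /cvg_ex[/= l fl] := df x.
  have lE : partial j f x = l by apply: cvg_lim fl.
  rewrite lE; apply/cvgrPdist_lt => e e0.
  have /cvgrPdist_lt/(_ e e0) := fl; rewrite near_withinE => /nbhs_ballP[r /= r0 rl].
  have := near_infty_natSinv_lt (PosNum r0); apply: filterS => n /= nr.
  have := rl (h_ n); rewrite /ball/= sub0r normrN gtr0_norm// => /(_ nr).
  rewrite gt_eqF// => /(_ isT); rewrite /f_ (addrC x) /h_ invrK /=.
  by rewrite /shift/= /GRing.scale/=.
have cv := @Rintegral_bounded_cvg _ _ _ (@hausdorff_measure R d d) fundamental_domain f_ (partial j f) B
  fundamental_domain_measurable fundamental_domain_lt
  (fun n : nat => continuous_measurable_hausdorff (cf_ n)) (continuous_measurable_hausdorff cdf)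
  (fun x _ => lim0 x) f_B.
have := cvg_lim (@Rhausdorff R) cv; rewrite /torus_int => <-.
apply: cvg_lim => //; apply: cvg_near_cst; apply: nearW => n.
have -> : \int[@hausdorff_measure R d d]_(x in fundamental_domain) f_ n x = torus_int (f_ n) by [].
rewrite torus_intZ; last first.
  by move=> x; apply: (@continuousB R _ _ (fun x => f (x + h_ n *: v)) f); [exact: continuous_translate|exact: cf].
rewrite torus_intB//; last exact: continuous_translate.
rewrite torus_int_translate// ?subrr ?mulr0// ltW//= (le_lt_trans (h1 n))//.
have := pi_ge2 R; lra.
Qed.

End Waves.

(** * Completeness of the waves on the torus *)

Lemma Rintegral_ge_indic {disp} {T : measurableType disp} {R : realType}
    (mu : {measure set T -> \bar R}) (D E : set T) (f : T -> R) (a b : R) :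
  measurable D -> measurable E -> E `<=` D -> (mu D < +oo)%E -> mu.-integrable D (EFin \o f) ->
  (forall x, D x -> a * \1_E x - b <= f x) ->
  a * fine (mu E) - b * fine (mu D) <= \int[mu]_(x in D) f x.
Proof.
move=> mD mE ED Doo intf h.
have iE : mu.-integrable D (EFin \o \1_E).
  have mi : measurable_fun D (\1_E : T -> R) by apply: measurable_funTS; apply: measurable_indic.
  apply: (integrable_bounded_support (M := 1) mD mD) => //; first by rewrite setIid.
  by move=> x _; rewrite ger0_norm// indicE; case: (_ \in _).
have iaE : mu.-integrable D (EFin \o (fun x => a * \1_E x)).
  have -> : EFin \o (fun x => a * \1_E x) = (fun x => (a%:E * (EFin \o \1_E) x)%E).
    by apply/funext => x; rewrite /= EFinM.
  exact: integrableZl.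
have ib : mu.-integrable D (EFin \o cst b).
  by apply: (@integrable_bounded_support _ _ _ mu `|b| D D) => //; rewrite setIid.
have -> : a * fine (mu E) - b * fine (mu D) = \int[mu]_(x in D) (a * \1_E x - cst b x).
  rewrite RintegralB// RintegralZl// Rintegral_cst//; congr (_ * _ - _).
  by rewrite /Rintegral integral_indic// setIidl.
apply: le_Rintegral => //.
have -> : EFin \o (fun x => a * \1_E x - cst b x) = (fun x => ((EFin \o (fun x => (a * \1_E x)%R)) x - (EFin \o cst b) x)%E).
  by apply/funext => x; rewrite /= EFinB.
exact: integrableB.
Qed.

Section ContinuousOperations.
Context {R : realType} {T : topologicalType}.
Implicit Types f g : T -> R.

Lemma continuous_mul f g : continuous f -> continuous g -> continuous (fun x => f x * g x).
Proof. by move=> cf cg x; apply: (@continuousM R _ f g); [exact: cf|exact: cg]. Qed.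

Lemma continuous_add f g : continuous f -> continuous g -> continuous (fun x => f x + g x).
Proof. by move=> cf cg x; apply: (@continuousD R _ _ f g); [exact: cf|exact: cg]. Qed.

Lemma continuous_sub f g : continuous f -> continuous g -> continuous (fun x => f x - g x).
Proof. by move=> cf cg x; apply: (@continuousB R _ _ f g); [exact: cf|exact: cg]. Qed.

Lemma continuous_scale (a : R) f : continuous f -> continuous (fun x => a * f x).
Proof. by apply: (@continuous_mul (cst a) f) => x; exact: cst_continuous. Qed.

Lemma continuous_opp f : continuous f -> continuous (fun x => - f x).
Proof. by move=> cf x; apply: (@continuousN R _ _ f); exact: cf. Qed.

End ContinuousOperations.

Section Completeness.
Context {R : realType} {d : nat}.
Implicit Types (n m x y : 'rV[R]_d) (phi : R) (f g u : 'rV[R]_d -> R).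

Lemma partial_periodic (j : 'I_d) f : lattice_periodic f -> lattice_periodic (partial j f).
Proof.
move=> pf k x; rewrite /partial /derive; set v := 'e_j.
have -> // : (fun h : R => h^-1 *: ((f \o shift (x + (2 * pi) *: of_int k)) (h *: v) - f (x + (2 * pi) *: of_int k)))
  = (fun h : R => h^-1 *: ((f \o shift x) (h *: v) - f x)).
by apply/funext => h /=; rewrite addrA !pf.
Qed.

Lemma integer_pointsD n m : integer_points n -> integer_points m -> integer_points (n + m).
Proof.
move=> [p _ <-] [q _ <-]; exists (p + q) => //.
by apply/rowP => i; rewrite !mxE rmorphD.
Qed.

Lemma integer_pointsN n : integer_points n -> integer_points (- n).
Proof. by move=> [p _ <-]; exists (- p) => //; apply/rowP => i; rewrite !mxE rmorphN. Qed.

Lemma integer_points0 : integer_points (0 : 'rV[R]_d).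
Proof. by exists 0 => //; apply/rowP => i; rewrite !mxE. Qed.

Lemma integer_points_delta (j : 'I_d) : integer_points (delta_mx 0 j : 'rV[R]_d).
Proof. by exists (delta_mx 0 j) => //; exact: of_int_delta. Qed.

Lemma wave_mul n m phi psi x : wave n phi x * wave m psi x =
  2^-1 * (wave (n + m) (phi + psi) x + wave (n - m) (phi - psi) x).
Proof.
rewrite /wave dotDl dotBl.
have -> : dot n x + dot m x + (phi + psi) = (dot n x + phi) + (dot m x + psi) by ring.
have -> : dot n x - dot m x + (phi - psi) = (dot n x + phi) - (dot m x + psi) by ring.
move: (dot n x + phi) (dot m x + psi) => A B; rewrite cosD cosB; lra.
Qed.

Lemma torus_int_wave_mul n m phi psi : integer_points n -> integer_points m ->
  torus_int (fun x => wave n phi x * wave m psi x) =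
  2^-1 * fine (hausdorff_measure d (@fundamental_domain R d)) *
    ((n + m == 0)%:R * cos (phi + psi) + (n == m)%:R * cos (phi - psi)).
Proof.
move=> nZ mZ; under eq_torus_int do rewrite wave_mul.
have cw p c := @continuous_wave R d p c.
rewrite torus_intZ; last by apply: continuous_add; exact: cw.
rewrite torus_intD; [|exact: cw..]; rewrite -mulrA; congr (_ * _); rewrite mulrDr; congr (_ + _).
- have [->|nm] := eqVneq; last by rewrite mul0r mulr0 torus_int_wave//; exact: integer_pointsD.
  rewrite mul1r mulrC -torus_int_cst; apply: eq_torus_int => x.
  by rewrite /wave dot0l add0r.
- have [->|nm] := eqVneq n m; last first.
    rewrite mul0r mulr0 torus_int_wave ?subr_eq0//.
    by apply: integer_pointsD => //; exact: integer_pointsN.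
  rewrite mul1r mulrC -torus_int_cst; apply: eq_torus_int => x.
  by rewrite subrr /wave dot0l add0r.
Qed.

(** Green's identity: the j-th derivative of [G j] is the j-th part of (Delta u + |n|^2 u) times the
    wave, and its integral vanishes. Summing over j leaves (|n|^2 - mu) times the integral in
    question. *)
Lemma laplacian_orthogonal u (mu : R) n phi : C2 u -> lattice_periodic u ->
  (forall x, - laplacian u x = mu * u x) -> integer_points n ->
  dot n n != mu -> torus_int (fun x => u x * wave n phi x) = 0.
Proof.
move=> [[cu C1u] C2u] pu eu nZ nmu.
have cw phi' := @continuous_wave R d n phi'.
pose G j x := partial j u x * wave n phi x - u x * (n 0 j * wave n (phi + pi / 2) x).
pose dG j x := (partial j (partial j u) x + n 0 j ^+ 2 * u x) * wave n phi x.
have cpu j : continuous (partial j u) by have [] := C1u j.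
have cppu j : continuous (partial j (partial j u)) by have [_ /(_ j) []] := C2u j.
have GdG j x : is_derive x ('e_j : 'rV[R]_d) (G j) (dG j x).
  have d1 : is_derive x ('e_j : 'rV[R]_d) (partial j u) (partial j (partial j u) x).
    by apply: derivableP; have [_ /(_ j) []] := C2u j.
  have d2 : is_derive x ('e_j : 'rV[R]_d) u (partial j u x).
    by apply: derivableP; have [] := C1u j.
  have d3 phi' : is_derive x ('e_j : 'rV[R]_d) (wave n phi') (n 0 j * wave n (phi' + pi / 2) x).
    by rewrite -(dot_delta j n); exact: is_derive_wave.
  have -> : G j = partial j u * wave n phi - u * (n 0 j \*: wave n (phi + pi / 2)).
    by apply/funext => z; rewrite /G.
  apply: is_derive_eq; rewrite /dG /GRing.scale/=.
  have -> : wave n (phi + pi / 2 + pi / 2) x = - wave n phi x.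
    by rewrite -addrA -splitr /wave addrA cosDpi.
  rewrite /GRing.scale/=; ring.
have GE j : partial j (G j) = dG j.
  by apply/funext => x; rewrite /partial; have [] := GdG j x.
have cdG j : continuous (dG j).
  apply: continuous_mul => //; apply: continuous_add => //; exact: continuous_scale.
have int0 j : torus_int (dG j) = 0.
  rewrite -GE; apply: torus_int_partial; last by rewrite GE.
  - apply: continuous_sub; first exact: continuous_mul.
    by apply: continuous_mul => //; exact: continuous_scale.
  - move=> k x; rewrite /G partial_periodic// pu.
    by rewrite !(wave_periodic _ nZ).
  - by move=> x; case: (GdG j x).
have : torus_int (fun x => \sum_j dG j x) = 0 by rewrite torus_int_sum// big1.
have -> : (fun x => \sum_j dG j x) = (fun x => (dot n n - mu) * (u x * wave n phi x)).
  apply/funext => x; rewrite -mulr_suml big_split/= -mulr_suml mulrA; congr (_ * _).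
  rewrite mulrBl -eu opprK [RHS]addrC; congr (_ + _ * _).
rewrite torus_intZ; last exact: continuous_mul.
by move/eqP; rewrite mulf_eq0 subr_eq0 (negbTE nmu) => /eqP.
Qed.

Definition wave_orthogonal f := forall n phi, integer_points n ->
  torus_int (fun x => f x * wave n phi x) = 0.

(** The factor times a wave of frequency n is a combination of waves of frequencies n, n + e_j and n
    - e_j, so orthogonality persists under products of such factors. *)
Lemma wave_orthogonal_mul_cos f (j : 'I_d) (a : R) : continuous f -> wave_orthogonal f ->
  wave_orthogonal (fun x => f x * ((1 + cos (x 0 j - a)) / 2)).
Proof.
move=> cf of_ n phi nZ; have eZ := integer_points_delta j.
have cw p c := @continuous_wave R d p c.
pose e : 'rV[R]_d := delta_mx 0 j.
have -> : (fun x => f x * ((1 + cos (x 0 j - a)) / 2) * wave n phi x) =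
    (fun x => 2^-1 * (f x * wave n phi x + 2^-1 * (f x * wave (n + e) (phi - a) x + f x * wave (n - e) (phi + a) x))).
  apply/funext => x; have := wave_mul n e phi (- a) x; rewrite opprK => wE.
  rewrite -mulrDr [2^-1 * (f x * _)]mulrCA -wE.
  have -> : cos (x 0 j - a) = wave e (- a) x by rewrite /wave dotC dot_delta.
  lra.
have cfw p c : continuous (fun x => f x * wave p c x) by exact: continuous_mul.
rewrite torus_intZ; last by do ?[apply: continuous_add|apply: continuous_scale].
rewrite torus_intD; [|by []|by apply: continuous_scale; exact: continuous_add].
rewrite torus_intZ; last exact: continuous_add.
rewrite torus_intD// (of_ _ _ nZ) (of_ _ _ (integer_pointsD nZ eZ)).
by rewrite (of_ _ _ (integer_pointsD nZ (integer_pointsN eZ))) addr0 mulr0 addr0 mulr0.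
Qed.

Lemma le_cos (s t : R) : 0 <= s -> s <= t -> t <= pi -> cos t <= cos s.
Proof. by move=> s0 st tp; rewrite leNgt ltr_cos ?in_itv/= -?leNgt//; lra. Qed.

(* The kernel prod_j ((1 + cos (x_j - y_j)) / 2) is at most q < 1 away from y,
   and above any q' < 1 near y, so its powers detect f y. *)
Lemma wave_orthogonal_le0 f y : continuous f -> wave_orthogonal f ->
  (forall j, 0 < y 0 j < 2 * pi) -> f y <= 0.
Proof.
move=> cf of_ yQ; rewrite leNgt; apply/negP => fy0.
pose c (j : 'I_d) x : R := (1 + cos (x 0 j - y 0 j)) / 2.
have c01 j x : 0 <= c j x <= 1.
  have := cos_geN1 (x 0 j - y 0 j); have := cos_le1 (x 0 j - y 0 j); rewrite /c; lra.
have cc j : continuous (c j).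
  have -> : c j = (fun x => 2^-1 * (1 + wave (delta_mx 0 j) (- y 0 j) x)).
    by apply/funext => x; rewrite /c /wave dotC dot_delta mulrC.
  apply: continuous_scale; apply: (@continuous_add _ _ (cst 1)); first by move=> ?; exact: cst_continuous.
  exact: continuous_wave.
pose P x := \prod_j c j x.
have cP : continuous P by apply: continuous_prod.
have orthP g : continuous g -> wave_orthogonal g -> wave_orthogonal (fun x => g x * P x).
  rewrite /P => cg og; elim: (index_enum _) g cg og => [|j s IH] g cg og.
    by under [X in wave_orthogonal X]eq_fun do rewrite big_nil mulr1.
  under [X in wave_orthogonal X]eq_fun do rewrite big_cons mulrA.
  apply: (IH (fun x => g x * c j x)); first exact: continuous_mul.
  exact: wave_orthogonal_mul_cos.
have cPN N : continuous (fun x => f x * P x ^+ N).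
  elim: N => [|N IH]; first by under [X in continuous X]eq_fun do rewrite expr0 mulr1.
  by under [X in continuous X]eq_fun do rewrite exprSr mulrA; exact: continuous_mul.
have orthPN N : wave_orthogonal (fun x => f x * P x ^+ N).
  elim: N => [|N IH]; first by under [X in wave_orthogonal X]eq_fun do rewrite expr0 mulr1.
  by under [X in wave_orthogonal X]eq_fun do rewrite exprSr mulrA; exact: orthP.
have int0 N : torus_int (fun x => f x * P x ^+ N) = 0.
  rewrite -(orthPN N 0 0 integer_points0); apply: eq_torus_int => x.
  by rewrite /wave dot0l addr0 cos0 mulr1.
have P01 x : 0 <= P x <= 1.
  apply/andP; split; first by apply: prodr_ge0 => j _; have /andP[] := c01 j x.
  by apply: prodr_ile1 => j _; exact: c01.
have Pc j x : P x <= c j x.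
  rewrite /P (bigD1 j)//= ler_piMr//; first by have /andP[] := c01 j x.
  by apply: prodr_ile1 => i _; exact: c01.
have [r r0 [rf rQ]] : exists2 r : R, 0 < r & (forall x, (forall j, `|y 0 j - x 0 j| < r) -> f y / 2 < f x) /\
    (forall x, (forall j, `|y 0 j - x 0 j| < r) -> forall j, 0 < x 0 j < 2 * pi).
  have n1 : nbhs y [set x | f y / 2 < f x].
    have /cf h : nbhs (f y) `]f y / 2, +oo[%classic.
      by apply: open_nbhs_nbhs; split; [exact: interval_open|rewrite /= in_itv/= andbT; lra].
    by apply: (@filterS _ (nbhs y) _ _ _ _ h) => x; rewrite /= in_itv/= andbT.
  have n2 : nbhs y [set x | forall j, 0 < x 0 j < 2 * pi].
    apply: (@filter_forall _ _ (fun (j : 'I_d) x => 0 < x 0 j < 2 * pi) (nbhs y)) => j.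
    have /(@coordC R d j y) h : nbhs (y 0 j) `]0, 2 * pi[%classic.
      by apply: open_nbhs_nbhs; split; [exact: interval_open|rewrite /= in_itv/= yQ].
    by apply: (@filterS _ (nbhs y) _ _ _ _ h) => x; rewrite /= in_itv.
  have : nbhs y ([set x | f y / 2 < f x] `&` [set x | forall j, 0 < x 0 j < 2 * pi]).
    exact: filterI.
  move=> /nbhs_ballP[r /= r0 rn]; exists r => //; split=> x xr.
    by have [] := rn x (conj r0 (fun i j => eq_ind_r (fun i => ball (y i j) r (x i j)) (xr j) (ord1 i))).
  by have [] := rn x (conj r0 (fun i j => eq_ind_r (fun i => ball (y i j) r (x i j)) (xr j) (ord1 i))).
pose e := Num.min (r / 2) (pi / 2).
have pi0 := pi_gt0 R.
have e0 : 0 < e by rewrite lt_min !divr_gt0.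
have [er ep] : e <= r / 2 /\ e <= pi / 2 by split; rewrite ge_min lexx ?orbT.
(* A margin e from both faces of the cell is needed because the kernel peaks again at distance 2 pi:
   inside the cell |x_j - y_j| then never exceeds 2 pi - e. *)
have ye j : e <= y 0 j <= 2 * pi - e.
  have er' : `|e| < r by rewrite gtr0_norm//; lra.
  have h1 := rQ (y - const_mx e); have h2 := rQ (y + const_mx e).
  have /h1/(_ j) : forall i, `|y 0 i - (y - const_mx e) 0 i| < r.
    by move=> i; rewrite !mxE opprB addrC subrK.
  have /h2/(_ j) : forall i, `|y 0 i - (y + const_mx e) 0 i| < r.
    by move=> i; rewrite !mxE opprD addrA subrr add0r normrN.
  rewrite !mxE; lra.
pose q : R := (1 + cos e) / 2.
have cose : cos e < 1.
  rewrite -[ltRHS]cos0 ltr_cos ?in_itv/=; lra.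
have q01 : 0 <= q < 1.
  by rewrite /q; have := cos_geN1 e; lra.
have far x : fundamental_domain x -> (exists j, e <= `|x 0 j - y 0 j|) -> P x <= q.
  move=> Qx [j ej]; apply: le_trans (Pc j x) _; rewrite /c /q ler_pM2r ?invr_gt0// lerD2l.
  have -> : cos (x 0 j - y 0 j) = cos `|x 0 j - y 0 j|.
    by have [h|h] := leP 0 (x 0 j - y 0 j); [rewrite ger0_norm|rewrite ltr0_norm// cosN].
  have : `|x 0 j - y 0 j| <= 2 * pi - e.
    by rewrite ler_norml; have := Qx j; have := ye j; lra.
  move: `|_| ej => t et t2.
  have [tp|tp] := leP t pi; first by apply: le_cos; lra.
  have -> : cos t = cos (2 * pi - t).
    by rewrite -cosN -[LHS](cosD2pi_int _ 1) mulr1 addrC.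
  by apply: le_cos; lra.
have q0 : 0 <= q by case/andP: q01.
(* Halfway between the bound q off the peak and the peak value 1. *)
pose q' := (1 + q) / 2.
have qq' : q < q' by rewrite /q'; lra.
have q'0 : 0 < q' by rewrite /q'; lra.
have Py : P y = 1.
  by apply: big1 => j _; rewrite /c subrr cos0 -[1 + 1]/(2%:R) divff ?pnatr_eq0.
have [s s0 sP] : exists2 s : R, 0 < s & forall x, (forall j, `|y 0 j - x 0 j| < s) -> q' < P x.
  have : nbhs (P y) `]q', +oo[%classic.
    by apply: open_nbhs_nbhs; split; [exact: interval_open|rewrite /= in_itv/= andbT Py /q'; lra].
  move/cP => /nbhs_ballP[s /= s0 sP]; exists s => // x xs.
  have : ball y s x by split=> // i j; rewrite (ord1 i) /ball/=; exact: xs.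
  by move/sP; rewrite /= in_itv/= andbT.
(* Side below s, so that the kernel exceeds q' on [E]; below e, so that [E] lies in the cell and f >
   f y / 2 on it. *)
pose t := Num.min s e / 2.
have [t0 ts te] : [/\ 0 < t, t < s & t < e].
  have h : 0 < Num.min s e by rewrite lt_min s0.
  have [hs he] : Num.min s e <= s /\ Num.min s e <= e by split; rewrite ge_min lexx ?orbT.
  by rewrite /t; split; lra.
pose E := [set x : 'rV[R]_d | forall j, y 0 j <= x 0 j < y 0 j + t].
have Et x j : E x -> `|y 0 j - x 0 j| < s by move=> /(_ j) xj; rewrite ltr_norml; lra.
have EQ : E `<=` fundamental_domain.
  by move=> x Ex j; have := Ex j; have := ye j; lra.
have mE : measurable (E : set (caratheodory_type (@hausdorff_outer R d d))).
  have -> : E = \bigcap_(j in [set: 'I_d]) ([set x : 'rV[R]_d | y 0 j <= x 0 j] `&` [set x | x 0 j < y 0 j + t]).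
    apply/seteqP; split=> x Ex j => [_|].
      by have /andP[h1 h2] := Ex j.
    by have [/= -> ->] := Ex j I.
  apply: fin_bigcap_measurable => // j _; apply: measurableI.
    exact: coord_measurable_ge.
  exact: coord_measurable_lt.
have E0 : (0 < hausdorff_measure d E)%E.
  apply: (@hausdorff_box_gt0 _ _ y (t / 2)); first by rewrite divr_gt0.
  by move=> x xE j; have := xE j; lra.
pose m0 := fine (hausdorff_measure d E).
have Eoo : (hausdorff_measure d E < +oo)%E.
  by apply: le_lt_trans fundamental_domain_lt; exact: le_hausdorff.
have m00 : 0 < m0 by rewrite fine_gt0// E0.
have [B B0 fB] := continuous_bounded_cube (2 * pi) cf.
pose V := fine (hausdorff_measure d (@fundamental_domain R d)).
(* Three regions: on [E] both factors are bounded below; elsewhere within e of y the product is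
   nonnegative since f is; farther away it is at most B q^N in absolute value. *)
have bound N x : fundamental_domain x ->
    f y / 2 * q' ^+ N * \1_E x - B * q ^+ N <= f x * P x ^+ N.
  move=> Qx; have /andP[P0 P1] := P01 x.
  have fBx : `|f x| <= B by apply: fB; exact: fundamental_domain_sub_cube Qx.
  have qN : 0 <= q ^+ N by rewrite exprn_ge0.
  have [near|/existsNP[j /negP]] := pselect (forall j, `|y 0 j - x 0 j| < e).
    have fx : f y / 2 < f x by apply: rf => j; have := near j; lra.
    have [Ex|nEx] := pselect (E x).
      rewrite indicE mem_set// mulr1; apply: (@le_trans _ _ (f y / 2 * q' ^+ N)).
        by rewrite gerDl oppr_le0 mulr_ge0// ltW.
      apply: ler_pM; [by lra|by rewrite exprn_ge0// ltW|exact: ltW|].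
      by rewrite lerXn2r ?nnegrE ?(ltW q'0)// ltW// sP// => j; exact: Et.
    rewrite indicE memNset// mulr0 sub0r (@le_trans _ _ 0)//.
      by rewrite oppr_le0 mulr_ge0// ltW.
    by rewrite mulr_ge0 ?exprn_ge0//; lra.
  rewrite -leNgt distrC => ej; have Pq : P x <= q by apply: far => //; exists j.
  have -> : \1_E x = 0 :> R.
    rewrite indicE memNset// => Ex; have := Ex j; move: ej; rewrite ler_normr; lra.
  rewrite mulr0 sub0r; apply: (@le_trans _ _ (- (`|f x| * P x ^+ N))).
    rewrite lerN2; apply: ler_pM => //; first by rewrite exprn_ge0.
    by rewrite lerXn2r ?nnegrE//; lra.
  by rewrite -mulNr ler_wpM2r ?exprn_ge0// lerNnormlW.
have key N : f y / 2 * q' ^+ N * m0 <= B * q ^+ N * V.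
  rewrite -subr_le0 -(int0 N).
  exact: (Rintegral_ge_indic fundamental_domain_measurable mE EQ fundamental_domain_lt
    (torus_integrable (cPN N)) (@bound N)).
(* As (q / q')^N tends to 0, [key] fails for large N. Using B * V + 1 keeps the denominator positive
   without a lower bound on V. *)
have ratio : `|q / q'| < 1.
  have qq0 : 0 <= q / q' by rewrite divr_ge0// ltW.
  by rewrite (ger0_norm qq0) ltr_pdivrMr ?mul1r.
have /cvgrPdist_lt := cvg_expr ratio.
have V0 : 0 <= V by rewrite fine_ge0// measure_ge0.
have z0 : 0 < f y / 2 * m0 / (B * V + 1).
  by rewrite !divr_gt0 ?mulr_gt0 ?divr_gt0// ltr_wpDl// mulr_ge0// ltW.
move=> /(_ _ z0) [N _ /(_ N (leqnn N))] /=.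
rewrite sub0r normrN ger0_norm; last by apply: exprn_ge0; rewrite divr_ge0// ltW.
rewrite expr_div_n ltr_pdivrMr ?exprn_gt0// => h.
have BV : 0 < B * V + 1 by rewrite ltr_wpDl// mulr_ge0// ltW.
have := key N; rewrite leNgt => /negP; apply.
have qN : 0 <= q ^+ N by rewrite exprn_ge0.
apply: (@le_lt_trans _ _ ((B * V + 1) * q ^+ N)); first by rewrite mulrDl mul1r mulrAC lerDl.
have -> : f y / 2 * q' ^+ N * m0 = (B * V + 1) * (f y / 2 * m0 / (B * V + 1) * q' ^+ N).
  by field; rewrite gt_eqF.
by rewrite ltr_pM2l.
Qed.

(** [wave_orthogonal_le0] for f and - f settles interior points of the cell. A lattice translation
    brings any point to the half-open cell, and a face point has interior points arbitrarily close,
    so continuity finishes. *)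
Lemma wave_orthogonal_eq0 f : continuous f -> lattice_periodic f -> wave_orthogonal f ->
  forall y, f y = 0.
Proof.
move=> cf pf of_.
have inner y : (forall j, 0 < y 0 j < 2 * pi) -> f y = 0.
  move=> yQ; apply/eqP; rewrite eq_le wave_orthogonal_le0//= -oppr_le0.
  apply: (@wave_orthogonal_le0 (fun x => - f x)) => //; first exact: continuous_opp.
  move=> n phi nZ.
  under eq_torus_int do rewrite -mulN1r -mulrA.
  rewrite torus_intZ ?of_ ?mulr0//; exact: continuous_mul (@continuous_wave _ _ n phi).
move=> y; have pi0 := pi_gt0 R.
pose k : 'rV[int]_d := \row_j - Num.floor (y 0 j / (2 * pi)).
pose z := y + (2 * pi) *: of_int k.
have zQ j : 0 <= z 0 j < 2 * pi.
  rewrite !mxE rmorphN/=; set F := Num.floor _.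
  have /andP[] := floor_itv (y 0 j / (2 * pi)); rewrite -/F.
  rewrite ler_pdivlMr ?mulr_gt0// ltr_pdivrMr ?mulr_gt0// intrD; lra.
rewrite -(pf k) -/z; apply/eqP; apply/negPn/negP => fz.
have : nbhs z [set x | f x != 0].
  have : nbhs (f z) (~` [set 0]).
    apply: open_nbhs_nbhs; split; last exact/eqP.
    by apply: closed_openC; exact: closed_eq.
  by move=> /cf h; apply: (@filterS _ (nbhs z) _ _ _ _ h) => x /eqP.
move=> /nbhs_ballP[r /= r0 rz].
pose w : 'rV[R]_d := \row_j (z 0 j + Num.min r (2 * pi - z 0 j) / 2).
have wj j : 0 < w 0 j - z 0 j /\ w 0 j - z 0 j < r /\ w 0 j - z 0 j < 2 * pi - z 0 j.
  have h : 0 < Num.min r (2 * pi - z 0 j) by rewrite lt_min r0; have := zQ j; lra.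
  have [h1 h2] : Num.min r (2 * pi - z 0 j) <= r /\ Num.min r (2 * pi - z 0 j) <= 2 * pi - z 0 j.
    by split; rewrite ge_min lexx ?orbT.
  rewrite mxE; split; [lra|split; lra].
have : f w != 0.
  apply: rz; split=> // i j; rewrite (ord1 i) /ball/= distrC gtr0_norm; have := wj j; lra.
by rewrite inner ?eqxx// => j; have := wj j; have := zQ j; lra.
Qed.

End Completeness.

(** * Fourier expansion of real eigenfunctions and Parseval's identity *)

Definition torus_volume (R : realType) (d : nat) : R :=
  fine (hausdorff_measure d (@fundamental_domain R d)).

Section Expansion.
Context {R : realType} {d : nat}.
Implicit Types (n m x y : 'rV[R]_d) (phi : R).

Lemma torus_volume_gt0 : 0 < torus_volume R d.
Proof. by apply: fine_gt0; rewrite fundamental_domain_gt0 fundamental_domain_lt. Qed.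

Lemma waveN n phi x : wave (- n) phi x = wave n (- phi) x.
Proof. by rewrite /wave dotNl -cosN opprD opprK. Qed.

Lemma wave_shift_sum n phi x :
  wave n phi x = cos phi * wave n 0 x - sin phi * wave n (- (pi / 2)) x.
Proof. by rewrite /wave addr0 cosBpihalf cosD; ring. Qed.

(* Both n and -n occur in Lam, and each carries half of the common real mode. *)
Lemma eigen_expansion (u : 'rV[R]_d -> R) (mu : R) (Lam : seq 'rV[R]_d) :
  C2 u -> lattice_periodic u -> (forall x, - laplacian u x = mu * u x) ->
  uniq Lam -> (forall n, n \in Lam <-> integer_points n /\ dot n n = mu) ->
  exists a b : 'rV[R]_d -> R,
    (forall x, u x = \sum_(n <- Lam) (a n * wave n 0 x + b n * wave n (- (pi / 2)) x)) /\
    torus_int (fun x => u x ^+ 2) = torus_volume R d * \sum_(n <- Lam) (a n ^+ 2 + b n ^+ 2).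
Proof.
move=> C2u pu eu Lu LamP; have cu : continuous u by case: C2u => -[].
have V0 := torus_volume_gt0; set V := torus_volume R d in V0 *.
have cw n phi : continuous (@wave R d n phi) by exact: continuous_wave.
have cuw n phi : continuous (fun x => u x * wave n phi x) by exact: continuous_mul.
(* The square of a nonconstant wave has integral V / 2; dividing by V gives half the usual
   coefficient, as n and -n are both summed. *)
pose A n phi := torus_int (fun x => u x * wave n phi x) / V.
pose a n := A n 0; pose b n := A n (- (pi / 2)).
have AE n phi : A n phi = cos phi * a n - sin phi * b n.
  rewrite /a /b /A !mulrA -mulrBl -!torus_intZ// -torus_intB; do ?exact: continuous_scale.
  by congr (_ / _); apply: eq_torus_int => x; rewrite wave_shift_sum; ring.
have AN n phi : A (- n) phi = A n (- phi).
  by congr (_ / _); apply: eq_torus_int => x; rewrite waveN.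
have aN n : a (- n) = a n by rewrite /a AN oppr0.
have bN n : b (- n) = - b n.
  by rewrite /b AN opprK AE cos_pihalf sin_pihalf /b; ring.
have LamZ n : n \in Lam -> integer_points n by move=> /LamP[].
have LamN n : n \in Lam -> - n \in Lam.
  move=> /LamP[nZ nn]; apply/LamP; split; first exact: integer_pointsN.
  by rewrite dotNl dotNr opprK.
pose g x := \sum_(n <- Lam) (a n * wave n 0 x + b n * wave n (- (pi / 2)) x).
have cg1 n : continuous (fun x => a n * wave n 0 x + b n * wave n (- (pi / 2)) x).
  by apply: continuous_add; exact: continuous_scale.
have cg : continuous g by apply: continuous_sum => n _; exact: cg1.
have pg : lattice_periodic g.
  move=> k x; rewrite /g !big_seq; apply: eq_bigr => n /LamZ nZ.
  by rewrite !(wave_periodic _ nZ).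
have gw m phi : integer_points m -> torus_int (fun x => g x * wave m phi x) =
    if m \in Lam then V * A m phi else 0.
  move=> mZ.
  have -> : (fun x => g x * wave m phi x) = (fun x => \sum_(n <- Lam)
      (a n * (wave n 0 x * wave m phi x) + b n * (wave n (- (pi / 2)) x * wave m phi x))).
    by apply/funext => x; rewrite /g mulr_suml; apply: eq_bigr => n _; rewrite mulrDl !mulrA.
  have cww n p : continuous (fun x => wave n p x * wave m phi x) by exact: continuous_mul.
  rewrite torus_int_sum; last by move=> n; apply: continuous_add; exact: continuous_scale.
  (* Only n = m and n = -m survive; [a] is even and [b] odd, so the two contributions are equal. *)
  pose T n := 2^-1 * V * ((n == - m)%:R * (a n * cos phi + b n * sin phi) +
      (n == m)%:R * (a n * cos phi - b n * sin phi)).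
  have termE n : n \in Lam -> torus_int (fun x => a n * (wave n 0 x * wave m phi x) +
      b n * (wave n (- (pi / 2)) x * wave m phi x)) = T n.
    move=> /LamZ nZ; rewrite torus_intD; [|exact: continuous_scale..].
    rewrite !torus_intZ// !torus_int_wave_mul// -/(torus_volume R d) -/V addr_eq0 add0r sub0r.
    rewrite cosN addrC (addrC (- (pi / 2))) cosBpihalf -opprD cosN (addrC (pi / 2)) cosDpihalf /T; ring.
  rewrite big_seq (eq_bigr _ termE) -big_seq.
  case: ifPn => [mL|mL].
    rewrite /T -mulr_sumr big_split/= (bigD1_seq (- m)) ?LamN//= eqxx mul1r.
    rewrite big1 ?addr0 => [|n /negbTE ->]; last by rewrite mul0r.
    rewrite (bigD1_seq m)//= eqxx mul1r big1 ?addr0 => [|n /negbTE ->]; last by rewrite mul0r.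
    by rewrite aN bN AE; lra.
  rewrite big_seq big1// => n nL; rewrite /T.
  have -> : (n == m) = false by apply: contraNF mL => /eqP <-.
  have -> : (n == - m) = false by apply: contraNF mL => /eqP nm; rewrite -(opprK m) -nm LamN.
  by rewrite !mul0r addr0 mulr0.
have ug x : u x = g x.
  apply/eqP; rewrite -subr_eq0; apply/eqP.
  apply: (@wave_orthogonal_eq0 _ _ (fun x => u x - g x)).
  - exact: continuous_sub.
  - by move=> k z; rewrite pu pg.
  (* Frequencies in [Lam] cancel by the choice of coefficients; at all others [g] has no component,
     and neither has [u] by Green's identity. *)
  move=> m phi mZ; under eq_torus_int do rewrite mulrBl.
  rewrite torus_intB//; last exact: continuous_mul.
  rewrite gw//; case: ifPn => mL; first by rewrite /A mulrC divfK ?subrr// gt_eqF.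
  rewrite (laplacian_orthogonal phi C2u pu eu mZ) ?subrr//.
  by apply: contra mL => /eqP mm; apply/LamP.
exists a, b; split=> //.
(* Only one factor of u^2 is expanded, so the integrals that appear are the coefficients themselves
   and no cross terms arise. *)
have -> : (fun x => u x ^+ 2) = (fun x => \sum_(n <- Lam) (a n * (u x * wave n 0 x) + b n * (u x * wave n (- (pi / 2)) x))).
  apply/funext => x; rewrite expr2 {2}ug mulr_sumr; apply: eq_bigr => n _; ring.
rewrite torus_int_sum; last by move=> n; apply: continuous_add; exact: continuous_scale.
rewrite mulr_sumr; apply: eq_bigr => n _.
rewrite torus_intD; [|exact: continuous_scale..].
rewrite !torus_intZ// /a /b /A; field; exact: lt0r_neq0.
Qed.

End Expansion.

(** * Oscillatory integrals on a plane *)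

Lemma integrable_scaler {disp} {T : measurableType disp} {R : realType}
    (mu : {measure set T -> \bar R}) (D : set T) (c : R) (f : T -> R) : measurable D ->
  mu.-integrable D (EFin \o f) -> mu.-integrable D (EFin \o (fun x => c * f x)).
Proof.
move=> mD fi; have -> : EFin \o (fun x => c * f x) = (fun x => (c%:E * (EFin \o f) x)%E).
  by apply/funext => x; rewrite /= EFinM.
exact: integrableZl.
Qed.

Lemma integrable_addr {disp} {T : measurableType disp} {R : realType}
    (mu : {measure set T -> \bar R}) (D : set T) (f g : T -> R) : measurable D ->
  mu.-integrable D (EFin \o f) -> mu.-integrable D (EFin \o g) ->
  mu.-integrable D (EFin \o (fun x => f x + g x)).
Proof.
move=> mD fi gi; have -> : EFin \o (fun x => f x + g x) = (fun x => ((EFin \o f) x + (EFin \o g) x)%E).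
  by apply/funext => x; rewrite /= EFinD.
exact: integrableD.
Qed.

Lemma Rintegral_sum {disp} {T : measurableType disp} {R : realType}
    (mu : {measure set T -> \bar R}) (D : set T) (I : Type) (s : seq I) (F : I -> T -> R) :
  measurable D -> (forall i, mu.-integrable D (EFin \o F i)) ->
  mu.-integrable D (EFin \o (fun x => \sum_(i <- s) F i x)) /\
  \int[mu]_(x in D) (\sum_(i <- s) F i x) = \sum_(i <- s) \int[mu]_(x in D) F i x.
Proof.
move=> mD Fi; elim: s => [|i s [IH1 IH2]].
  have -> : (fun x => \sum_(i <- [::]) F i x) = cst 0 by apply/funext => x; rewrite big_nil.
  by rewrite big_nil Rintegral_cst// mul0r; split=> //; exact: integrable0.
have -> : (fun x => \sum_(j <- i :: s) F j x) = (fun x => F i x + \sum_(j <- s) F j x).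
  by apply/funext => x; rewrite big_cons.
by rewrite big_cons -IH2 -RintegralD//; split=> //; exact: integrable_addr.
Qed.

Lemma Rintegral_le_support {disp} {T : measurableType disp} {R : realType}
    (mu : {measure set T -> \bar R}) (M : R) (D B : set T) (f : T -> R) :
  measurable D -> measurable B -> (mu (D `&` B) < +oo)%E -> measurable_fun D f ->
  (forall x, D x -> `|f x| <= M) -> (forall x, D x -> ~ B x -> f x = 0) ->
  `|\int[mu]_(x in D) f x| <= M * fine (mu (D `&` B)).
Proof.
move=> mD mB Doo mf fM f0.
have fi : mu.-integrable D (EFin \o f) by exact: (integrable_bounded_support mD mB Doo mf fM f0).
apply: le_trans (le_normr_Rintegral mD fi) _.
have mi : measurable_fun D (\1_B : T -> R) by apply: measurable_funTS; apply: measurable_indic.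
have i1 : mu.-integrable D (EFin \o \1_B).
  apply: (integrable_bounded_support (M := 1) mD mB) => //.
    by move=> x _; rewrite ger0_norm// indicE; case: (_ \in _).
  by move=> x _ nB; rewrite indicE memNset.
have iM := integrable_scaler M mD i1.
have -> : M * fine (mu (D `&` B)) = \int[mu]_(x in D) (M * \1_B x).
  by rewrite RintegralZl// /Rintegral integral_indic// setIC.
apply: le_Rintegral => //; first exact: integrable_norm fi.
move=> x Dx; have [Bx|nBx] := pselect (B x); first by rewrite indicE mem_set// mulr1 fM.
by rewrite f0// indicE memNset// normr0 mulr0.
Qed.

Section Orthonormal.
Context {R : realType} {k d : nat}.
Implicit Types (W : 'M[R]_(k, d)) (p q x : 'rV[R]_d) (t : 'rV[R]_k).

Definition orthonormal_rows W := W *m W^T = 1%:M.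

Definition plane p W : set 'rV[R]_d := [set p + t *m W | t in [set: 'rV[R]_k]].

Lemma dot_mulmx {m} (x y : 'rV[R]_m) : dot x y = (x *m y^T) 0 0.
Proof. by rewrite mxE; apply: eq_bigr => i _; rewrite mxE. Qed.

Lemma dot_row_mulmx {a m} (A : 'M[R]_(a, m)) (x : 'rV[R]_m) j : dot (row j A) x = (x *m A^T) 0 j.
Proof. by rewrite dotC mxE; apply: eq_bigr => i _; rewrite !mxE. Qed.

Lemma dot_mulmxE W t x : dot (t *m W) x = \sum_j t 0 j * dot (row j W) x.
Proof.
rewrite dot_mulmx -mulmxA mxE; apply: eq_bigr => j _; congr (_ * _).
by rewrite mxE; apply: eq_bigr => i _; rewrite !mxE.
Qed.

Lemma orthonormal_dot W i j : orthonormal_rows W -> dot (row i W) (row j W) = (i == j)%:R.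
Proof. by move=> oW; rewrite dotC dot_row_mulmx -row_mul oW !mxE eq_sym. Qed.

Lemma orthonormal_enorm W t : orthonormal_rows W -> enorm (t *m W) = enorm t.
Proof.
move=> oW; rewrite /enorm dot_mulmxE; congr Num.sqrt; apply: eq_bigr => j _.
by rewrite dot_row_mulmx -mulmxA oW mulmx1.
Qed.

Lemma orthonormal_row_enorm W j : orthonormal_rows W -> enorm (row j W) = 1.
Proof. by move=> oW; rewrite /enorm orthonormal_dot// eqxx sqrtr1. Qed.

Lemma plane_coordE W t q j p : orthonormal_rows W ->
  dot (row j W) (p + t *m W - q) = t 0 j + dot (row j W) (p - q).
Proof.
move=> oW; rewrite addrAC (dotDr (p - q)) addrC; congr (_ + _).
by rewrite dot_row_mulmx -mulmxA oW mulmx1.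
Qed.

Lemma plane_translate p W j (h : R) x :
  plane p W (x + h *: row j W) <-> plane p W x.
Proof.
have rowE : h *: row j W = (h *: delta_mx 0 j) *m W by rewrite -scalemxAl -rowE.
split=> -[t _ tx].
  exists (t - h *: delta_mx 0 j) => //.
  by rewrite mulmxBl -rowE addrA tx addrK.
by exists (t + h *: delta_mx 0 j) => //; rewrite mulmxDl -rowE addrA tx.
Qed.

Lemma plane_closed p W : orthonormal_rows W -> closed (plane p W).
Proof.
(* [N] is the orthogonal projection onto the normal space, so the plane is the zero set of the
   continuous function |(x - p) N|^2. *)
move=> oW; pose N : 'M[R]_d := 1%:M - W^T *m W.
pose F x := \sum_i dot (row i N^T) (x - p) ^+ 2.
have cF : continuous F.
  apply: continuous_sum => i _.
  have c1 : continuous (fun x : 'rV[R]_d => dot (row i N^T) (x - p)).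
    exact: continuous_translate (@continuous_dotr _ _ (row i N^T)).
  by apply: (continuous_mul c1).
have -> : plane p W = F @^-1` [set 0].
  apply/seteqP; split=> x.
    move=> [t _ <-]; apply: big1 => i _.
    rewrite (addrAC p) subrr add0r dot_row_mulmx trmxK /N mulmxBr mulmx1 mulmxA -(mulmxA t) oW mulmx1.
    by rewrite subrr mxE expr0n.
  move=> /eqP; rewrite /F psumr_eq0 => [/allP h|i _]; last exact: sqr_ge0.
  exists ((x - p) *m W^T) => //; apply/rowP => i.
  have := h i (mem_index_enum _); rewrite /= sqrf_eq0 dot_row_mulmx trmxK /N mulmxBr mulmx1 => /eqP.
  by rewrite mxE mxE mulmxA !mxE; lra.
apply: closed_comp; last exact: closed_eq.
by move=> x _; exact: cF.
Qed.

Lemma plane_box_hausdorff p q W (L : R) : orthonormal_rows W ->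
  (hausdorff k (plane p W `&` [set x | forall j, `|dot (row j W) (x - q)%R| <= L]%R) <=
   hausdorff k (cube k (2 * L)%R))%E.
Proof.
(* [tau] holds the coordinates of p relative to q; [f] maps a cube of side 2 L into the plane
   without increasing distances, and its image covers the box. *)
move=> oW; pose tau := \row_j dot (row j W) (p - q).
pose f (s : 'rV[R]_k) := p + (s - tau - const_mx L) *m W.
have fL s s' : enorm (f s - f s') <= 1 * enorm (s - s').
  rewrite mul1r /f opprD addrACA subrr add0r -mulmxBl orthonormal_enorm//.
  by rewrite opprB addrA subrK opprB addrA subrK.
apply: (@le_trans _ _ (hausdorff k (f @` cube k (2 * L)))); last first.
  by have := hausdorff_image_le k (cube k (2 * L)) ltr01 fL; rewrite expr1n mul1e.
apply: le_hausdorff => _ [[t _ <-] tL]; exists (t + tau + const_mx L); last first.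
  by rewrite /f (addrAC (t + tau + _)) !addrK.
move=> j; have := tL j; rewrite plane_coordE// !mxE ler_norml; lra.
Qed.

End Orthonormal.

Section Oscillation.
Context {R : realType} {k d : nat} (p q : 'rV[R]_d) (W : 'M[R]_(k, d)).
Context (oW : orthonormal_rows W).
Local Notation mu := (@hausdorff_measure R d k).
Local Notation T := (caratheodory_type (@hausdorff_outer R d k)).
Local Notation P := (plane p W).
Implicit Types (beta : 'I_k -> R -> R) (x xi : 'rV[R]_d).

Let box (L : R) : set 'rV[R]_d := [set x | forall j, `|dot (row j W) (x - q)| <= L].

Definition coord_prod beta x := \prod_(j < k) beta j (dot (row j W) (x - q)).

Lemma plane_measurable : measurable (P : set T).
Proof. by apply: closed_measurable_hausdorff; exact: plane_closed. Qed.

Lemma continuous_plane_coord j : continuous (fun x => dot (row j W) (x - q)).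
Proof. exact: continuous_translate (@continuous_dotr _ _ (row j W)). Qed.

Lemma continuous_coord_prod beta : (forall j, continuous (beta j)) -> continuous (coord_prod beta).
Proof.
move=> cb; apply: continuous_prod => j _ x.
by apply: (continuous_comp (@continuous_plane_coord j x)); exact: cb.
Qed.

Lemma box_measurable (L : R) : measurable (box L : set T).
Proof.
have -> : box L = \bigcap_(j in [set: 'I_k]) ((fun x => dot (row j W) (x - q)) @^-1` `[- L, L]%classic).
  by apply/seteqP; split=> x xL j; [move=> _|]; have := xL j; rewrite /= in_itv/= ler_norml//; exact.
apply: fin_bigcap_measurable => // j _.
apply: closed_measurable_hausdorff; apply: closed_comp; last exact: interval_closed.
by move=> x _; exact: continuous_plane_coord.
Qed.

Definition bump_family (M : 'I_k -> R) (L : R) beta := forall j,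
  [/\ continuous (beta j), forall t, `|beta j t| <= M j & forall t, L < `|t| -> beta j t = 0].

Lemma coord_prod_le M L beta x : bump_family M L beta -> `|coord_prod beta x| <= \prod_j M j.
Proof.
move=> b; rewrite normr_prod; apply: ler_prod => j _.
by rewrite normr_ge0; have [_ ->] := b j.
Qed.

Lemma coord_prod_supp M L beta x : bump_family M L beta -> ~ box L x -> coord_prod beta x = 0.
Proof.
move=> b /existsNP[j /negP]; rewrite -ltNge => xL.
by rewrite /coord_prod (bigD1 j)//=; have [_ _ ->//] := b j; rewrite mul0r.
Qed.

Lemma plane_box_lt L : (mu (P `&` box L) < +oo)%E.
Proof. exact: le_lt_trans (plane_box_hausdorff p q L oW) (hausdorff_cube_lt k (2 * L)). Qed.

Lemma coord_prod_integrable M L beta (g : 'rV[R]_d -> R) : bump_family M L beta ->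
  continuous g -> (forall x, `|g x| <= 1) ->
  mu.-integrable P (EFin \o (fun x => coord_prod beta x * g x)).
Proof.
move=> b cg g1; have mB := box_measurable L.
apply: (integrable_bounded_support (M := \prod_j M j) plane_measurable mB (plane_box_lt L)).
- apply: continuous_measurable_hausdorff; apply: continuous_mul => //.
  by apply: continuous_coord_prod => j; have [] := b j.
- move=> x _; rewrite normrM -[leRHS]mulr1; apply: ler_pM => //; exact: coord_prod_le b.
- by move=> x _ nB; rewrite (coord_prod_supp b nB) mul0r.
Qed.

Lemma coord_prod_int_le M L beta (g : 'rV[R]_d -> R) : bump_family M L beta ->
  continuous g -> (forall x, `|g x| <= 1) ->
  `|\int[mu]_(x in P) (coord_prod beta x * g x)| <=
  (\prod_j M j) * fine (hausdorff k (cube k (2 * L) : set 'rV[R]_k)).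
Proof.
move=> b cg g1; have mB := box_measurable L.
have M0 : 0 <= \prod_j M j by apply: le_trans (coord_prod_le 0 b).
apply: (@le_trans _ _ ((\prod_j M j) * fine (mu (P `&` box L)))).
  apply: (Rintegral_le_support (M := \prod_j M j) plane_measurable mB (plane_box_lt L)).
  - apply: continuous_measurable_hausdorff; apply: continuous_mul => //.
    by apply: continuous_coord_prod => j; have [] := b j.
  - move=> x _; rewrite normrM -[leRHS]mulr1; apply: ler_pM => //; exact: coord_prod_le b.
  - by move=> x _ nB; rewrite (coord_prod_supp b nB) mul0r.
apply: ler_wpM2l => //; apply: fine_le.
- by rewrite ge0_fin_numE ?hausdorff_ge0//; exact: plane_box_lt.
- by rewrite ge0_fin_numE ?hausdorff_ge0//; exact: hausdorff_cube_lt.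
- exact: plane_box_hausdorff.
Qed.

Definition shift_at (j : 'I_k) (h : R) beta : 'I_k -> R -> R :=
  fun i => if i == j then (fun t => beta j (t + h)) else beta i.

(** The divisor 4 preserves the oscillatory integral I: each term shifted by half a wavelength
    contributes - I, and 2 + 1 + 1 = 4. *)
Definition second_diff (h : R) (f : R -> R) (t : R) := (2 * f t - f (t + h) - f (t - h)) / 4.

Definition second_diff_at (j : 'I_k) (h : R) beta : 'I_k -> R -> R :=
  fun i => if i == j then second_diff h (beta j) else beta i.

Lemma coord_prod_at (j : 'I_k) beta x : coord_prod beta x =
  beta j (dot (row j W) (x - q)) * \prod_(i < k | i != j) beta i (dot (row i W) (x - q)).
Proof. by rewrite /coord_prod (bigD1 j). Qed.

Lemma coord_translate i j (h : R) x : dot (row i W) (x + h *: row j W - q) =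
  dot (row i W) (x - q) + (if i == j then h else 0).
Proof.
rewrite addrAC (dotDr (x - q)) dotZr orthonormal_dot//.
by case: eqP => _; rewrite ?mulr1 ?mulr0.
Qed.

Lemma coord_prod_translate j (h : R) beta x :
  coord_prod beta (x + h *: row j W) = coord_prod (shift_at j h beta) x.
Proof.
rewrite !(coord_prod_at j) coord_translate eqxx /shift_at eqxx; congr (_ * _).
apply: eq_bigr => i ij; rewrite coord_translate (negbTE ij) addr0 //.
Qed.

Lemma bump_family_shift M L beta j h : bump_family M L beta ->
  bump_family M (L + `|h|) (shift_at j h beta).
Proof.
move=> b i; rewrite /shift_at; case: eqP => [->|_].
  have [c1 c2 c3] := b j; split=> [|t|t Lt].
  - move=> t; apply: (@continuous_comp _ _ _ (fun t => t + h) (beta j)); last exact: c1.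
    by apply: (@continuousD R _ _ id (cst h)); [exact: cvg_id|exact: cst_continuous].
  - exact: c2.
  - apply: c3; have := ler_normB (t + h) h; rewrite addrK; lra.
have [c1 c2 c3] := b i; split=> // t Lt; apply: c3; have := normr_ge0 h; lra.
Qed.

Lemma coord_prod_second_diff j (h : R) beta x : coord_prod (second_diff_at j h beta) x =
  (2 * coord_prod beta x - coord_prod (shift_at j h beta) x - coord_prod (shift_at j (- h) beta) x) / 4.
Proof.
rewrite !(coord_prod_at j) /second_diff_at /shift_at !eqxx /second_diff.
have E (f : R -> R) : \prod_(i < k | i != j) (if i == j then f else beta i) (dot (row i W) (x - q)) =
    \prod_(i < k | i != j) beta i (dot (row i W) (x - q)).
  by apply: eq_bigr => i /negbTE ->.
by rewrite !E; ring.
Qed.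

(* Translating by h = pi / xi_j along the j-th axis changes the sign of the wave. *)
Lemma coord_prod_int_second_diff M L beta j xi phi : bump_family M L beta ->
  dot xi (row j W) != 0 ->
  \int[mu]_(x in P) (coord_prod (second_diff_at j (pi / dot xi (row j W)) beta) x * wave xi phi x) =
  \int[mu]_(x in P) (coord_prod beta x * wave xi phi x).
Proof.
move=> b xj0; set h := pi / _.
have cw : continuous (@wave R d xi phi) by exact: continuous_wave.
have w1 x : `|wave xi phi x| <= 1 by rewrite ler_norml cos_le1 cos_geN1.
have int L' beta' : bump_family M L' beta' ->
    mu.-integrable P (EFin \o (fun x => coord_prod beta' x * wave xi phi x)).
  by move=> b'; exact: coord_prod_integrable b' cw w1.
have shift (h' : R) : (forall x, wave xi phi (x + h' *: row j W) = - wave xi phi x) ->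
    \int[mu]_(x in P) (coord_prod (shift_at j h' beta) x * wave xi phi x) =
    - \int[mu]_(x in P) (coord_prod beta x * wave xi phi x).
  move=> wh; have mf : measurable_fun (P : set T) (fun x => coord_prod beta x * wave xi phi x).
    apply: continuous_measurable_hausdorff; apply: continuous_mul => //.
    by apply: continuous_coord_prod => i; have [] := b i.
  have PE : [set x | P (x + h' *: row j W)] = P.
    by apply/seteqP; split=> x /=; rewrite plane_translate.
  rewrite [in RHS](Rintegral_translate (h' *: row j W) plane_measurable mf) PE.
  have mfi := int _ _ (bump_family_shift j h' b).
  rewrite -mulN1r -RintegralZl; [|exact: plane_measurable|].
    by apply: eq_Rintegral => x _; rewrite coord_prod_translate wh; ring.
  have -> : (fun x => coord_prod beta (x + h' *: row j W) * wave xi phi (x + h' *: row j W)) =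
     (fun x => -1 * (coord_prod (shift_at j h' beta) x * wave xi phi x)).
    by apply/funext => x; rewrite coord_prod_translate wh; ring.
  exact: integrable_scaler plane_measurable mfi.
have hx : h * dot xi (row j W) = pi by rewrite divfK.
have s1 : \int[mu]_(x in P) (coord_prod (shift_at j h beta) x * wave xi phi x) =
    - \int[mu]_(x in P) (coord_prod beta x * wave xi phi x).
  by apply: shift => x; rewrite /wave dotDr dotZr hx addrAC cosDpi.
have s2 : \int[mu]_(x in P) (coord_prod (shift_at j (- h) beta) x * wave xi phi x) =
    - \int[mu]_(x in P) (coord_prod beta x * wave xi phi x).
  apply: shift => x; rewrite /wave dotDr dotZr mulNr hx addrAC cosB cospi sinpi.
  by rewrite mulrN1 mulr0 addr0.
have -> : (fun x => coord_prod (second_diff_at j h beta) x * wave xi phi x) =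
    (fun x => 2^-1 * (coord_prod beta x * wave xi phi x) +
       (- 4^-1 * (coord_prod (shift_at j h beta) x * wave xi phi x) +
        - 4^-1 * (coord_prod (shift_at j (- h) beta) x * wave xi phi x))).
  by apply/funext => x; rewrite coord_prod_second_diff; lra.
have i0 := int _ _ b.
have i1 := int _ _ (bump_family_shift j h b).
have i2 := int _ _ (bump_family_shift j (- h) b).
have mP := plane_measurable.
rewrite RintegralD; [|exact: mP|exact: integrable_scaler|].
  rewrite RintegralD; [|exact: mP|exact: integrable_scaler|exact: integrable_scaler].
  by rewrite !RintegralZl// s1 s2; lra.
by apply: integrable_addr => //; exact: integrable_scaler.
Qed.
End Oscillation.

(** * A bump with quadratic frequency decay *)

Section Bump.
Context {R : realType}.
Implicit Types (s t h r xi : R).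

(** Of class C^1 with Lipschitz derivative, which is just enough for second differences of order h^2
    and hence for decay of order 1 / xi^2. It is at least 1 on [-1, 1] and vanishes for s^2 >= 2. *)
Definition plateau s : R := Num.max 0 (2 - s ^+ 2) ^+ 2.

Lemma plateau_ge0 s : 0 <= plateau s. Proof. exact: sqr_ge0. Qed.

Lemma plateau_le4 s : plateau s <= 4.
Proof.
rewrite /plateau; have [h|h] := leP 0 (2 - s ^+ 2); last by rewrite expr0n.
have := sqr_ge0 s; nra.
Qed.

Lemma plateau_ge1 s : `|s| <= 1 -> 1 <= plateau s.
Proof.
move=> s1; have s2 : s ^+ 2 <= 1 by rewrite -real_normK ?num_real// expr_le1.
rewrite /plateau max_r; last by lra.
by rewrite -[leLHS](expr1n _ 2) lerXn2r ?nnegrE//; lra.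
Qed.

Lemma plateau_eq0 s : 2 <= `|s| -> plateau s = 0.
Proof.
move=> s2; have s4 : 4 <= s ^+ 2.
  by rewrite -real_normK ?num_real//; move: `|s| s2 => a; nra.
by rewrite /plateau max_l ?expr0n//; lra.
Qed.

Lemma continuous_plateau : continuous plateau.
Proof.
have c1 : continuous (fun s : R => 2 - s ^+ 2).
  apply: (continuous_sub (f := cst 2)) => s; first exact: cst_continuous.
  exact: exprn_continuous.
have c2 : continuous (fun s : R => Num.max 0 (2 - s ^+ 2)).
  by move=> s; apply: (@continuous_max R _ (cst 0) (fun s => 2 - s ^+ 2)); [exact: cst_continuous|exact: c1].
move=> s; apply: (@continuous_comp _ _ _ (fun s => Num.max 0 (2 - s ^+ 2)) (fun s => s ^+ 2)); first exact: c2.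
exact: exprn_continuous.
Qed.

(** First-order Taylor estimate: the square of the positive part has derivative 2 max (0, x), which
    is 2-Lipschitz. *)
Lemma sqr_max_taylor (a b : R) :
  `|Num.max 0 a ^+ 2 - Num.max 0 b ^+ 2 - 2 * Num.max 0 b * (a - b)| <= (a - b) ^+ 2.
Proof.
have [a0|a0] := leP 0 a; have [b0|b0] := leP 0 b.
- have -> : a ^+ 2 - b ^+ 2 - 2 * b * (a - b) = (a - b) ^+ 2 by ring.
  by rewrite ger0_norm ?sqr_ge0.
- rewrite expr0n mulr0 mul0r !subr0 ger0_norm ?sqr_ge0//.
  by rewrite lerXn2r ?nnegrE//; lra.
- have -> : 0 ^+ 2 - b ^+ 2 - 2 * b * (a - b) = b ^+ 2 + 2 * (b * - a) by ring.
  have ab : 0 <= b * - a by rewrite mulr_ge0// oppr_ge0 ltW.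
  rewrite ger0_norm; last by rewrite addr_ge0 ?sqr_ge0// mulr_ge0.
  have -> : (a - b) ^+ 2 = a ^+ 2 + b ^+ 2 + 2 * (b * - a) by ring.
  by have := sqr_ge0 a; lra.
- by rewrite expr0n mulr0 mul0r !subr0 normr0 sqr_ge0.
Qed.

Lemma plateau_second_diff s h : `|h| <= 1 ->
  `|2 * plateau s - plateau (s + h) - plateau (s - h)| <= 82 * h ^+ 2.
Proof.
move=> h1; have hh : h ^+ 2 <= 1 by rewrite -real_normK ?num_real// expr_le1.
have h0 := sqr_ge0 h.
(* For |s| > 3 all three values vanish. Otherwise the increments of 2 - s^2 are -2sh - h^2 and 2sh -
   h^2: their squares add up to 8 s^2 h^2 + 2 h^4 <= 74 h^2, and in the linear terms the parts in sh
   cancel, leaving at most 8 h^2. This gives 82. *)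
have [s3|s3] := leP `|s| 3; last first.
  have := ler_normB (s + h) h; rewrite addrK => sa.
  have := ler_normD (s - h) h; rewrite subrK => sb.
  by rewrite !plateau_eq0; [rewrite mulr0 !subr0 normr0; lra|lra..].
have s9 : s ^+ 2 <= 9.
  by rewrite -real_normK ?num_real//; move: `|s| s3 (normr_ge0 s) => a; nra.
have := sqr_max_taylor (2 - (s + h) ^+ 2) (2 - s ^+ 2).
have := sqr_max_taylor (2 - (s - h) ^+ 2) (2 - s ^+ 2).
have [m0 m2] : 0 <= Num.max 0 (2 - s ^+ 2) /\ Num.max 0 (2 - s ^+ 2) <= 2.
  by have := sqr_ge0 s; case: (leP 0 (2 - s ^+ 2)) => h2 s0; split; lra.
rewrite /plateau; move: (Num.max 0 (2 - s ^+ 2)) m0 m2 => m m0 m2.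
move: (Num.max 0 _ ^+ 2) => B; move: (Num.max 0 _ ^+ 2) => A.
have -> : 2 - (s - h) ^+ 2 - (2 - s ^+ 2) = 2 * s * h - h ^+ 2 by ring.
have -> : 2 - (s + h) ^+ 2 - (2 - s ^+ 2) = - (2 * s * h) - h ^+ 2 by ring.
have -> : (2 * s * h - h ^+ 2) ^+ 2 = 4 * (s ^+ 2 * h ^+ 2) - 4 * (s * h) * h ^+ 2 + h ^+ 2 * h ^+ 2 by ring.
have -> : (- (2 * s * h) - h ^+ 2) ^+ 2 = 4 * (s ^+ 2 * h ^+ 2) + 4 * (s * h) * h ^+ 2 + h ^+ 2 * h ^+ 2 by ring.
have e1 : s ^+ 2 * h ^+ 2 <= 9 * h ^+ 2 by rewrite ler_wpM2r.
have e2 : h ^+ 2 * h ^+ 2 <= h ^+ 2 by rewrite ler_piMr.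
have e3 : m * h ^+ 2 <= 2 * h ^+ 2 by rewrite ler_wpM2r.
have e4 : 0 <= m * h ^+ 2 by rewrite mulr_ge0.
move: e1 e2 e3 e4; rewrite !mulrBr !ler_norml.
move: (s ^+ 2 * h ^+ 2) (h ^+ 2 * h ^+ 2) => X Y.
have -> : 2 * m * (2 * s * h) = 4 * (m * (s * h)) by ring.
have -> : 2 * m * - (2 * s * h) = - (4 * (m * (s * h))) by ring.
have -> : 2 * m * h ^+ 2 = 2 * (m * h ^+ 2) by ring.
move: (m * h ^+ 2) (m * (s * h)) (4 * (s * h) * h ^+ 2) (h ^+ 2) => Z U V H.
move=> e1 e2 e3 e4; lra.
Qed.

(** For |xi| r < pi, which includes xi = 0, the half wavelength exceeds the bump's scale:
    differencing would gain nothing and would spread the support beyond any fixed multiple of r. *)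
Definition damped_plateau r xi : R -> R :=
  if `|xi| * r < pi then (fun t => plateau (t / r)) else second_diff (pi / xi) (fun t => plateau (t / r)).

(** 21 bounds both 82 / 4, from the second difference and its divisor, and the maximum 4 of the
    plateau, which is what counts at low frequency. *)
Definition damping r : R := 21 * (1 + (pi / r) ^+ 2).

Lemma damping_gt0 r : 0 < damping r.
Proof. by rewrite mulr_gt0// ltr_pwDl// sqr_ge0. Qed.

Lemma continuous_plateau_scale r : continuous (fun t => plateau (t / r)).
Proof.
move=> t; apply: (@continuous_comp _ _ _ (fun t => t / r) plateau); last exact: continuous_plateau.
by apply: (continuous_mul (f := id) (g := cst r^-1)) => s; [exact: cvg_id|exact: cst_continuous].
Qed.

Lemma continuous_damped_plateau r xi : continuous (damped_plateau r xi).
Proof.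
have cb := @continuous_plateau_scale r.
rewrite /damped_plateau; case: ifP => _ //; rewrite /second_diff.
have cs h : continuous (fun t : R => plateau ((t + h) / r)).
  move=> t; apply: (@continuous_comp _ _ _ (fun t => t + h) (fun t => plateau (t / r))); last exact: cb.
  by apply: (continuous_add (f := id) (g := cst h)) => s; [exact: cvg_id|exact: cst_continuous].
apply: (continuous_mul (g := cst 4^-1)); last by move=> t; exact: cst_continuous.
apply: continuous_sub; last exact: cs.
by apply: continuous_sub; [exact: continuous_scale|exact: cs].
Qed.

Lemma second_diff_plateau h r t : second_diff h (fun t => plateau (t / r)) t =
  (2 * plateau (t / r) - plateau (t / r + h / r) - plateau (t / r - h / r)) / 4.
Proof. by rewrite /second_diff (mulrDl t h) (mulrDl t (- h)) mulNr. Qed.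

Lemma damped_plateau_le r xi t : 0 < r -> `|damped_plateau r xi t| <= damping r / (1 + xi ^+ 2).
Proof.
move=> r0; have pi0 := pi_gt0 R; have xi1 : 0 < 1 + xi ^+ 2 by rewrite ltr_pwDl// sqr_ge0.
rewrite ler_pdivlMr// /damped_plateau /damping.
have x0 : 0 <= `|xi| by [].
case: ltP => xr.
  rewrite ger0_norm ?plateau_ge0//.
  have : xi ^+ 2 <= (pi / r) ^+ 2.
    by rewrite -real_normK ?num_real// lerXn2r ?nnegrE ?divr_ge0 ?(ltW r0) ?(ltW pi0)// ler_pdivlMr// ltW.
  have := plateau_le4 (t / r); have := plateau_ge0 (t / r); have := sqr_ge0 xi.
  move: (plateau _) ((pi / r) ^+ 2) (xi ^+ 2) => B p X; nra.
have xi0 : 0 < `|xi| by rewrite -(pmulr_lgt0 _ r0) (lt_le_trans pi0).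
have xin0 : xi != 0 by rewrite -normr_gt0.
set h := pi / xi / r.
have h1 : `|h| <= 1.
  rewrite /h !normrM normfV (gtr0_norm pi0) normfV (gtr0_norm r0).
  by rewrite -mulrA -invfM ler_pdivrMr ?mulr_gt0// mul1r.
rewrite second_diff_plateau -/h normrM (@gtr0_norm _ 4^-1) ?invr_gt0//.
have hE : h ^+ 2 * xi ^+ 2 = (pi / r) ^+ 2 by rewrite /h; field; rewrite xin0 gt_eqF.
have hh : h ^+ 2 <= 1 by rewrite -real_normK ?num_real// expr_le1.
have := plateau_second_diff (t / r) h1.
move: `|_| => D; rewrite -hE; have := sqr_ge0 h; have := sqr_ge0 xi.
move: (h ^+ 2) (xi ^+ 2) hh => H X hh X0 H0 DH.
have : D * (1 + X) <= 82 * H * (1 + X) by rewrite ler_wpM2r//; lra.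
nra.
Qed.

Lemma damped_plateau_supp r xi t : 0 < r -> 3 * r < `|t| -> damped_plateau r xi t = 0.
Proof.
move=> r0 t3; have tr : 3 < `|t / r| by rewrite normrM normfV (gtr0_norm r0) ltr_pdivlMr.
rewrite /damped_plateau; case: ltP => xr; first by rewrite plateau_eq0//; lra.
have pi0 := pi_gt0 R.
have xi0 : 0 < `|xi| by rewrite -(pmulr_lgt0 _ r0) (lt_le_trans pi0).
have h1 : `|pi / xi / r| <= 1.
  rewrite !normrM normfV (gtr0_norm pi0) normfV (gtr0_norm r0).
  by rewrite -mulrA -invfM ler_pdivrMr ?mulr_gt0// mul1r.
rewrite second_diff_plateau; move: (t / r) (pi / xi / r) tr h1 => s h tr h1.
have := ler_normB (s + h) h; rewrite addrK => sa.
have := ler_normD (s - h) h; rewrite subrK => sb.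
by rewrite !plateau_eq0; [rewrite mulr0 !subr0 mul0r|lra..].
Qed.

End Bump.

Section OscillationBound.
Context {R : realType} {k d : nat} (p q : 'rV[R]_d) (W : 'M[R]_(k, d)).
Context (oW : orthonormal_rows W).
Local Notation mu := (@hausdorff_measure R d k).
Implicit Types (r : R) (xi : 'rV[R]_d).

Lemma oscillation_bound r xi phi : 0 < r ->
  `|\int[mu]_(x in plane p W) (coord_prod q W (fun _ t => plateau (t / r)) x * wave xi phi x)| <=
  (\prod_(j < k) (damping r / (1 + dot xi (row j W) ^+ 2))) *
    fine (hausdorff k (cube k (2 * (3 * r)) : set 'rV[R]_k)).
Proof.
move=> r0.
pose z j := dot xi (row j W).
(* [s] lists the axes already damped; they are treated one at a time, and the integral never
   changes. *)
pose fam (s : seq 'I_k) i : R -> R := if i \in s then damped_plateau r (z i) else (fun t => plateau (t / r)).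
(* A crude common bound for damped and undamped bumps, good enough for integrability. The sharp
   bounds enter only once all axes are damped. The support 3 r allows a shift by r of a bump
   supported in [-2r, 2r]. *)
have plateauf s : bump_family (fun=> 4 + \sum_(i < k) damping r / (1 + z i ^+ 2)) (3 * r) (fam s).
  move=> j; have pos i : 0 <= damping r / (1 + z i ^+ 2).
    by rewrite divr_ge0 ?(ltW (damping_gt0 r))// addr_ge0// sqr_ge0.
  rewrite /fam; case: ifP => _; split.
  - exact: continuous_damped_plateau.
  - move=> t; apply: le_trans (damped_plateau_le _ _ r0) _.
    rewrite (bigD1 j)//= addrCA lerDl addr_ge0// sumr_ge0//.
  - by move=> t; exact: damped_plateau_supp.
  - exact: continuous_plateau_scale.
  - by move=> t; rewrite ger0_norm ?plateau_ge0// (le_trans (plateau_le4 _))// lerDl sumr_ge0.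
  - move=> t tr; rewrite plateau_eq0// normrM normfV (gtr0_norm r0) ler_pdivlMr//; lra.
have step s : uniq s ->
    \int[mu]_(x in plane p W) (coord_prod q W (fam s) x * wave xi phi x) =
    \int[mu]_(x in plane p W) (coord_prod q W (fam [::]) x * wave xi phi x).
  elim: s => // j s IH /= /andP[js us]; rewrite -(IH us).
  have [small|big] := ltP (`|z j| * r) pi.
    congr (\int[mu]_(x in _) _); apply/funext => x; congr (_ * _); apply: eq_bigr => i _.
    rewrite /fam in_cons; case: eqP => [->|//]; rewrite (negbTE js) /=.
    by rewrite /damped_plateau small.
  have zj0 : z j != 0.
    rewrite -normr_gt0 -(pmulr_lgt0 _ r0); exact: lt_le_trans (pi_gt0 R) big.
  rewrite -(coord_prod_int_second_diff p q oW phi (plateauf s) zj0).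
  congr (\int[mu]_(x in _) _); apply/funext => x; congr (_ * _); apply: eq_bigr => i _.
  rewrite /fam in_cons /second_diff_at; case: eqP => [->|//]; rewrite (negbTE js) /=.
  by rewrite /damped_plateau ltNge big.
have -> : coord_prod q W (fun _ t => plateau (t / r)) = coord_prod q W (fam [::]) by [].
rewrite -(step _ (enum_uniq 'I_k)).
apply: (@coord_prod_int_le _ _ _ p q W oW (fun j => damping r / (1 + z j ^+ 2)) (3 * r)) => [j||x].
- rewrite /fam mem_enum inE; split=> [|t|t].
  + exact: continuous_damped_plateau.
  + exact: damped_plateau_le.
  + exact: damped_plateau_supp.
- exact: continuous_wave.
- by rewrite ler_norml cos_le1 cos_geN1.
Qed.

End OscillationBound.

(** * Schur's test for sums of waves on a plane *)

Lemma ge0_integral_le_Rintegral {disp} {T : measurableType disp} {R : realType}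
    (mu : {measure set T -> \bar R}) (S D : set T) (f g : T -> R) :
  measurable S -> measurable D -> S `<=` D -> measurable_fun S f ->
  mu.-integrable D (EFin \o g) -> (forall x, S x -> 0 <= f x <= g x) -> (forall x, D x -> 0 <= g x) ->
  (\int[mu]_(x in S) (f x)%:E <= (\int[mu]_(x in D) g x)%:E)%E.
Proof.
move=> mS mD SD mf ig fg g0; have /integrableP[mg _] := ig.
rewrite [leRHS]fineK; last exact: integrable_fin_num.
apply: (@le_trans _ _ (\int[mu]_(x in S) (g x)%:E)%E).
  apply: ge0_le_integral => //.
  - by move=> x Sx; rewrite lee_fin; have /andP[] := fg x Sx.
  - exact/measurable_EFinP.
  - exact: measurable_funS mg.
  - by move=> x Sx; rewrite lee_fin; have /andP[] := fg x Sx.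
by apply: ge0_subset_integral => // x Dx; rewrite lee_fin g0.
Qed.

Section Schur.
Context {R : realType} {k d : nat} (p q : 'rV[R]_d) (W : 'M[R]_(k, d)).
Context (oW : orthonormal_rows W).
Local Notation mu := (@hausdorff_measure R d k).
Implicit Types (r : R) (Lam : seq 'rV[R]_d) (a b : 'rV[R]_d -> R).

Definition decay r (xi : 'rV[R]_d) : R :=
  \prod_(j < k) (damping r / (1 + dot xi (row j W) ^+ 2)).

Lemma decayN r xi : decay r (- xi) = decay r xi.
Proof. by apply: eq_bigr => j _; rewrite dotNl sqrrN. Qed.

(* The mode a cos + b sin is completed by its conjugate a sin - b cos, so that
   only frequency differences m - n occur in the expansion of the square. *)
Lemma plane_quadratic_bound r Lam a b (B : R) (S : set 'rV[R]_d) : 0 < r ->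
  measurable (S : set (caratheodory_type (@hausdorff_outer R d k))) -> S `<=` plane p W ->
  (forall x j, S x -> `|dot (row j W) (x - q)| <= r) ->
  (forall m, m \in Lam -> \sum_(n <- Lam) decay r (m - n) <= B) ->
  (\int[mu]_(x in S) ((\sum_(n <- Lam) (a n * wave n 0 x + b n * wave n (- (pi / 2)) x)) ^+ 2)%:E <=
   (2 * fine (hausdorff k (cube k (2 * (3 * r)) : set 'rV[R]_k)) * B *
    \sum_(n <- Lam) (a n ^+ 2 + b n ^+ 2))%:E)%E.
Proof.
move=> r0 mS SP Sr rowB.
pose eta (x : 'rV[R]_d) : R := coord_prod q W (fun (_ : 'I_k) (t : R) => plateau (t / r)) x.
pose U (x : 'rV[R]_d) : R := \sum_(n <- Lam) (a n * wave n 0 x + b n * wave n (- (pi / 2)) x).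
(* U + i U' is the sum of (a n - i b n) exp (i n.x); [al] and [be] come from the real and imaginary
   parts of the products of its coefficients with conjugates. *)
pose U' (x : 'rV[R]_d) : R := \sum_(n <- Lam) (a n * wave n (- (pi / 2)) x - b n * wave n 0 x).
pose al (m n : 'rV[R]_d) : R := a m * a n + b m * b n.
pose be (m n : 'rV[R]_d) : R := b m * a n - a m * b n.
pose F (m n x : 'rV[R]_d) : R := al m n * (eta x * wave (m - n) 0 x) + be m n * (eta x * wave (m - n) (- (pi / 2)) x).
have EF x : eta x * (U x ^+ 2 + U' x ^+ 2) = \sum_(m <- Lam) \sum_(n <- Lam) F m n x.
  have -> : U x ^+ 2 + U' x ^+ 2 = \sum_(m <- Lam) \sum_(n <- Lam)
     (al m n * wave (m - n) 0 x + be m n * wave (m - n) (- (pi / 2)) x).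
    rewrite !expr2 /U /U' !mulr_suml -big_split/=; apply: eq_bigr => m _.
    rewrite !mulr_sumr -big_split/=; apply: eq_bigr => n _.
    rewrite /wave dotBl !addr0 !cosBpihalf; move: (dot m x) (dot n x) => A A'.
    by rewrite cosB sinB /al /be; ring.
  rewrite mulr_sumr; apply: eq_bigr => m _; rewrite mulr_sumr; apply: eq_bigr => n _.
  by rewrite /F; ring.
have eb : bump_family (fun _ : 'I_k => 4) (3 * r) (fun (_ : 'I_k) (t : R) => plateau (t / r)).
  move=> j; split => [|t|t tr]; first exact: continuous_plateau_scale.
    by rewrite ger0_norm ?plateau_ge0// plateau_le4.
  by rewrite plateau_eq0// normrM normfV (gtr0_norm r0) ler_pdivlMr//; lra.
have iw n phi : mu.-integrable (plane p W) (EFin \o (fun x => eta x * wave n phi x)).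
  apply: (@coord_prod_integrable _ _ _ p q W oW _ _ _ (wave n phi) eb).
    exact: continuous_wave.
  by move=> x; rewrite ler_norml cos_le1 cos_geN1.
have mP := plane_measurable p oW.
have iF m n : mu.-integrable (plane p W) (EFin \o F m n).
  by apply: (integrable_addr mP); exact: (integrable_scaler _ mP).
have iS m := Rintegral_sum Lam mP (iF m).
have [iSS intSS] := Rintegral_sum Lam mP (fun m => (iS m).1).
have eta0 x : 0 <= eta x by apply: prodr_ge0 => j _; exact: plateau_ge0.
have cU : continuous (fun x => U x ^+ 2).
  have c1 : continuous U.
    apply: continuous_sum => n _.
    by apply: continuous_add; apply: continuous_scale; exact: continuous_wave.
  by apply: (continuous_mul c1).
apply: (@le_trans _ _ (\int[mu]_(x in plane p W) (\sum_(m <- Lam) \sum_(n <- Lam) F m n x))%:E).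
  apply: (ge0_integral_le_Rintegral mS mP SP _ iSS).
  - exact: continuous_measurable_hausdorff.
  - move=> x Sx; rewrite sqr_ge0 -EF /=.
    have e1 : 1 <= eta x.
      have <- : \prod_(j < k) (1 : R) = 1 by rewrite big1.
      apply: ler_prod => j _; rewrite ler01 plateau_ge1// normrM normfV (gtr0_norm r0).
      by rewrite ler_pdivrMr// mul1r Sr.
    have := sqr_ge0 (U x); have := sqr_ge0 (U' x); rewrite -/(U x); nra.
  - by move=> x Px; rewrite -EF mulr_ge0// addr_ge0// sqr_ge0.
rewrite lee_fin intSS; set K := fine _.
pose c (n : 'rV[R]_d) : R := a n ^+ 2 + b n ^+ 2.
have K0 : 0 <= K by rewrite fine_ge0// hausdorff_ge0.
(* Schur's test: |al| and |be| are at most (c m + c n) / 2. As [decay] is even, the sums of the c m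
   and of the c n parts agree, and each is at most B times the sum of c; hence the factor 2. *)
apply: (@le_trans _ _ (\sum_(m <- Lam) \sum_(n <- Lam) K * ((c m + c n) * decay r (m - n)))).
  apply: ler_sum => m _; rewrite (iS m).2; apply: ler_sum => n _.
  rewrite RintegralD; [|exact: mP|exact: (integrable_scaler _ mP)|exact: (integrable_scaler _ mP)].
  rewrite !RintegralZl//.
  have b1 := oscillation_bound p q oW (m - n) 0 r0.
  have b2 := oscillation_bound p q oW (m - n) (- (pi / 2)) r0.
  move: b1 b2; rewrite -/(decay r (m - n)) -/K -/(eta _).
  move: (\int[mu]_(x in plane p W) (eta x * wave (m - n) 0 x)) => I1.
  move: (\int[mu]_(x in plane p W) (eta x * wave (m - n) (- (pi / 2)) x)) => I2 b1 b2.
  have al1 : `|al m n| <= (c m + c n) / 2.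
    by rewrite /al /c ler_norml; have := sqr_ge0 (a m - a n); have := sqr_ge0 (b m - b n);
       have := sqr_ge0 (a m + a n); have := sqr_ge0 (b m + b n); nra.
  have be1 : `|be m n| <= (c m + c n) / 2.
    by rewrite /be /c ler_norml; have := sqr_ge0 (a m - b n); have := sqr_ge0 (b m - a n);
       have := sqr_ge0 (a m + b n); have := sqr_ge0 (b m + a n); nra.
  have h1 : al m n * I1 <= (c m + c n) / 2 * (decay r (m - n) * K).
    by rewrite (le_trans (ler_norm _))// normrM ler_pM.
  have h2 : be m n * I2 <= (c m + c n) / 2 * (decay r (m - n) * K).
    by rewrite (le_trans (ler_norm _))// normrM ler_pM.
  by lra.
have c0 n : 0 <= c n by rewrite addr_ge0// sqr_ge0.
have half : \sum_(m <- Lam) \sum_(n <- Lam) c m * decay r (m - n) <= B * \sum_(n <- Lam) c n.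
  rewrite mulr_sumr big_seq [leRHS]big_seq; apply: ler_sum => m mL.
  by rewrite -mulr_sumr mulrC ler_wpM2r// rowB.
have -> : \sum_(m <- Lam) \sum_(n <- Lam) K * ((c m + c n) * decay r (m - n)) =
    K * (\sum_(m <- Lam) \sum_(n <- Lam) c m * decay r (m - n) +
         \sum_(m <- Lam) \sum_(n <- Lam) c n * decay r (m - n)).
  rewrite -big_split/= mulr_sumr; apply: eq_bigr => m _.
  rewrite -big_split/= mulr_sumr; apply: eq_bigr => n _; ring.
rewrite [X in _ + X]exchange_big/=.
have -> : \sum_(j <- Lam) \sum_(i <- Lam) c j * decay r (i - j) =
    \sum_(m <- Lam) \sum_(n <- Lam) c m * decay r (m - n).
  by apply: eq_bigr => m _; apply: eq_bigr => n _; rewrite -decayN opprB.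
have := ler_wpM2l K0 half; rewrite -/(c _); lra.
Qed.

End Schur.

(** * Bands and lattice points on the sphere *)

(** Induction on rows: the remaining rows are made orthonormal and their component is removed from
    the first. [A] and [B] certify that the row spans agree in both directions. *)
Lemma gram_schmidt {R : realType} {k d : nat} (V : 'M[R]_(k, d)) : row_free V ->
  exists W : 'M[R]_(k, d), orthonormal_rows W /\
    exists A B : 'M[R]_k, W = A *m V /\ V = B *m W.
Proof.
elim: k V => [|k IH] V fV.
  exists 0; split; first by apply/matrixP => -[].
  by exists 0, 0; split; apply/matrixP => -[].
move: V fV; rewrite -[k.+1]/(1 + k)%N => V; rewrite -[V]vsubmxK.
set v := usubmx V; set V' := dsubmx V => fV.
have kerV (s : 'rV[R]_1) (t : 'rV[R]_k) : s *m v + t *m V' = 0 -> s = 0 /\ t = 0.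
  rewrite -mul_row_col -(mul0mx _ (col_mx v V')) => /(row_free_inj fV) /eqP.
  by rewrite -[0 in X in _ == X -> _]row_mx0 => /eqP /eq_row_mx.
have [|W' [oW [A [B [WA VB]]]]] := IH V'.
  apply: inj_row_free => t t0; have [] // := kerV 0 t.
  by rewrite mul0mx add0r.
pose w := v - v *m W'^T *m W'.
have wW' : w *m W'^T = 0 by rewrite mulmxBl -(mulmxA (v *m W'^T)) oW mulmx1 subrr.
have w0 : w != 0.
  (* If w vanished, the rows of [V] would satisfy a relation with coefficient 1 on the first row. *)
  apply/eqP => wz; have [] := kerV 1%:M (- (v *m W'^T *m A)).
    by rewrite mul1mx mulNmx -(mulmxA (v *m W'^T)) -WA.
  by move/matrixP => /(_ 0 0); rewrite !mxE /= => /eqP; rewrite oner_eq0.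
have ew : 0 < enorm w by rewrite enorm_gt0.
pose a : 'M[R]_1 := (enorm w)^-1%:M.
pose W := col_mx (a *m w) W'.
have ww : w *m w^T = (enorm w ^+ 2)%:M.
  by apply/matrixP => i j; rewrite (ord1 i) (ord1 j) -dot_mulmx sqr_enorm !mxE eqxx.
have aT : a^T = a by rewrite tr_scalar_mx.
exists W; split.
  rewrite /orthonormal_rows /W tr_col_mx mul_col_row trmx_mul aT.
  have -> : a *m w *m (w^T *m a) = 1%:M.
    rewrite -mulmxA (mulmxA w) ww -!scalar_mxM; congr (_%:M).
    by field; rewrite gt_eqF.
  have -> : a *m w *m W'^T = 0 by rewrite -mulmxA wW' mulmx0.
  have -> : W' *m (w^T *m a) = 0.
    by rewrite mulmxA -[W' *m w^T]trmxK trmx_mul trmxK wW' trmx0 mul0mx.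
  by rewrite oW -scalar_mx_block.
exists (block_mx a (- (a *m (v *m W'^T *m A))) 0 A).
exists (block_mx (enorm w)%:M (v *m W'^T) 0 B); split.
  rewrite mul_block_col mul0mx add0r -WA /W; congr col_mx.
  by rewrite mulNmx -!mulmxA -WA /w !mulmxBr !mulmxA.
rewrite /W mul_block_col mul0mx add0r -VB; congr col_mx.
rewrite mulmxA -scalar_mxM divff ?gt_eqF// mul1mx /w.
by rewrite subrK.
Qed.

Lemma affine_plane_orthonormal {R : realType} {k d : nat} (P : set 'rV[R]_d) : affine_plane k P ->
  exists p (W : 'M[R]_(k, d)), orthonormal_rows W /\ P = plane p W.
Proof.
move=> [p [V [fV ->]]]; have [W [oW [A [B [WA VB]]]]] := gram_schmidt fV.
exists p, W; split=> //; apply/seteqP; split=> _ [t _ <-].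
  by exists (t *m B) => //; rewrite -mulmxA -VB.
by exists (t *m A) => //; rewrite -mulmxA -WA.
Qed.

Lemma plane_affine {R : realType} {k d : nat} p (W : 'M[R]_(k, d)) :
  orthonormal_rows W -> affine_plane k (plane p W).
Proof.
move=> oW; exists p, W; split=> //; apply: inj_row_free => t tW.
by rewrite -[t]mulmx1 -oW mulmxA tW mul0mx.
Qed.

Definition lattice_sphere {R : realType} (d : nat) (lambda : R) : set 'rV[R]_d :=
  integer_points `&` [set x | enorm x = lambda].

Arguments lattice_sphere {R} d lambda _.

Definition sphere_seq {R : realType} (d : nat) (lambda : R) : seq 'rV[R]_d :=
  enum_fset (fset_set (lattice_sphere d lambda)).

Arguments sphere_seq {R} d lambda.

Section Counting.
Context {R : realType} {d : nat}.
Implicit Types (lambda r : R) (n m : 'rV[R]_d).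

Lemma lattice_sphere_finite lambda : finite_set (lattice_sphere d lambda).
Proof.
pose N := (Num.truncn lambda).+1.
pose f (g : {ffun 'I_d -> 'I_(2 * N).+1}) : 'rV[R]_d :=
  of_int (\row_i ((g i : nat)%:Z - N%:Z)).
apply: (@sub_finite_set _ _ [set` codom f]); last exact: finite_seq.
move=> _ [[z _ <-] /= zl].
have zN i : `|z 0 i| < N%:Z.
  rewrite -(ltr_int R) (le_lt_trans _ (truncnS_gt lambda))// -zl.
  by have := ler_coord_enorm (of_int z : 'rV[R]_d) i; rewrite mxE -intr_norm.
have lt i : (absz (z 0 i + N%:Z)%R < (2 * N).+1)%N by have := zN i; lia.
apply/codomP; exists [ffun i => Ordinal (lt i)]; congr of_int; apply/rowP => i.
rewrite !mxE ffunE /=; have := zN i; lia.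
Qed.

Lemma sphere_seq_uniq lambda : uniq (sphere_seq d lambda).
Proof. exact: fset_uniq. Qed.

Lemma mem_sphere_seq lambda n : n \in sphere_seq d lambda <-> lattice_sphere d lambda n.
Proof.
rewrite /sphere_seq; have := in_fset_set (lattice_sphere_finite lambda) n.
move=> h; split=> [ns|/mem_set ns]; first by apply/set_mem; rewrite -h.
by rewrite -h in ns.
Qed.

Section Bands.
Context (k : nat) (c0 lambda : R) (k0 : (0 < k)%N).

Lemma band_set_sub (u x0 : 'I_k -> 'rV[R]_d) :
  integer_points `&` \bigcap_i band c0 lambda (u i) (x0 i) `<=` lattice_sphere d lambda.
Proof. by move=> n [nZ nb]; split=> //=; have [] := nb (Ordinal k0) I. Qed.

Lemma band_set_finite (u x0 : 'I_k -> 'rV[R]_d) :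
  finite_set (integer_points `&` \bigcap_i band c0 lambda (u i) (x0 i)).
Proof. exact: sub_finite_set (@band_set_sub u x0) (lattice_sphere_finite lambda). Qed.

Lemma band_count_has_ubound : has_ubound [set m : R | exists u x0 : 'I_k -> 'rV[R]_d,
    band_configuration u /\ m = (band_count c0 lambda u x0)%:R].
Proof.
exists (size (sphere_seq d lambda))%:R => _ [u [x0 [_ ->]]].
rewrite ler_nat; apply: fsubset_leq_card; rewrite -fset_set_sub.
- exact: band_set_sub.
- exact: band_set_finite.
- exact: lattice_sphere_finite.
Qed.

Lemma band_count_le_max (u x0 : 'I_k -> 'rV[R]_d) : band_configuration u ->
  (band_count c0 lambda u x0)%:R <= band_max d k c0 lambda.
Proof. by move=> bu; apply: (ub_le_sup band_count_has_ubound); exists u, x0. Qed.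

Lemma size_le_band_max (s : seq 'rV[R]_d) (u x0 : 'I_k -> 'rV[R]_d) : uniq s ->
  band_configuration u ->
  (forall n, n \in s -> integer_points n /\ forall i, band c0 lambda (u i) (x0 i) n) ->
  (size s)%:R <= band_max d k c0 lambda.
Proof.
move=> us bu sb; apply: le_trans (band_count_le_max x0 bu); rewrite ler_nat.
apply: uniq_leq_size => // n /sb[nZ nb].
rewrite (in_fset_set (band_set_finite u x0) n).
by apply/mem_set; split=> // i _; exact: nb.
Qed.

(** The Gram determinant is 1, and the threshold is a nonpositive power of a number at least 1. *)
Lemma orthonormal_band_configuration (W : 'M[R]_(k, d)) : orthonormal_rows W ->
  band_configuration (fun i => row i W).
Proof.
move=> oW; split=> [i|k2].
  by rewrite -enorm_gt0 orthonormal_row_enorm.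
rewrite /transverse big1 => [|i _]; last exact: orthonormal_row_enorm.
rewrite divr1 /wedge_norm (_ : \matrix_(i, j) _ = 1%:M); last first.
  by apply/matrixP => i j; rewrite !mxE orthonormal_dot.
rewrite det1 sqrtr1; apply: (@le_trans _ _ ((d - k + 1)%:R `^ 0)); last by rewrite powRr0.
apply: ler_powR.
  by rewrite ler1n addn1.
by rewrite oppr_le0 divr_ge0.
Qed.

End Bands.

Lemma sum_inv_sqr (J : nat) : \sum_(i < J) (i.+1%:R ^+ 2)^-1 <= 2 :> R.
Proof.
case: J => [|J]; first by rewrite big_ord0.
(* The remainder 1 / (J + 1) makes the induction close, by comparison with a telescoping sum. *)
suff : \sum_(i < J.+1) (i.+1%:R ^+ 2)^-1 <= 2 - (J.+1%:R)^-1 :> R.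
  by move/le_trans; apply; rewrite lerBlDr lerDl invr_ge0.
elim: J => [|J IH]; first by rewrite big_ord1 expr1n !invr1; lra.
rewrite big_ord_recr/=; apply: le_trans (lerD IH (lexx _)) _.
have J1 : 0 < J.+1%:R :> R by rewrite ltr0n.
have -> : (J.+2)%:R = J.+1%:R + 1 :> R by rewrite natr1.
move: (J.+1%:R : R) J1 => x x0; have x1 : 0 < x + 1 by lra.
rewrite -subr_ge0.
have -> : 2 - (x + 1)^-1 - (2 - x^-1 + ((x + 1) ^+ 2)^-1) = x^-1 * ((x + 1) ^+ 2)^-1.
  by field; rewrite !gt_eqF.
by rewrite mulr_ge0 ?invr_ge0 ?sqr_ge0// ltW.
Qed.

(** Per axis, 4 is two signs times the bound 2 for the sum of inverse squares. The inner factor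
    trades 1 + xi^2 for (i + 1)^2, where i is the class index: (i + 1)^2 <= 2 + 2 i^2 and 2 i^2 <=
    xi^2 / (2 c0^2). *)
Definition row_constant (k : nat) (c0 r : R) : R :=
  (4 * (damping r * (2 + (2 * c0 ^+ 2)^-1))) ^+ k.

(* Sorting the lattice points by the sign and the integer part of
   dot (m - n) v_j / (2 c0) for every j, each class lies in an intersection of k
   bands with normals v_j. *)
Lemma decay_row_sum k (c0 : R) r lambda (W : 'M[R]_(k, d)) m : (0 < k)%N -> 0 < c0 ->
  orthonormal_rows W ->
  \sum_(n <- sphere_seq d lambda) decay W r (m - n) <=
  row_constant k c0 r * band_max d k c0 lambda.
Proof.
move=> k0 c00 oW; set s := sphere_seq d lambda.
pose xi n j := dot (m - n) (row j W).
pose ix n j := Num.truncn (`|xi n j| / (2 * c0)).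
have c2 : 0 < 2 * c0 by rewrite mulr_gt0.
(* Finitely many classes suffice for this [lambda]; the final bound does not depend on [J]. *)
pose J := (\max_(n <- s) \max_(j < k) ix n j).+1.
pose T := {ffun 'I_k -> bool * 'I_J}.
pose cl n : T := [ffun j => (0 <= xi n j, inord (ix n j))].
have clE n j : n \in s -> (cl n j).2 = ix n j :> nat.
  move=> ns; rewrite ffunE /= inordK// ltnS.
  apply: (@leq_trans (\max_(j < k) ix n j)); first exact: leq_bigmax.
  by apply: (@leq_bigmax_seq _ s xpredT (fun n => \max_(j < k) ix n j)).
pose D := damping r * (2 + (2 * c0 ^+ 2)^-1).
have D0 : 0 <= D.
  by rewrite mulr_ge0 ?(ltW (damping_gt0 r))// addr_ge0// invr_ge0 mulr_ge0// sqr_ge0.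
have term n : n \in s -> decay W r (m - n) <= \prod_(j < k) (D / (cl n j).2.+1%:R ^+ 2).
  move=> ns; apply: ler_prod => j _; rewrite clE// -/(xi n j).
  have x1 : 0 < 1 + xi n j ^+ 2 by rewrite ltr_pwDl// sqr_ge0.
  rewrite divr_ge0 ?(ltW (damping_gt0 r)) ?(ltW x1)//=.
  rewrite ler_pdivrMr// mulrAC ler_pdivlMr ?exprn_gt0// /D -[leRHS]mulrA; apply: ler_wpM2l; first exact: (ltW (damping_gt0 r)).
  have : (ix n j)%:R * (2 * c0) <= `|xi n j|.
    by rewrite -ler_pdivlMr//; have /andP[] := truncn_itv (divr_ge0 (normr_ge0 (xi n j)) (ltW c2)).
  rewrite -[xi n j ^+ 2]real_normK ?num_real// -[(ix n j).+1%:R]natr1; move: (ix n j)%:R (`|_|) (ler0n R (ix n j)) (normr_ge0 (xi n j)) => i x i0 xp ix'.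
  have h2 : (i * (2 * c0)) ^+ 2 <= x ^+ 2.
    by apply: lerXn2r; rewrite ?nnegrE// mulr_ge0// ltW.
  have h3 : i ^+ 2 * (2 * c0 ^+ 2) * 2 <= x ^+ 2 by move: h2; lra.
  have cc : 0 < 2 * c0 ^+ 2 by rewrite mulr_gt0// exprn_gt0.
  have h4 : i ^+ 2 * 2 <= (2 * c0 ^+ 2)^-1 * x ^+ 2 by rewrite ler_pdivlMl//; lra.
  have i5 : 0 <= (2 * c0 ^+ 2)^-1 by rewrite invr_ge0 ltW.
  have := sqr_ge0 (i - 1); have := sqr_ge0 x; move: ((2 * c0 ^+ 2)^-1) h4 i5 => y h4 y0.
  lra.
have count q : (size [seq n <- s | cl n == q])%:R <= band_max d k c0 lambda.
  pose sg (j : 'I_k) : R := if (q j).1 then 1 else -1.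
  (* In a class (m - n).v_j runs over an interval of length 2 c0; its midpoint determines the centre
     of the band. *)
  pose x0 j := (dot m (row j W) - sg j * (2 * c0 * (q j).2%:R + c0)) *: row j W.
  apply: (@size_le_band_max k c0 lambda k0 _ (fun j => row j W) x0).
  - by rewrite filter_uniq// sphere_seq_uniq.
  - exact: orthonormal_band_configuration.
  move=> n; rewrite mem_filter => /andP[/eqP clq ns].
  have /mem_sphere_seq[nZ nl] := ns; split=> // j; split=> //.
  rewrite orthonormal_row_enorm// invr1 scale1r dotBr dotZr orthonormal_dot// eqxx mulr1.
  have q2 : (q j).2 = ix n j :> nat by rewrite -clq clE.
  have q1 : (q j).1 = (0 <= xi n j) by rewrite -clq ffunE.
  have xiE : dot (row j W) n = dot m (row j W) - xi n j.
    by rewrite /xi dotBl (dotC n) opprB addrC subrK.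
  rewrite xiE /sg q1 q2.
  have := truncn_itv (divr_ge0 (normr_ge0 (xi n j)) (ltW c2)).
  rewrite -/(ix n j) ler_pdivlMr// ltr_pdivrMr// -[(ix n j).+1%:R]natr1.
  move: ((ix n j)%:R : R) => i; case: ifP => [x0'|/negbT].
    by rewrite ger0_norm// ler_norml; lra.
  by rewrite -ltNge => x0'; rewrite ltr0_norm// ler_norml; lra.
apply: (@le_trans _ _ (\sum_(n <- s) \prod_(j < k) (D / (cl n j).2.+1%:R ^+ 2))).
  by rewrite big_seq [leRHS]big_seq; exact: ler_sum.
have A0 : 0 <= band_max d k c0 lambda.
  apply: le_trans (band_count_le_max c0 lambda k0 (fun=> 0) (orthonormal_band_configuration oW)).
  exact: ler0n.
rewrite (partition_big cl xpredT)//=.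
apply: (@le_trans _ _ (\sum_(q : T) band_max d k c0 lambda * \prod_(j < k) (D / (q j).2.+1%:R ^+ 2))).
  apply: ler_sum => q _.
  rewrite (eq_bigr (fun=> \prod_(j < k) (D / (q j).2.+1%:R ^+ 2))) => [|n /eqP -> //].
  rewrite big_const_seq iter_addr_0 -mulr_natl -size_filter ler_wpM2r ?count//.
  by apply: prodr_ge0 => j _; rewrite divr_ge0// sqr_ge0.
rewrite -mulr_sumr mulrC ler_wpM2r//.
(* The sum over all classes of a product over the axes factors into k equal one-dimensional sums. *)
rewrite -(bigA_distr_bigA (fun (j : 'I_k) (e : bool * 'I_J) => D / e.2.+1%:R ^+ 2)).
rewrite prodr_const card_ord /row_constant lerXn2r// ?nnegrE.
- by apply: sumr_ge0 => e _; rewrite divr_ge0// sqr_ge0.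
- by rewrite mulr_ge0.
rewrite -(pair_bigA _ (fun (_ : bool) (i : 'I_J) => D / i.+1%:R ^+ 2))/=.
rewrite big_const card_bool /= addr0 -mulr_sumr.
have := ler_wpM2l D0 (sum_inv_sqr J); rewrite -/D; lra.
Qed.

End Counting.

(** * The upper bound *)

Lemma Lnorm2_restrict {disp} {T : measurableType disp} {R : realType}
    (mu : {measure set T -> \bar R}) (A : set T) (f : T -> R) : measurable A ->
  ('N[mu]_2%:E[(fun x => (f x)%:E) \_ A] = sqrte (\int[mu]_(x in A) (f x ^+ 2)%:E))%E.
Proof.
move=> mA; rewrite unlock /Lnorm poweR12_sqrt; last first.
  by apply: integral_ge0 => x _; exact: poweR_ge0.
congr sqrte; rewrite [RHS]integral_mkcond; apply: eq_integral => x _.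
rewrite !patchE; case: ifP => _; last by rewrite abse0 poweR0r.
by rewrite /= powR_mulrn// real_normK ?num_real.
Qed.

Lemma L2_normE {R : realType} {d : nat} (k : nat) (A : set 'rV[R]_d) (e : 'rV[R]_d -> R[i]) :
  measurable (A : set (caratheodory_type (@hausdorff_outer R d k))) ->
  L2_norm k A e = sqrte (\int[@hausdorff_measure R d k]_(x in A)
    (complex.Re (e x) ^+ 2 + complex.Im (e x) ^+ 2)%:E)%E.
Proof.
move=> mA; rewrite /L2_norm Lnorm2_restrict//; congr sqrte; apply: eq_integral => x _.
congr EFin; rewrite /ComplexField.Normc.normc; case: (e x) => u v /=.
by rewrite sqr_sqrtr// addr_ge0// sqr_ge0.
Qed.

Lemma complex_real_scale {R : realType} (a b mu : R) (z : R[i]) :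
  - Complex a b = Complex mu 0 * z -> - a = mu * complex.Re z /\ - b = mu * complex.Im z.
Proof.
by case: z => u v /= [-> ->]; rewrite !mul0r subr0 addr0.
Qed.

Section UpperBound.
Context {R : realType} {d : nat}.
Implicit Types (u : 'rV[R]_d -> R) (lambda : R).

Definition real_eigenfunction (mu : R) u := [/\ C2 u, lattice_periodic u &
  forall x, - laplacian u x = mu * u x].

Lemma eigenfunction_parts (mu : R) (e : 'rV[R]_d -> R[i]) : eigenfunction mu e ->
  real_eigenfunction mu (fun x => complex.Re (e x)) /\
  real_eigenfunction mu (fun x => complex.Im (e x)).
Proof.
move=> [pe c2r c2i ee].
have E x := complex_real_scale (ee x).
split; split=> //; do ?[by move=> n x; rewrite pe]; by move=> x; have [] := E x.
Qed.

Lemma mem_sphere_seq_dot lambda (n : 'rV[R]_d) : 0 < lambda ->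
  n \in sphere_seq d lambda <-> integer_points n /\ dot n n = lambda ^+ 2.
Proof.
move=> l0; rewrite mem_sphere_seq; split=> -[nZ /= nl]; split=> //.
  by rewrite -nl sqr_enorm.
by rewrite /= /enorm nl sqrtr_sqr gtr0_norm.
Qed.

Definition plane_constant (k : nat) (c0 C0 : R) : R :=
  2 * fine (hausdorff k (cube k (2 * (3 * C0)) : set 'rV[R]_k)) * row_constant k c0 C0 / torus_volume R d.

Lemma totally_geodesic_measurable k (C0 : R) (S : set 'rV[R]_d) : totally_geodesic k C0 S ->
  measurable (S : set (caratheodory_type (@hausdorff_outer R d k))).
Proof.
move=> [[P [G [aP oO ->]]] _ _]; have [p [W [oW ->]]] := affine_plane_orthonormal aP.
by apply: measurableI; [exact: plane_measurable|exact: open_measurable_hausdorff].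
Qed.

Lemma real_eigenfunction_bound k (c0 C0 : R) (S : set 'rV[R]_d) lambda u :
  (0 < k)%N -> 0 < c0 -> 0 < C0 -> totally_geodesic k C0 S -> 0 < lambda ->
  real_eigenfunction (lambda ^+ 2) u ->
  (\int[@hausdorff_measure R d k]_(x in S) (u x ^+ 2)%:E <=
   (plane_constant k c0 C0 * band_max d k c0 lambda * torus_int (fun x => u x ^+ 2))%:E)%E.
Proof.
move=> k0 c00 C00 gS l0 [C2u pu eu]; have mS := totally_geodesic_measurable gS.
have [[P [G [aP _ SE]]] _ [q Sq]] := gS; have [p [W [oW PE]]] := affine_plane_orthonormal aP.
have [a [b [uE intE]]] := eigen_expansion C2u pu eu (sphere_seq_uniq lambda)
  (fun n => mem_sphere_seq_dot n l0).
have SP : S `<=` plane p W by rewrite SE PE => x [].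
(* The ball that contains the submanifold supplies the centre q and the scale C0 of the bumps,
   whence the uniformity in [S]. *)
have Sr x j : S x -> `|dot (row j W) (x - q)| <= C0.
  move=> /Sq xq; apply: le_trans (dot_le _ _) _.
  by rewrite orthonormal_row_enorm// mul1r.
have rowB m : m \in sphere_seq d lambda -> \sum_(n <- sphere_seq d lambda) decay W C0 (m - n) <=
    row_constant k c0 C0 * band_max d k c0 lambda by move=> _; exact: decay_row_sum.
have := plane_quadratic_bound (q := q) oW a b C00 mS SP Sr rowB.
under eq_integral do rewrite -uE.
move/le_trans; apply; rewrite lee_fin intE /plane_constant.
have V0 := @torus_volume_gt0 R d; move: (torus_volume R d) V0 => V V0.
rewrite le_eqVlt; apply/orP; left; apply/eqP; field; exact: lt0r_neq0.
Qed.

End UpperBound.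

Lemma EFin_Rintegral {disp} {T : measurableType disp} {R : realType}
    (mu : {measure set T -> \bar R}) (D : set T) (f : T -> R) :
  measurable D -> mu.-integrable D (EFin \o f) ->
  (\int[mu]_(x in D) (f x)%:E = (\int[mu]_(x in D) f x)%R%:E)%E.
Proof. by move=> mD fi; rewrite /Rintegral fineK//; exact: integrable_fin_num. Qed.

Section Restriction.
Context {R : realType} {d : nat}.
Implicit Types (u : 'rV[R]_d -> R) (lambda : R).

Lemma torus_intE (f : 'rV[R]_d -> R) : continuous f ->
  (\int[@hausdorff_measure R d d]_(x in fundamental_domain) (f x)%:E = (torus_int f)%:E)%E.
Proof.
move=> cf.
exact: (EFin_Rintegral fundamental_domain_measurable (torus_integrable cf)).
Qed.

Lemma L2_norm_torusE (e : 'rV[R]_d -> R[i]) :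
  continuous (fun x => complex.Re (e x)) -> continuous (fun x => complex.Im (e x)) ->
  L2_norm_torus e = (Num.sqrt (torus_int (fun x => complex.Re (e x) ^+ 2) +
                               torus_int (fun x => complex.Im (e x) ^+ 2)))%:E.
Proof.
move=> cr ci; rewrite /L2_norm_torus L2_normE; last exact: fundamental_domain_measurable.
have cr2 : continuous (fun x => complex.Re (e x) ^+ 2) by apply: (continuous_mul cr).
have ci2 : continuous (fun x => complex.Im (e x) ^+ 2) by apply: (continuous_mul ci).
by rewrite torus_intE ?torus_intD//; apply: continuous_add.
Qed.

Lemma eigenvalue_ge2 lambda (n : 'rV[R]_d) : 1 < lambda -> n \in sphere_seq d lambda ->
  2 <= lambda ^+ 2.
Proof.
move=> l1; rewrite mem_sphere_seq_dot ?(lt_trans ltr01)// => -[[z _ <-] zl].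
have : 1 < lambda ^+ 2 by rewrite expr_gt1// ltW// (lt_trans ltr01).
rewrite -zl dot_of_int -[1]/(1%:~R) -[2]/(2%:~R) ltr_int ler_int; lia.
Qed.

Lemma orthonormal_rows_exist k : (k <= d)%N -> exists W : 'M[R]_(k, d), orthonormal_rows W.
Proof.
move=> kd; exists (\matrix_(i, j) ((i : nat) == j)%:R).
apply/matrixP => i j; rewrite !mxE (bigD1 (widen_ord kd i))//= !mxE eqxx mul1r.
rewrite big1 ?addr0 => [|l li]; first by rewrite eq_sym.
by rewrite !mxE -[i == l :> nat]/(widen_ord kd i == l) eq_sym (negbTE li) mul0r.
Qed.

Lemma band_max_ge0 k (c0 : R) lambda : (0 < k)%N -> (k <= d)%N -> 0 <= band_max d k c0 lambda.
Proof.
move=> k0 kd; have [W oW] := orthonormal_rows_exist kd.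
apply: le_trans (band_count_le_max c0 lambda k0 (fun=> 0) (orthonormal_band_configuration oW)).
exact: ler0n.
Qed.

Lemma eigenfunction_continuous (mu : R) (e : 'rV[R]_d -> R[i]) : eigenfunction mu e ->
  continuous (fun x => complex.Re (e x)) /\ continuous (fun x => complex.Im (e x)).
Proof. by move=> [_ [[c1 _] _] [[c2 _] _] _]. Qed.

Lemma torus_int_sqr_ge0 u : 0 <= torus_int (fun x => u x ^+ 2).
Proof. by apply: Rintegral_ge0 => x _; exact: sqr_ge0. Qed.

Lemma eigenfunction_sphere_nil lambda u : 0 < lambda -> sphere_seq d lambda = [::] ->
  real_eigenfunction (lambda ^+ 2) u -> forall x, u x = 0.
Proof.
move=> l0 s0 [C2u pu eu] x.
have [a [b [-> _]]] := eigen_expansion C2u pu eu (sphere_seq_uniq lambda)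
  (fun n => mem_sphere_seq_dot n l0).
by rewrite s0 big_nil.
Qed.

Lemma restriction_upper_bound k (c0 C0 : R) : (0 < k)%N -> (k <= d)%N -> 0 < c0 -> 0 < C0 ->
  exists C : R, 0 < C /\
    forall S : set 'rV[R]_d, totally_geodesic k C0 S ->
    forall lambda : R, 1 < lambda ->
    forall e : 'rV[R]_d -> R[i], eigenfunction (lambda ^+ 2) e ->
      (L2_norm k S e <=
       (C * Num.sqrt (band_max d k c0 lambda) * ln lambda `^ (k%:R / 2))%:E *
       L2_norm_torus e)%E.
Proof.
(* [ell] is a lower bound for the log factor, from lambda^2 >= 2; dividing by it absorbs that factor
   into the constant. *)
move=> k0 kd c00 C00; pose ell : R := (ln 2 / 2) `^ (k%:R / 2).
have ln2 : 0 < ln 2 / 2 :> R by rewrite divr_gt0// ln_gt0// ltr1n.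
have ell0 : 0 < ell by rewrite powR_gt0.
(* Positive whatever the sign of the constant inside. *)
pose K := `|@plane_constant R d k c0 C0| + 1.
have K0 : 0 < K by rewrite ltr_wpDl.
exists (Num.sqrt K / ell); split; first by rewrite divr_gt0// sqrtr_gt0.
move=> S gS lambda l1 e ee; have l0 : 0 < lambda := lt_trans ltr01 l1.
have [er ei] := eigenfunction_parts ee; have [cr ci] := eigenfunction_continuous ee.
have mS := totally_geodesic_measurable gS.
have cr2 : continuous (fun x => complex.Re (e x) ^+ 2) by apply: (continuous_mul cr).
have ci2 : continuous (fun x => complex.Im (e x) ^+ 2) by apply: (continuous_mul ci).
set A := band_max d k c0 lambda; have A0 : 0 <= A by exact: band_max_ge0.
rewrite L2_norm_torusE// L2_normE//.
set X := torus_int (fun x => complex.Re (e x) ^+ 2); set Y := torus_int (fun x => complex.Im (e x) ^+ 2).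
have X0 : 0 <= X by exact: torus_int_sqr_ge0.
have Y0 : 0 <= Y by exact: torus_int_sqr_ge0.
have bound u Z : 0 <= Z -> (\int[@hausdorff_measure R d k]_(x in S) (u x ^+ 2)%:E <=
    (@plane_constant R d k c0 C0 * A * Z)%:E)%E ->
    (\int[@hausdorff_measure R d k]_(x in S) (u x ^+ 2)%:E <= (K * A * Z)%:E)%E.
  move=> Z0 /le_trans; apply; rewrite lee_fin; apply: ler_wpM2r => //; apply: ler_wpM2r => //.
  by rewrite (le_trans (ler_norm _))// lerDl.
have bX := bound _ _ X0 (real_eigenfunction_bound k0 c00 C00 gS l0 er).
have bY := bound _ _ Y0 (real_eigenfunction_bound k0 c00 C00 gS l0 ei).
have sumE : (\int[@hausdorff_measure R d k]_(x in S) (complex.Re (e x) ^+ 2 + complex.Im (e x) ^+ 2)%:E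
   <= (K * A * (X + Y))%:E)%E.
  rewrite mulrDr EFinD; apply: le_trans (leeD bX bY); rewrite -ge0_integralD; last 5 first.
  - exact: mS.
  - by move=> x _; rewrite lee_fin sqr_ge0.
  - by apply/measurable_EFinP; exact: continuous_measurable_hausdorff.
  - by move=> x _; rewrite lee_fin sqr_ge0.
  - by apply/measurable_EFinP; exact: continuous_measurable_hausdorff.
  exact: lexx.
apply: (@le_trans _ _ (Num.sqrt (K * A * (X + Y)))%:E).
  by rewrite -[leRHS]/(sqrte (_)%:E) lee_sqrt// lee_fin !mulr_ge0 ?(ltW K0)// addr_ge0.
rewrite -EFinM lee_fin.
(* Without lattice points the eigenfunction vanishes. This case must be split off, since [lambda] >
   1 alone keeps log lambda away from no positive bound. *)
have [s0|] := eqVneq (sphere_seq d lambda) [::].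
  have u0 := eigenfunction_sphere_nil l0 s0 er; have v0 := eigenfunction_sphere_nil l0 s0 ei.
  have -> : X + Y = 0.
    rewrite /X /Y; under eq_torus_int do rewrite u0 expr0n.
    under [X in _ + X]eq_torus_int do rewrite v0 expr0n.
    by rewrite torus_int_cst mul0r addr0.
  by rewrite mulr0 sqrtr0 mulr0.
case sE : (sphere_seq d lambda) => [//|n s] _.
have l2 : 2 <= lambda ^+ 2 by apply: (@eigenvalue_ge2 _ n); rewrite // sE mem_head.
have lnh : ln 2 / 2 <= ln lambda.
  have : ln 2 <= ln (lambda ^+ 2) by rewrite ler_ln ?posrE ?exprn_gt0.
  by rewrite lnXn//; lra.
have h : ell <= ln lambda `^ (k%:R / 2).
  apply: ge0_ler_powR; rewrite ?nnegrE; [by rewrite divr_ge0|exact: ltW|exact: le_trans (ltW ln2) lnh|exact: lnh].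
have KA : 0 <= K * A by rewrite mulr_ge0// ltW.
rewrite (sqrtrM _ KA) (sqrtrM _ (ltW K0)); apply: ler_wpM2r; first exact: sqrtr_ge0.
have -> : Num.sqrt K / ell * Num.sqrt A * ln lambda `^ (k%:R / 2) =
    (Num.sqrt K * Num.sqrt A) * (ln lambda `^ (k%:R / 2) / ell) by ring.
rewrite -[leLHS]mulr1; apply: ler_wpM2l; first by rewrite mulr_ge0 ?sqrtr_ge0.
by rewrite ler_pdivlMr// mul1r.
Qed.
End Restriction.

(** * Sharpness *)

(** By [hausdorff_cube_scale_ge] this makes the cube of side 2 sqrt k have measure at least 1. In
    the induction by two, the factor (k + 2) from the square root cancels the denominator of the
    volume recursion and leaves 2 pi. *)
Lemma unit_ball_volume_sqrt {R : realType} (k : nat) : 1 <= unit_ball_volume R k * Num.sqrt k%:R ^+ k.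
Proof.
have pi2 := pi_ge2 R.
have [m] := ubnP k; elim: m k => // m IH [|[|k]] km; first by rewrite /= expr0 mulr1.
  by rewrite /= expr1 sqrtr1 mulr1 ler1n.
rewrite [unit_ball_volume _ _]/(2 * pi / k.+2%:R * unit_ball_volume R k).
have IHk : 1 <= unit_ball_volume R k * Num.sqrt k%:R ^+ k by apply: IH; exact: ltnW.
have k2 : 0 < k.+2%:R :> R by rewrite ltr0n.
have -> : 2 * pi / k.+2%:R * unit_ball_volume R k * Num.sqrt k.+2%:R ^+ k.+2 =
    2 * pi * (unit_ball_volume R k * Num.sqrt k.+2%:R ^+ k).
  rewrite !exprS [Num.sqrt _ * (_ * _)]mulrA -expr2 sqr_sqrtr ?(ltW k2)//.
  by field; rewrite gt_eqF.
have h : unit_ball_volume R k * Num.sqrt k%:R ^+ k <= unit_ball_volume R k * Num.sqrt k.+2%:R ^+ k.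
  apply: ler_wpM2l; first exact: unit_ball_volume_ge0.
  by apply: lerXn2r; rewrite ?nnegrE ?sqrtr_ge0//; apply: ler_wsqrtr; rewrite ler_nat -addn2 leq_addr.
nra.
Qed.

Lemma hausdorff_cube_scale_ge {R : realType} (k : nat) (L : R) : 0 < L ->
  ((unit_ball_volume R k / 2 ^+ k * L ^+ k)%:E <= hausdorff k (cube k L))%E.
Proof.
move=> L0; apply: (@le_trans _ _ (hausdorff k [set L *: x | x in cube k 1])).
  rewrite hausdorff_scale// mulrC EFinM; apply: lee_wpmul2l; last exact: hausdorff_cube_ge.
  by rewrite lee_fin exprn_ge0// ltW.
apply: le_hausdorff => _ [x x1 <-] i; have /andP[xi0 xi1] := x1 i.
by rewrite mxE mulr_ge0 ?(ltW L0)// ler_piMr// ltW.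
Qed.

(** * Discs in a plane and their measure *)

Section Disc.
Context {R : realType} {k d : nat} (W : 'M[R]_(k, d)).
Context (oW : orthonormal_rows W).

Definition disc (r : R) : set 'rV[R]_d := plane 0 W `&` [set x | enorm x < r].

Lemma disc_open_part (r : R) : open [set x : 'rV[R]_d | enorm x < r].
Proof.
have -> : [set x : 'rV[R]_d | enorm x < r] = enorm @^-1` `]-oo, r[%classic.
  by apply/seteqP; split=> x /=; rewrite in_itv.
by move/continuousP : (@continuous_enorm R d); apply; exact: interval_open.
Qed.

Lemma disc_measurable r : measurable (disc r : set (caratheodory_type (@hausdorff_outer R d k))).
Proof.
apply: measurableI; first exact: plane_measurable.
by apply: open_measurable_hausdorff; exact: disc_open_part.
Qed.

(** With y = x W^T, |y|^2 = (y W).x <= |y W| |x| = |y| |x|. *)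
Lemma enorm_mul_trmx x : enorm (x *m W^T) <= enorm x.
Proof.
have E : enorm (x *m W^T) ^+ 2 = dot (x *m W^T *m W) x.
  rewrite sqr_enorm (dot_mulmxE W) /dot; apply: eq_bigr => j _; by rewrite -(dot_row_mulmx W x j).
have := dot_le (x *m W^T *m W) x; rewrite -E (orthonormal_enorm _ oW) ger0_norm ?sqr_ge0// expr2.
have [->|] := eqVneq (enorm (x *m W^T)) 0; first by move=> _; exact: enorm_ge0.
move=> n0; rewrite ler_pM2l// lt_neqAle eq_sym n0; exact: enorm_ge0.
Qed.

Lemma hausdorff_mulmx (E : set 'rV[R]_k) :
  hausdorff k [set t *m W | t in E] = hausdorff k E.
Proof.
apply: (@hausdorff_isometry _ _ _ _ _ (fun x => x *m W^T)) => [x y|x y|x].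
- by rewrite -mulmxBl orthonormal_enorm.
- by rewrite -mulmxBl enorm_mul_trmx.
- by rewrite -mulmxA oW mulmx1.
Qed.

Lemma hausdorff_disc_scale r : 0 < r -> hausdorff k (disc r) = ((r ^+ k)%:E * hausdorff k (disc 1))%E.
Proof.
move=> r0; rewrite -hausdorff_scale//; congr (hausdorff k _); apply/seteqP; split=> x.
  move=> [[t _ tx] /= xr]; exists (r^-1 *: x); last by rewrite scalerA divff ?scale1r// gt_eqF.
  split; first by exists (r^-1 *: t) => //; rewrite -tx !add0r scalemxAl.
  by rewrite /= enormZ gtr0_norm ?invr_gt0// ltr_pdivrMl// mulr1.
move=> [_ [[t _ <-] /= x1] <-]; split; first by exists (r *: t) => //; rewrite !add0r scalemxAl.
by rewrite /= enormZ gtr0_norm// gtr_pMr.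
Qed.

Lemma hausdorff_disc1_lt : (hausdorff k (disc 1) <= hausdorff k (cube k 2 : set 'rV[R]_k))%E.
Proof.
apply: le_trans (_ : (_ <= hausdorff k (plane 0 W `&` [set x | forall j, `|dot (row j W) (x - 0)| <= 1])%R)%E) _.
  apply: le_hausdorff => x [Px /= x1]; split=> // j; rewrite subr0 (le_trans (dot_le _ _))//.
  by rewrite orthonormal_row_enorm// mul1r ltW.
by have := plane_box_hausdorff 0 0 1 oW; rewrite mulr1.
Qed.

(** The centred cube of side 2 sqrt k has measure at least 1 and lies within distance k < d of its
    centre. So a disc of measure 1 needs radius at most d, which is why C0 >= d leaves room for
    it. *)
Lemma hausdorff_disc_ge1 : (0 < k)%N -> (k < d)%N -> (1 <= hausdorff k (disc d%:R))%E.
Proof.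
move=> k0 kd; set s := Num.sqrt k%:R : R.
have s0 : 0 < s by rewrite sqrtr_gt0 ltr0n.
pose E : set 'rV[R]_k := [set t + const_mx (- s) | t in cube k (2 * s)].
apply: (@le_trans _ _ (hausdorff k E)).
  have s2 : 0 < 2 * s by rewrite mulr_gt0.
  rewrite hausdorff_translate; apply: le_trans _ (hausdorff_cube_scale_ge k s2).
  rewrite lee_fin exprMn [leRHS]mulrA divfK; first exact: unit_ball_volume_sqrt.
  by rewrite expf_neq0// pnatr_eq0.
rewrite -(hausdorff_mulmx E); apply: le_hausdorff => _ [_ [t tc <-] <-]; split.
  by exists (t + const_mx (- s)) => //; rewrite add0r.
rewrite /= orthonormal_enorm//; apply: (@le_lt_trans _ _ (s * s)).
  apply: enorm_le_coord; last exact: ltW.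
  by move=> i; rewrite !mxE; have := tc i; rewrite ler_norml; lra.
by rewrite -expr2 sqr_sqrtr ?ler0n// ltr_nat.
Qed.

End Disc.

(* The radius is chosen by homogeneity so that the disc has measure exactly 1. *)
Lemma unit_measure_disc {R : realType} (k d : nat) : (0 < k)%N -> (k < d)%N ->
  exists2 rho0 : R, 0 < rho0 & forall W : 'M[R]_(k, d), orthonormal_rows W ->
    exists2 r : R, rho0 <= r <= d%:R & hausdorff k (disc W r) = 1%E /\
    forall e : R, 0 < e -> (((e / d%:R) ^+ k)%:E <= hausdorff k (disc W e))%E.
Proof.
move=> k0 kd; pose beta := fine (hausdorff k (cube k 2 : set 'rV[R]_k)).
have beta0 : 0 <= beta by rewrite fine_ge0// hausdorff_ge0.
have betaE : (hausdorff k (cube k 2 : set 'rV[R]_k) = beta%:E)%E.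
  by rewrite fineK// ge0_fin_numE ?hausdorff_ge0// hausdorff_cube_lt.
(* The radius will be h^(-1/k), with h <= [beta] the measure of the unit disc. As (beta + 1)^-1 <=
   1, its k-th power is at most h^-1, so it bounds the radius below for all [W] at once. *)
pose rho0 : R := (beta + 1)^-1.
have b1 : 0 < beta + 1 by rewrite ltr_wpDl.
have rho00 : 0 < rho0 by rewrite invr_gt0.
exists rho0 => // W oW.
have d0 : 0 < d%:R :> R by rewrite ltr0n (leq_trans _ kd).
pose h := fine (hausdorff k (disc W 1)).
have hE : (hausdorff k (disc W 1) = h%:E)%E.
  rewrite fineK// ge0_fin_numE ?hausdorff_ge0//.
  by apply: le_lt_trans (hausdorff_disc1_lt oW) _; rewrite betaE ltry.
have hb : h <= beta by rewrite -lee_fin -hE -betaE hausdorff_disc1_lt.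
have dh : 1 <= d%:R ^+ k * h.
  have := hausdorff_disc_ge1 oW k0 kd; rewrite hausdorff_disc_scale// hE -EFinM lee_fin //.
have dk : 0 < d%:R ^+ k :> R by rewrite exprn_gt0.
have h0 : 0 < h by rewrite -(pmulr_rgt0 _ dk) (lt_le_trans ltr01).
pose r : R := h^-1 `^ (k%:R^-1).
have rk : r ^+ k = h^-1.
  rewrite -powR_mulrn ?powR_ge0// -powRrM mulVf ?pnatr_eq0 -?lt0n// powRr1//.
  by rewrite invr_ge0 ltW.
have r0 : 0 < r by rewrite powR_gt0// invr_gt0.
exists r.
  apply/andP; split.
    rewrite -(ler_pXn2r k0) ?nnegrE ?(ltW rho00) ?(ltW r0)// rk.
    apply: (@le_trans _ _ rho0).
      rewrite -[leRHS]expr1 ler_wiXn2l ?(ltW rho00)// invf_le1//; lra.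
    by rewrite lef_pV2 ?posrE//; lra.
  rewrite -(ler_pXn2r k0) ?nnegrE ?(ltW d0) ?(ltW r0)// rk.
  by rewrite -[leLHS]mul1r ler_pdivrMr.
split; first by rewrite hausdorff_disc_scale// hE -EFinM rk mulVf// gt_eqF.
move=> e e0; rewrite hausdorff_disc_scale// hE -EFinM lee_fin expr_div_n.
rewrite ler_wpM2l ?exprn_ge0 ?(ltW e0)//.
by rewrite -[leLHS]mul1r ler_pdivrMr// mulrC.
Qed.

Lemma disc_totally_geodesic {R : realType} (k d : nat) (C0 r : R) (W : 'M[R]_(k, d)) :
  orthonormal_rows W -> hausdorff k (disc W r) = 1%E -> r <= C0 -> totally_geodesic k C0 (disc W r).
Proof.
move=> oW H1 rC; split=> //.
  exists (plane 0 W), [set x | enorm x < r]; split=> //; first exact: plane_affine.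
  exact: disc_open_part.
by exists 0 => x [_ /= xr]; rewrite subr0 ltW// (lt_le_trans xr).
Qed.

Lemma cos_ge_half {R : realType} (t : R) : `|t| <= 2^-1 -> 2^-1 <= cos t.
Proof.
move=> t2; have p2 := pi_ge2 R; have p4 : 2^-1 <= pi / 4 :> R by lra.
have c0 : 0 <= cos (pi / 4 : R) by apply: cos_ge0_pihalf; lra.
have h : cos (pi / 4 : R) ^+ 2 = 2^-1.
  have := @cos_pihalf R; rewrite (_ : pi / 2 = pi / 4 + pi / 4); last by lra.
  rewrite cosD -!expr2 => h; have := cos2Dsin2 (pi / 4 : R); lra.
apply: (@le_trans _ _ (cos (pi / 4))); first nra.
rewrite -[leRHS]cos_norm; apply: le_cos => //; lra.
Qed.

Lemma complex_scale_real {R : realType} (a b u v mu : R) :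
  - a = mu * u -> - b = mu * v -> - Complex a b = Complex mu 0 * Complex u v.
Proof. by move=> ha hb; apply/eqP; rewrite eq_complex /= ha hb !mul0r subr0 addr0 !eqxx. Qed.

(** * Exponential sums over lattice points *)

Section TrigonometricSums.
Context {R : realType} {d : nat}.
Implicit Types (s : seq 'rV[R]_d) (a : 'rV[R]_d -> R).

(** General coefficients and a common phase make the family stable under partial derivatives. *)
Definition trig_sum a (phi : R) s (x : 'rV[R]_d) : R := \sum_(n <- s) a n * wave n phi x.

Lemma is_derive_trig_sum a phi s x v : is_derive x v (trig_sum a phi s)
  (trig_sum (fun n => a n * dot n v) (phi + pi / 2) s x).
Proof.
elim: s => [|n s IH].
  have -> : trig_sum a phi [::] = cst 0 by apply/funext => y; rewrite /trig_sum big_nil.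
  by rewrite /trig_sum big_nil; exact: is_derive_cst.
have -> : trig_sum a phi (n :: s) = a n *: wave n phi + trig_sum a phi s.
  by apply/funext => y; rewrite /trig_sum big_cons.
rewrite [X in is_derive _ _ _ X](_ : _ = a n *: (dot n v * wave n (phi + pi / 2) x) +
    trig_sum (fun n => a n * dot n v) (phi + pi / 2) s x); last by rewrite /trig_sum big_cons -mulrA.
apply: is_deriveD.
by apply: is_deriveZ; exact: is_derive_wave.
Qed.

Lemma partial_trig_sum a phi s (j : 'I_d) :
  partial j (trig_sum a phi s) = trig_sum (fun n => a n * n 0 j) (phi + pi / 2) s.
Proof.
apply/funext => x; rewrite /partial (@derive_val _ _ _ _ _ _ _ (is_derive_trig_sum a phi s x _)).
by rewrite /trig_sum; apply: eq_bigr => n _; rewrite dot_delta.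
Qed.

Lemma continuous_trig_sum a phi s : continuous (trig_sum a phi s).
Proof.
apply: continuous_sum => n _; apply: continuous_scale; exact: (@continuous_wave R d n phi).
Qed.

Lemma C1_trig_sum a phi s : C1 (trig_sum a phi s).
Proof.
split=> [|j]; first exact: continuous_trig_sum.
split=> [x|]; last by rewrite partial_trig_sum; exact: continuous_trig_sum.
by have [] := is_derive_trig_sum a phi s x 'e_j.
Qed.

Lemma C2_trig_sum a phi s : C2 (trig_sum a phi s).
Proof.
split=> [|j]; first exact: C1_trig_sum.
by rewrite partial_trig_sum; exact: C1_trig_sum.
Qed.

Lemma laplacian_trig_sum a phi s (mu : R) x : (forall n, n \in s -> dot n n = mu) ->
  - laplacian (trig_sum a phi s) x = mu * trig_sum a phi s x.
Proof.
move=> smu; rewrite /laplacian.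
under eq_bigr do rewrite !partial_trig_sum.
rewrite /trig_sum exchange_big mulr_sumr -sumrN big_seq [RHS]big_seq.
apply: eq_bigr => n ns; rewrite -(smu n ns) -sumrN mulr_suml; apply: eq_bigr => j _.
rewrite /wave; have -> : dot n x + (phi + pi / 2 + pi / 2) = dot n x + phi + pi by lra.
by rewrite cosDpi; ring.
Qed.

Lemma trig_sum_periodic a phi s : (forall n, n \in s -> integer_points n) ->
  lattice_periodic (trig_sum a phi s).
Proof.
move=> sZ p x; rewrite /trig_sum big_seq [RHS]big_seq; apply: eq_bigr => n /sZ nZ.
by rewrite (wave_periodic phi nZ).
Qed.

(* exp_sum s x is the sum of exp (i n.x) over n in s. *)
Definition exp_sum s (x : 'rV[R]_d) : R[i] :=
  Complex (trig_sum (fun=> 1) 0 s x) (trig_sum (fun=> 1) (- (pi / 2)) s x).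

Lemma exp_sum_eigenfunction s (lambda : R) :
  (forall n, n \in s -> integer_points n /\ dot n n = lambda ^+ 2) ->
  eigenfunction (lambda ^+ 2) (exp_sum s).
Proof.
move=> hs.
have sZ n : n \in s -> integer_points n by move/hs => [].
have sl n : n \in s -> dot n n = lambda ^+ 2 by move/hs => [].
split; [|exact: C2_trig_sum|exact: C2_trig_sum|].
  by move=> p x; rewrite /exp_sum !(trig_sum_periodic _ _ sZ).
move=> x; have lap a phi := @laplacian_trig_sum a phi s _ x sl.
exact: (complex_scale_real (lap _ _) (lap _ _)).
Qed.

Lemma exp_sum0 s : exp_sum s 0 = Complex (size s)%:R 0.
Proof.
rewrite /exp_sum /trig_sum; congr Complex.
  under eq_bigr do rewrite /wave dotC dot0l addr0 cos0 mul1r.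
  by rewrite big_const_seq count_predT iter_addr_0.
rewrite big1 // => n _.
by rewrite /wave dotC dot0l add0r cosN cos_pihalf mulr0.
Qed.

Lemma exp_sum_sqr s x : complex.Re (exp_sum s x) ^+ 2 + complex.Im (exp_sum s x) ^+ 2 =
  \sum_(m <- s) \sum_(n <- s) wave (m - n) 0 x.
Proof.
rewrite /= /trig_sum !expr2 !mulr_suml -big_split; apply: eq_bigr => m _.
rewrite !mulr_sumr -big_split; apply: eq_bigr => n _ /=.
by rewrite !mul1r /wave !addr0 !cosBpihalf dotBl cosB.
Qed.

Lemma exp_sum_sqr_le s x :
  complex.Re (exp_sum s x) ^+ 2 + complex.Im (exp_sum s x) ^+ 2 <= (size s)%:R ^+ 2.
Proof.
have E : (size s)%:R = \sum_(m <- s) 1 :> R by rewrite big_const_seq count_predT iter_addr_0.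
rewrite exp_sum_sqr expr2 {1}E mulr_suml; apply: ler_sum => m _.
by rewrite mul1r E; apply: ler_sum => n _; exact: cos_le1.
Qed.

Lemma exp_sum_sqr_ge s x : (forall m n, m \in s -> n \in s -> `|dot (m - n) x| <= 2^-1) ->
  (size s)%:R ^+ 2 / 2 <= complex.Re (exp_sum s x) ^+ 2 + complex.Im (exp_sum s x) ^+ 2.
Proof.
move=> sx; have E : (size s)%:R = \sum_(m <- s) 1 :> R by rewrite big_const_seq count_predT iter_addr_0.
rewrite exp_sum_sqr expr2 -mulrA {1}E mulr_suml big_seq [leRHS]big_seq; apply: ler_sum => m ms.
rewrite mul1r E mulr_suml big_seq [leRHS]big_seq; apply: ler_sum => n ns.
rewrite mul1r /wave addr0; exact: cos_ge_half (sx m n ms ns).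
Qed.

Lemma torus_int_exp_sum_sqr s : uniq s -> (forall n, n \in s -> integer_points n) ->
  torus_int (fun x => complex.Re (exp_sum s x) ^+ 2 + complex.Im (exp_sum s x) ^+ 2) =
  torus_volume R d * (size s)%:R.
Proof.
move=> us sZ; under eq_torus_int do rewrite exp_sum_sqr.
have cw n : continuous (wave n 0 : 'rV[R]_d -> R) by exact: (@continuous_wave R d n 0).
rewrite torus_int_sum => [|m]; last by apply: continuous_sum => n _; exact: cw.
have E : (size s)%:R = \sum_(m <- s) 1 :> R by rewrite big_const_seq count_predT iter_addr_0.
rewrite E mulr_sumr big_seq [RHS]big_seq; apply: eq_bigr => m ms.
rewrite torus_int_sum => [|n]; last exact: cw.
rewrite (bigD1_seq m)//= big_seq_cond big1 => [|n /andP[ns nm]]; last first.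
  apply: torus_int_wave; first exact: (integer_pointsD (sZ m ms) (integer_pointsN (sZ n ns))).
  by rewrite subr_eq0 eq_sym.
rewrite subrr addr0 mulr1 (@eq_torus_int _ _ _ (fun=> 1)); last by move=> x; rewrite /wave dot0l addr0 cos0.
by rewrite torus_int_cst mul1r.
Qed.

End TrigonometricSums.

(** * Gram determinants and transverse normals *)

Section Gram.
Context {R : realType}.

Lemma normr_det_le {n} (A : 'M[R]_n) : (forall i j, `|A i j| <= 1) -> `|\det A| <= n`!%:R.
Proof.
move=> A1; apply: le_trans (ler_norm_sum _ _ _) _.
apply: (@le_trans _ _ (\sum_(s : 'S_n) 1)).
  apply: ler_sum => s _; rewrite normrM normrX normrN1 expr1n mul1r normr_prod.
  by apply: prodr_ile1 => i _; rewrite normr_ge0 A1.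
by rewrite sumr_const (eq_card (B := {perm (ordinal n)})) // card_Sn.
Qed.

Lemma normr_adj_le {n} (A : 'M[R]_n) i j : (forall i j, `|A i j| <= 1) -> `|(\adj A) i j| <= n`!%:R.
Proof.
move=> A1; rewrite mxE normrM normrX normrN1 expr1n mul1r.
apply: (@le_trans _ _ (n.-1)`!%:R); last by rewrite ler_nat leq_fact// leq_pred.
by apply: normr_det_le => a b; rewrite !mxE.
Qed.

Definition gram_constant (k : nat) (g : R) : R := k%:R ^+ 2 * k`!%:R / g.

Context {k d : nat}.
Implicit Types (U : 'M[R]_(k, d)) (x w : 'rV[R]_d).

(** Identifies the entries so that unit rows give a Gram matrix with entries at most 1, as the
    determinant bounds require. *)
Lemma gramE U i j : (U *m U^T) i j = dot (row i U) (row j U).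
Proof. by rewrite mxE; apply: eq_bigr => l _; rewrite !mxE. Qed.

Lemma gram_dot_bound U (g b : R) (s : 'rV[R]_k) w : (forall i, enorm (row i U) = 1) -> 0 < g ->
  g <= \det (U *m U^T) -> (forall i, `|dot (row i U) w| <= b) ->
  `|dot (s *m U) w| <= gram_constant k g * b * enorm (s *m U).
Proof.
move=> U1 g0 gG wb; set x := s *m U; set G := U *m U^T in gG.
have G1 i j : `|G i j| <= 1.
  by rewrite gramE (le_trans (dot_le _ _))// !U1 mulr1.
have sE : \det G *: s = x *m U^T *m \adj G.
  by rewrite -(mulmxA s U) -/G -mulmxA mul_mx_adj mul_mx_scalar.
have s_le i : `|s 0 i| <= k%:R * enorm x * k`!%:R / g.
  rewrite ler_pdivlMr//; apply: (@le_trans _ _ `|(\det G *: s) 0 i|).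
    rewrite mxE normrM mulrC ler_wpM2r// (le_trans gG)//; exact: ler_norm.
  rewrite sE mxE; apply: le_trans (ler_norm_sum _ _ _) _.
  rewrite -mulrA mulr_natl -[X in _ *+ X](card_ord k) -sumr_const; apply: ler_sum => j _.
  rewrite normrM ler_pM//; last exact: normr_adj_le.
  by rewrite -dot_row_mulmx (le_trans (dot_le _ _))// U1 mul1r.
rewrite dot_mulmxE; apply: le_trans (ler_norm_sum _ _ _) _.
have -> : gram_constant k g * b * enorm x = \sum_(i < k) (k%:R * enorm x * k`!%:R / g) * b.
  by rewrite sumr_const card_ord /gram_constant -[RHS]mulr_natl; ring.
by apply: ler_sum => i _; rewrite normrM ler_pM.
Qed.

Definition transversality (k d : nat) : R := (d - k + 1)%:R `^ (- (k%:R / 2)).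

Lemma transversality_gt0 : 0 < transversality k d.
Proof. by apply: powR_gt0; rewrite ltr0n addn1. Qed.

Lemma transversality_le1 : transversality k d <= 1.
Proof.
apply: (@le_trans _ _ ((d - k + 1)%:R `^ 0)); last by rewrite powRr0.
by apply: ler_powR; rewrite ?ler1n ?addn1// oppr_le0 divr_ge0.
Qed.

Definition direction_mx (u : 'I_k -> 'rV[R]_d) : 'M[R]_(k, d) :=
  \matrix_i ((enorm (u i))^-1 *: u i).

Lemma row_direction_mx u i : row i (direction_mx u) = (enorm (u i))^-1 *: u i.
Proof. exact: rowK. Qed.

Lemma enorm_row_direction_mx u i : u i != 0 -> enorm (row i (direction_mx u)) = 1.
Proof.
by rewrite -enorm_gt0 => u0; rewrite row_direction_mx enormZ gtr0_norm ?invr_gt0// mulVf// gt_eqF.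
Qed.

(** Normalising the normals divides the wedge norm by the product of their lengths, which is the
    transversality quotient. For k = 1 no transversality is assumed, but the Gram matrix is the
    identity. *)
Lemma band_configuration_gram (u : 'I_k -> 'rV[R]_d) : (0 < k)%N -> band_configuration u ->
  transversality k d ^+ 2 <= \det (direction_mx u *m (direction_mx u)^T).
Proof.
move=> k0 [u0 ut]; set U := direction_mx u; have e0 i : 0 < enorm (u i) by rewrite enorm_gt0.
have rU i : row i U = (enorm (u i))^-1 *: u i := row_direction_mx u i.
have n0 := ltW transversality_gt0.
have [k2|k1] := leqP 2 k; last first.
  have {k1} kE : k = 1%N by apply/eqP; rewrite eqn_leq -ltnS k1.
  have -> : U *m U^T = 1%:M.
    apply/matrixP => i j; rewrite gramE !mxE.
    have -> : i = j by apply/ord_inj; have := ltn_ord i; have := ltn_ord j; lia.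
    by rewrite eqxx -sqr_enorm enorm_row_direction_mx// expr1n.
  by rewrite det1 expr_le1// transversality_le1.
have := ut k2; rewrite /transverse -/(transversality k d); set p := \prod_(i < k) _.
have p0 : 0 < p by apply: prodr_gt0 => i _.
have -> : wedge_norm u = p * Num.sqrt (\det (U *m U^T)).
  pose D : 'M[R]_k := diag_mx (\row_i enorm (u i)).
  have detD : \det D = p by rewrite det_diag; apply: eq_bigr => i _; rewrite mxE.
  rewrite /wedge_norm (_ : \matrix_(i, j) _ = D *m (U *m U^T) *m D).
    rewrite !det_mulmx detD mulrAC -expr2 sqrtrM ?sqr_ge0//.
    by rewrite sqrtr_sqr gtr0_norm.
  apply/matrixP => i j; rewrite mxE mul_mx_diag mul_diag_mx.
  rewrite [RHS]mxE [X in _ = X * _]mxE gramE !rU dotZl dotZr ![(\row__ _) _ _]mxE.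
  by field; rewrite !gt_eqF.
rewrite mulrC mulKf ?gt_eqF// => h.
have g0 : 0 < \det (U *m U^T) by rewrite -sqrtr_gt0 (lt_le_trans transversality_gt0).
by rewrite -(sqr_sqrtr (ltW g0)) lerXn2r// nnegrE// (le_trans n0).
Qed.

End Gram.

Lemma integral_sandwich {disp} {T : measurableType disp} {R : realType}
    (mu : {measure set T -> \bar R}) (S E : set T) (f : T -> R) (M m : R) :
  measurable S -> measurable E -> E `<=` S -> measurable_fun S (EFin \o f) ->
  (forall x, S x -> 0 <= f x <= M) -> 0 <= m -> (forall x, E x -> m <= f x) ->
  (m%:E * mu E <= \int[mu]_(x in S) (f x)%:E <= M%:E * mu S)%E.
Proof.
move=> mS mE ES mf fM m0 fm.
have f0 x : S x -> (0 <= (f x)%:E)%E by move/fM => /andP[]; rewrite lee_fin.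
have mfE : measurable_fun E (EFin \o f) by exact: measurable_funS mf.
apply/andP; split.
  rewrite -integral_cst//; apply: (@le_trans _ _ (\int[mu]_(x in E) (f x)%:E)%E).
    exact: ge0_le_integral.
  exact: ge0_subset_integral.
have [->|/set0P[x /fM/andP[h0 hM]]] := eqVneq S set0.
  by rewrite integral_set0 measure0 mule0.
rewrite -integral_cst//; apply: ge0_le_integral => //.
by move=> y /fM /andP[]; rewrite lee_fin.
Qed.

Section Sharpness.
Context {R : realType} {d : nat}.
Implicit Types (lambda : R).

Lemma gram_row_free {k} (U : 'M[R]_(k, d)) : 0 < \det (U *m U^T) -> row_free U.
Proof.
move=> g0; apply/row_freeP; exists (U^T *m invmx (U *m U^T)).
by rewrite mulmxA mulmxV// unitmxE unitfE gt_eqF.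
Qed.

Lemma sphere_seq_eigenvalue lambda : 0 < lambda -> @eigenvalue_of_torus R d (lambda ^+ 2) ->
  exists n, n \in sphere_seq d lambda.
Proof.
move=> l0 [e [ee [x ex]]]; case sE : (sphere_seq d lambda) => [|n s].
  have [er ei] := eigenfunction_parts ee.
  have := eigenfunction_sphere_nil l0 sE er x; have := eigenfunction_sphere_nil l0 sE ei x.
  by case: (e x) ex => a b /= ab b0 a0; move: ab; rewrite a0 b0 eqxx.
by exists n; rewrite mem_head.
Qed.

Lemma band_max_ge1 k (c0 : R) lambda (n : 'rV[R]_d) : (0 < k)%N -> (k <= d)%N -> 0 < c0 ->
  n \in sphere_seq d lambda -> 1 <= band_max d k c0 lambda.
Proof.
move=> k0 kd c00 /mem_sphere_seq[nZ nl]; have [W oW] := @orthonormal_rows_exist R d k kd.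
apply: (size_le_band_max (s := [:: n]) (x0 := fun=> n) k0 _ (orthonormal_band_configuration oW)) => //.
move=> m; rewrite inE => /eqP ->; split=> // i; split=> //.
by rewrite subrr dotC dot0l normr0 ltW.
Qed.

(** A near-maximum suffices: a count N within 1/2 of a supremum A >= 1 is a positive integer, and A
    < N + 1/2 <= 2 N. *)
Lemma band_max_adherent k (c0 : R) lambda : (0 < k)%N -> (k <= d)%N -> 1 <= band_max d k c0 lambda ->
  exists u x0 : 'I_k -> 'rV[R]_d, band_configuration u /\
    band_max d k c0 lambda <= 2 * (band_count c0 lambda u x0)%:R.
Proof.
move=> k0 kd A1; have [W oW] := @orthonormal_rows_exist R d k kd.
have hs : has_sup [set m : R | exists u x0 : 'I_k -> 'rV[R]_d,
    band_configuration u /\ m = (band_count c0 lambda u x0)%:R].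
  split; last exact: band_count_has_ubound.
  exists (band_count c0 lambda (fun i => row i W) (fun=> 0))%:R, (fun i => row i W), (fun=> 0).
  by split=> //; exact: orthonormal_band_configuration.
have half0 : 0 < 2^-1 :> R by rewrite invr_gt0.
have [_ [u [x0 [bu ->]]]] := sup_adherent half0 hs.
rewrite -/(band_max d k c0 lambda) => h; exists u, x0; split=> //.
have N1 : 1 <= (band_count c0 lambda u x0)%:R :> R.
  by rewrite ler1n -(ltr0n R); lra.
lra.
Qed.

Lemma restriction_sharp k (c0 C0 : R) : (0 < k)%N -> (k < d)%N -> 0 < c0 -> d%:R <= C0 ->
  exists c' C' : R, 0 < c' /\ c' <= C' /\
    forall lambda : R, 1 < lambda -> @eigenvalue_of_torus R d (lambda ^+ 2) ->
    exists (S : set 'rV[R]_d) (e : 'rV[R]_d -> R[i]),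
      totally_geodesic k C0 S /\ eigenfunction (lambda ^+ 2) e /\ nonzero e /\
      ((c' * Num.sqrt (band_max d k c0 lambda))%:E * L2_norm_torus e
         <= L2_norm k S e)%E /\
      (L2_norm k S e <=
       (C' * Num.sqrt (band_max d k c0 lambda))%:E * L2_norm_torus e)%E.
Proof.
move=> k0 kd c00 dC; have d0 : 0 < d%:R :> R by rewrite ltr0n (leq_trans _ kd).
have [rho rho0 discW] := @unit_measure_disc R k d k0 kd.
pose nu : R := transversality k d ^+ 2.
have nu0 : 0 < nu by rewrite exprn_gt0// transversality_gt0.
(* 2 c0 bounds the component, along a band's normal, of the difference of two points of the band. *)
pose K := gram_constant k nu * (2 * c0).
have K0 : 0 <= K.
  apply: mulr_ge0; last by rewrite mulr_ge0// ltW.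
  by rewrite divr_ge0 ?(ltW nu0)// mulr_ge0// sqr_ge0.
(* At most [rho], so that the small disc lies inside the submanifold; small enough for all phases (m
   - n).x to stay within 1/2 on it. *)
pose eps := Num.min rho (2 * (K + 1))^-1.
have K1 : 0 < 2 * (K + 1) by rewrite mulr_gt0// ltr_wpDl.
have eps0 : 0 < eps by rewrite lt_min rho0 invr_gt0.
have Keps : K * eps <= 2^-1.
  apply: (@le_trans _ _ (K * (2 * (K + 1))^-1)); first by rewrite ler_wpM2l// ge_min lexx orbT.
  rewrite ler_pdivrMr//; lra.
pose kappa := (eps / d%:R) ^+ k.
have kappa0 : 0 < kappa by rewrite exprn_gt0// divr_gt0.
set V := torus_volume R d; have V0 : 0 < V := torus_volume_gt0.
(* With N points, |e|^2 >= N^2 / 2 on a disc of measure at least kappa, A <= 2 N, and the squared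
   torus norm is V N; so N^2 kappa / 2 >= kappa / (4 V) * A * (V N). *)
pose c' := Num.sqrt (kappa / (4 * V)).
have c'0 : 0 < c' by rewrite sqrtr_gt0 divr_gt0// mulr_gt0.
(* Above, |e|^2 <= N^2 on a set of measure 1 and N <= A give the constant V^-1/2; adding [c']
   secures c' <= C'. *)
exists c', (c' + Num.sqrt V^-1); split=> //; split; first by rewrite lerDl sqrtr_ge0.
move=> lambda l1 ev; have l0 : 0 < lambda := lt_trans ltr01 l1.
have [n0 n0s] := sphere_seq_eigenvalue l0 ev.
set A := band_max d k c0 lambda.
have A1 : 1 <= A := band_max_ge1 k0 (ltnW kd) c00 n0s.
have [u [x0 [bu AN]]] := band_max_adherent k0 (ltnW kd) A1.
have AN' := band_count_le_max c0 lambda k0 x0 bu.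
set F := enum_fset (fset_set (integer_points `&` \bigcap_i band c0 lambda (u i) (x0 i))).
rewrite -/A -[band_count _ _ _ _]/(size F) in AN AN'.
have uF : uniq F by exact: fset_uniq.
have memF n : n \in F -> integer_points n /\ forall i, band c0 lambda (u i) (x0 i) n.
  rewrite (in_fset_set (band_set_finite c0 lambda k0 u x0)) => /set_mem[nZ nb].
  by split=> // i; exact: nb.
have FZ n : n \in F -> integer_points n by move/memF => [].
have N0 : 0 < (size F)%:R :> R by lra.
have gU := band_configuration_gram k0 bu; set U := direction_mx u in gU.
have [W [oW [B [_ [WE _]]]]] := gram_schmidt (gram_row_free (lt_le_trans nu0 gU)).
have [r /andP[rr rd] [H1 He]] := discW W oW.
have small x : disc W eps x -> forall m n, m \in F -> n \in F -> `|dot (m - n) x| <= 2^-1.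
  move=> [[t _ tx] /= xe] m n /memF[_ mb] /memF[_ nb]; rewrite dotC.
  (* The plane of the disc lies in the span of the unit normals, where [gram_dot_bound] controls (m
     - n).x by |x|. *)
  have xE : x = t *m B *m U by rewrite -tx add0r WE mulmxA.
  rewrite xE; apply: le_trans (_ : _ <= K * enorm (t *m B *m U)) _; last first.
    by rewrite -xE (le_trans _ Keps)// ler_wpM2l// ltW.
  have U1 i : enorm (row i U) = 1 by apply: enorm_row_direction_mx; have [u0 _] := bu.
  apply: (gram_dot_bound (b := 2 * c0) (t *m B) U1 nu0 gU) => i.
  rewrite row_direction_mx; have [_ hm] := mb i; have [_ hn] := nb i.
  have -> : m - n = (m - x0 i) - (n - x0 i) by rewrite opprB addrA subrK.
  by rewrite dotBr (le_trans (ler_normB _ _))//; lra.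
pose S := disc W r; pose e := exp_sum F.
have ee : eigenfunction (lambda ^+ 2) e.
  apply: exp_sum_eigenfunction => n /memF[nZ nb]; split=> //.
  by have [nl _] := nb (Ordinal k0); rewrite -sqr_enorm nl.
have [cr ci] := eigenfunction_continuous ee.
exists S, e; split; first exact: (disc_totally_geodesic oW H1 (le_trans rd dC)).
split=> //; split.
  exists 0; rewrite /e exp_sum0; apply/eqP => -[]; apply/eqP; exact: lt0r_neq0.
have cr2 : continuous (fun x => complex.Re (e x) ^+ 2) by apply: (continuous_mul cr).
have ci2 : continuous (fun x => complex.Im (e x) ^+ 2) by apply: (continuous_mul ci).
have nT : L2_norm_torus e = (Num.sqrt (V * (size F)%:R))%:E.
  by rewrite L2_norm_torusE// -torus_intD// torus_int_exp_sum_sqr.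
have mS := disc_measurable oW r.
have sub : disc W eps `<=` S.
  move=> x [Px /= xe]; split=> //=; apply: lt_le_trans xe _; apply: le_trans rr.
  by rewrite ge_min lexx.
pose f x : R := complex.Re (e x) ^+ 2 + complex.Im (e x) ^+ 2.
have cf : continuous f by exact: continuous_add.
have mf : measurable_fun (S : set (caratheodory_type (@hausdorff_outer R d k))) (EFin \o f).
  by apply/measurable_EFinP; exact: continuous_measurable_hausdorff.
have f0 x : 0 <= f x by rewrite addr_ge0 ?sqr_ge0.
have := @integral_sandwich _ _ R (@hausdorff_measure R d k) S (disc W eps) f ((size F)%:R ^+ 2)
  ((size F)%:R ^+ 2 / 2) mS (disc_measurable oW eps) sub mf.
move=> /(_ (fun x _ => introT andP (conj (f0 x) (exp_sum_sqr_le F x)))).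
move=> /(_ (divr_ge0 (sqr_ge0 _) (ler0n R 2)) (fun x xe => exp_sum_sqr_ge (small x xe))) /andP[lo up].
have eS : L2_norm k S e = sqrte (\int[@hausdorff_measure R d k]_(x in S) (f x)%:E).
  exact: L2_normE.
rewrite nT eS; move: lo up; set I := (X in (_ <= X)%E) => lo up.
have upE : (I <= ((size F)%:R ^+ 2)%:E)%E.
  by apply: le_trans up _; rewrite [X in (_ * X)%E]H1 mule1.
have loE : (((size F)%:R ^+ 2 / 2 * kappa)%:E <= I)%E.
  apply: le_trans lo; rewrite EFinM; apply: lee_wpmul2l; last exact: He.
  by rewrite lee_fin divr_ge0 ?sqr_ge0.
have VN : 0 <= V * (size F)%:R by rewrite mulr_ge0// ltW.
have sqrtE c : 0 <= c -> ((c * Num.sqrt A)%:E * (Num.sqrt (V * (size F)%:R))%:E =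
    sqrte (c ^+ 2 * A * (V * (size F)%:R))%:E)%E.
  move=> c_ge0; have A0 : 0 <= A by lra.
  by rewrite -EFinM /= (sqrtrM _ (mulr_ge0 (sqr_ge0 c) A0)) (sqrtrM _ (sqr_ge0 c)) sqrtr_sqr ger0_norm.
have C0' : 0 <= c' + Num.sqrt V^-1 by rewrite addr_ge0 ?sqrtr_ge0.
rewrite !sqrtE ?(ltW c'0)//; split.
  rewrite lee_sqrt; last by rewrite (le_trans _ loE)// lee_fin !mulr_ge0 ?sqr_ge0 ?(ltW kappa0)// invr_ge0.
  apply: le_trans _ loE; rewrite lee_fin sqr_sqrtr; last by rewrite ltW// divr_gt0// mulr_gt0.
  have -> : kappa / (4 * V) * A * (V * (size F)%:R) = kappa * (size F)%:R * A / 4.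
    by field; rewrite gt_eqF.
  have -> : (size F)%:R ^+ 2 / 2 * kappa = kappa * (size F)%:R * (2 * (size F)%:R) / 4 by field.
  by rewrite ler_pM2r// ler_wpM2l// mulr_ge0// ltW.
have A0 : 0 <= A by lra.
rewrite lee_sqrt; last by rewrite lee_fin mulr_ge0// mulr_ge0// sqr_ge0.
apply: le_trans upE _; rewrite lee_fin.
apply: (@le_trans _ _ (V^-1 * A * (V * (size F)%:R))).
  have -> : V^-1 * A * (V * (size F)%:R) = (size F)%:R * A by field; rewrite gt_eqF.
  by rewrite expr2 ler_wpM2l.
rewrite ler_wpM2r// ler_wpM2r// -[leLHS]sqr_sqrtr ?invr_ge0 ?(ltW V0)//.
by rewrite lerXn2r ?nnegrE ?sqrtr_ge0// lerDr ltW.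
Qed.

End Sharpness.

Unset Implicit Arguments.
Set Strict Implicit.
Set Printing Implicit Defensive.

Theorem theorem3 (R : realType) (d k : nat) (hd : (3 <= d)%N)
  (hk : (1 <= k <= d - 1)%N) (c0 C0 : R) (hc0 : 0 < c0) (hC0 : d%:R <= C0) :
  (exists C : R, 0 < C /\
    forall S : set 'rV[R]_d, totally_geodesic k C0 S ->
    forall lambda : R, 1 < lambda ->
    forall e : 'rV[R]_d -> R[i], eigenfunction (lambda ^+ 2) e ->
      (L2_norm k S e <=
       (C * Num.sqrt (band_max d k c0 lambda) * ln lambda `^ (k%:R / 2))%:E *
       L2_norm_torus e)%E)
  /\
  (exists c' C' : R, 0 < c' /\ c' <= C' /\
    forall lambda : R, 1 < lambda -> @eigenvalue_of_torus R d (lambda ^+ 2) ->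
    exists (S : set 'rV[R]_d) (e : 'rV[R]_d -> R[i]),
      totally_geodesic k C0 S /\ eigenfunction (lambda ^+ 2) e /\ nonzero e /\
      ((c' * Num.sqrt (band_max d k c0 lambda))%:E * L2_norm_torus e
         <= L2_norm k S e)%E /\
      (L2_norm k S e <=
       (C' * Num.sqrt (band_max d k c0 lambda))%:E * L2_norm_torus e)%E).
Proof.
have /andP[k0 kd1] := hk; have kd : (k < d)%N by lia.
have d0 : 0 < d%:R :> R by rewrite ltr0n; lia.
split; first exact: restriction_upper_bound k0 (ltnW kd) hc0 (lt_le_trans d0 hC0).
exact: restriction_sharp.
Qed.
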